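(* Let $d\ge1$, $\gamma>1$, $c>0$, $\beta\in\mathbb{R}$ and $\lambda_1,\dots,\lambda_d>0$. For $i=1,\dots,d$ let $(Z^{(i)}_j)_{j\ge1}$ be i.i.d. almost surely non-negative random variables with $P(Z^{(i)}_1>x)=c\,x^{\beta}e^{-\lambda_i\log^\gamma x}$ for all sufficiently large $x$, the $d$ sequences being independent of each other. For $n\ge1$ and $t\in[0,1]$ let $$\bar S^{(i)}_n(t)=\frac1n\sum_{j=1}^{\lfloor nt\rfloor}\big(Z_j^{(i)}-E[Z_1^{(i)}]\big),\qquad\bar{\boldsymbol S}_n=(\bar S_n^{(1)},\dots,\bar S_n^{(d)}).$$ Then $\{\bar{\boldsymbol S}_n\}_{n\ge1}$ satisfies the extended LDP on $\big(\prod_{i=1}^d\mathbb{D},\sum_{i=1}^dd_{J_1}\big)$ with speed $\log^\gamma n$ and rate function $$\tilde I^d(\xi_1,\dots,\xi_d)=\begin{cases}\sum_{i=1}^d\lambda_i\sum_{t\in[0,1]}\mathbf 1\{\xi_i(t)\ne\xi_i(t-)\}&\text{if }(\xi_1,\dots,\xi_d)\in\prod_{i=1}^d\tilde{\mathbb{D}}_{<\infty},\\ \infty&\text{otherwise.}\end{cases}$$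
   Context: Notation: $\log^\gamma x=(\log x)^\gamma$. $\mathbb{D}$ is the space of real-valued càdlàg functions on $[0,1]$, with convention $\xi(0-)=0$. The $J_1$ metric is $d_{J_1}(\xi,\zeta)=\inf_{\lambda\in\Lambda}\max(\|\lambda-e\|,\|\xi\circ\lambda-\zeta\|)$, where $\|\cdot\|$ is the sup norm on $[0,1]$, $\Lambda$ is the set of non-decreasing homeomorphisms of $[0,1]$, and $e$ is the identity map. On $\prod_{i=1}^d\mathbb{D}$ the metric is the sum of the coordinatewise $J_1$ distances. $\tilde{\mathbb{D}}_{<\infty}$ is the set of $\xi\in\mathbb{D}$ that are non-decreasing pure jump functions with $\xi(0)=0$ and finitely many jumps; i.e. $\xi=\sum_{i=1}^jz_i\mathbf 1_{[t_i,1]}$ with $j\ge0$, $z_i>0$ and distinct $t_i\in(0,1]$. Extended LDP: for a metric space $(S,d)$ and $A\subseteq S$ let $d(x,A)=\inf_{y\in A}d(x,y)$ and $A^\epsilon=\{x\in S:d(x,A)\le\epsilon\}$. Random elements $Y_n$ of $S$ satisfy the extended LDP on $(S,d)$ with rate function $I$ and speed $a_n\to\infty$ if $I:S\to[0,\infty]$ is lower semicontinuous and for every open $G$ and every closed $F$, $-\inf_{x\in G}I(x)\le\liminf_{n\to\infty}\frac{\log P(Y_n\in G)}{a_n}$ and $\limsup_{n\to\infty}\frac{\log P(Y_n\in F)}{a_n}\le-\lim_{\epsilon\downarrow0}\inf_{x\in F^\epsilon}I(x)$ (with $\inf\emptyset=+\infty$, $\log 0=-\infty$). *)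

(* Defs.v *)
From HB Require Import structures.
From mathcomp Require Import all_boot all_order all_algebra.
From mathcomp Require Import all_classical all_reals all_analysis.
From mathcomp Require Import ring lra.
Set Implicit Arguments.
Unset Strict Implicit.
Unset Printing Implicit Defensive.
Import Order.TTheory GRing.Theory Num.Theory.
Import numFieldNormedType.Exports.
Local Open Scope classical_set_scope.
Local Open Scope ring_scope.

Section skorokhod.
Variable R : realType.
Implicit Types (f g l m : R -> R) (s t e : R).

Definition cadlag f : Prop :=
  (forall t, 0 <= t < 1 -> f x @[x --> t^'+] --> f t) /\
  (forall t, 0 < t <= 1 -> cvg (f x @[x --> t^'-])).

(* A path on [0,1] is stored as its extension by 0 to R.  This makes Leibniz
   equality of paths the equality of functions on [0,1], and it makes the left
   limit at 0 equal to 0, which is the convention xi(0-) = 0. *)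
Record skorokhod : Type := Skorokhod {
  skorokhod_fun :> R -> R;
  skorokhod_cadlag : cadlag skorokhod_fun;
  skorokhod_out : forall t, t \notin `[0, 1] -> skorokhod_fun t = 0 }.
Implicit Types xi zeta eta : skorokhod.

Definition left_lim f t : R := lim (f x @[x --> t^'-]).

Definition supnorm f : R := sup [set `|f t| | t in `[0, 1]%classic].

Definition homeo01 l : Prop :=
  [/\ {homo l : t / t \in `[0, 1]},
      {within `[0, 1]%classic, continuous l} &
      exists m, [/\ {homo m : t / t \in `[0, 1]},
        {within `[0, 1]%classic, continuous m},
        {in `[0, 1], cancel l m} & {in `[0, 1], cancel m l}]].

Definition time_change l : Prop :=
  homeo01 l /\ {in `[0, 1] &, {homo l : s t / s <= t}}.

Definition dJ1 xi zeta : R :=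
  inf [set Num.max (supnorm (l \- id)) (supnorm ((xi \o l) \- zeta))
      | l in time_change].

Lemma skorokhod_eq xi zeta : (xi : R -> R) = zeta -> xi = zeta.
Proof.
case: xi zeta => [f cf of_] [g cg og] /= E; subst g.
by congr Skorokhod; exact: Prop_irrelevance.
Qed.

Lemma skorokhod_far xi s : (s < 0) || (1 < s) -> xi s = 0.
Proof. by move=> h; apply: skorokhod_out; rewrite in_itv/= negb_and -!ltNge. Qed.

Let cvg_near_le (F : set_system R) f (y : R) : Filter F ->
  f x @[x --> F] --> y -> \forall s \near F, `|f s| <= `|y| + 1.
Proof.
move=> FF /cvgrPdist_le/(_ _ ltr01); apply: filterS => s h.
rewrite -(subrK y (f s)) (le_trans (ler_normD _ _))//.
by rewrite addrC lerD2l distrC.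
Qed.

Lemma skorokhod_near_bounded xi t :
  exists M, \forall s \near t, `|xi s| <= M.
Proof.
have [M1 R1] : exists M, \forall s \near t^'+, `|xi s| <= M.
  have [t01|] := boolP (0 <= t < 1).
    exists (`|xi t| + 1); apply: cvg_near_le.
    exact: (skorokhod_cadlag xi).1.
  rewrite negb_and -ltNge -leNgt => /orP[t0|t1]; exists 0.
    near=> s; rewrite skorokhod_far ?normr0//; apply/orP; left.
    by near: s; exact: nbhs_right_lt.
  near=> s; rewrite skorokhod_far ?normr0//; apply/orP; right.
  by rewrite (le_lt_trans t1).
have [M2 R2] : exists M, \forall s \near t^'-, `|xi s| <= M.
  have [t01|] := boolP (0 < t <= 1).
    exists (`|left_lim xi t| + 1); apply: cvg_near_le.
    exact: (skorokhod_cadlag xi).2.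
  rewrite negb_and -leNgt -ltNge => /orP[t0|t1]; exists 0.
    near=> s; rewrite skorokhod_far ?normr0//; apply/orP; left.
    by rewrite (lt_le_trans _ t0).
  near=> s; rewrite skorokhod_far ?normr0//; apply/orP; right.
  by near: s; exact: nbhs_left_gt.
exists (Num.max (Num.max M1 M2) `|xi t|).
move: R1 R2; rewrite !near_withinE/= => R1 R2.
near=> s; have [st|ts|->] := ltgtP s t; rewrite !le_max ?lexx ?orbT//.
  suff -> : `|xi s| <= M2 by rewrite orbT.
  by move: st; near: s.
suff -> : `|xi s| <= M1 by [].
by move: ts; near: s.
Unshelve. all: by end_near. Qed.

Lemma skorokhod_bounded xi : exists M, forall t, `|xi t| <= M.
Proof.
have /compact_near_coveringP cK := @segment_compact R 0 1.
have : \forall M \near +oo, (`[0, 1]%classic : set R) `<=` (fun s => `|xi s| <= M).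
  apply: cK => t _; have [M0 HM] := skorokhod_near_bounded xi t.
  exists ([set s | `|xi s| <= M0], [set M | M0 <= M]) => /=.
    by split; [exact: HM|apply: nbhs_pinfty_ge; exact: num_real].
  by move=> [s M] [/= h1 h2]; exact: le_trans h2.
move=> /filter_ex[M HM]; exists M => t.
have [t01|t01] := boolP (t \in `[0, 1]); first exact: HM.
rewrite skorokhod_out// normr0 (le_trans _ (HM 0 _))//=.
by rewrite in_itv/= lexx ler01.
Qed.

Let zero01 : (0 : R) \in `[0, 1]. Proof. by rewrite in_itv/= lexx ler01. Qed.

Lemma supnorm_le f e : {in `[0, 1], forall t, `|f t| <= e} -> supnorm f <= e.
Proof.
move=> fe; apply: ge_sup; first by exists `|f 0|; exists 0.
by move=> _ [t t01 <-]; exact: fe.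
Qed.

Lemma le_supnorm f e t : {in `[0, 1], forall t, `|f t| <= e} ->
  t \in `[0, 1] -> `|f t| <= supnorm f.
Proof.
move=> fe t01; apply: sup_upper_bound; last by exists t.
split; first by exists `|f 0|; exists 0.
by exists e => _ [u u01 <-]; exact: fe.
Qed.

Lemma supnorm_ge0 f : 0 <= supnorm f.
Proof.
rewrite /supnorm; set A := [set _ | _ in _].
have [hA|/sup_out->//] := pselect (has_sup A).
rewrite (le_trans (normr_ge0 (f 0)))//.
by apply: sup_upper_bound => //; exists 0.
Qed.

Lemma time_change_id : time_change id.
Proof.
have cid : {within `[0, 1]%classic, continuous (id : R -> R)}.
  by apply: continuous_subspaceT => x; exact: cvg_id.
by split=> //; split=> //; exists id; split.
Qed.

Let within_comp l m : {homo l : t / t \in `[0, 1]} ->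
  {within `[0, 1]%classic, continuous l} ->
  {within `[0, 1]%classic, continuous m} ->
  {within `[0, 1]%classic, continuous (m \o l)}.
Proof.
move=> l01 /subspace_continuousP cl /subspace_continuousP cm.
apply/subspace_continuousP => t t01.
apply: cvg_comp (cm _ (l01 _ t01)) => A /(cl _ t01).
rewrite /fmap /within /nbhs/=.
by apply: filterS => s + s01 => /(_ s01); apply; exact: l01.
Qed.

Lemma time_change_comp l m :
  time_change l -> time_change m -> time_change (m \o l).
Proof.
move=> [[l01 cl [l' [l'01 cl' ll' l'l]]] hl] [[m01 cm [m' [m'01 cm' mm' m'm]]] hm].
split; last first.
  by move=> s t s01 t01 st; apply: hm; [exact: l01|exact: l01|exact: hl].
split; first by move=> t /l01 /m01.
  exact: within_comp.
exists (l' \o m'); split; first by move=> t /m'01 /l'01.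
- exact: within_comp.
- by move=> t t01 /=; rewrite mm' ?ll'//; exact: l01.
- by move=> t t01 /=; rewrite l'l ?m'm//; exact: m'01.
Qed.

Lemma time_change_inv l : time_change l -> exists m,
  [/\ time_change m, {in `[0, 1], cancel l m} & {in `[0, 1], cancel m l}].
Proof.
move=> [[l01 cl [m [m01 cm lm ml]]] hl]; exists m; split => //; split.
  by split=> //; exists l.
move=> s t s01 t01 st; rewrite leNgt; apply/negP => mts.
have := hl _ _ (m01 _ t01) (m01 _ s01) (ltW mts); rewrite !ml// => ts.
have E : s = t by apply/eqP; rewrite eq_le st ts.
by rewrite E ltxx in mts.
Qed.

Definition J1_within e xi zeta := exists2 l, time_change l &
  {in `[0, 1], forall t, `|l t - t| <= e /\ `|xi (l t) - zeta t| <= e}.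

Let cost_has_lbound xi zeta : has_lbound
  [set Num.max (supnorm (l \- id)) (supnorm ((xi \o l) \- zeta))
      | l in time_change].
Proof.
by exists 0 => _ [l _ <-]; rewrite le_max supnorm_ge0.
Qed.

Lemma J1_within_le e xi zeta : J1_within e xi zeta -> dJ1 xi zeta <= e.
Proof.
move=> [l tl H]; apply: (@le_trans _ _
  (Num.max (supnorm (l \- id)) (supnorm ((xi \o l) \- zeta)))).
  by apply: ge_inf; [exact: cost_has_lbound|exists l].
by rewrite ge_max; apply/andP; split; apply: supnorm_le => t /H[].
Qed.

Lemma dJ1_lt_within e xi zeta : dJ1 xi zeta < e -> J1_within e xi zeta.
Proof.
move=> /inf_lt => /(_ _)[|_ [l tl <-]].
  by eexists; exists id; first exact: time_change_id.
rewrite gt_max => /andP[h1 h2]; exists l => // t t01; split.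
  rewrite (le_trans _ (ltW h1))//.
  apply: (@le_supnorm (l \- id) (1 + 1)) => // {t t01} t t01 /=.
  have := tl.1; case => /(_ _ t01) + _ _; move: t01; rewrite !in_itv/=.
  move=> /andP[t0 t1] /andP[l0 l1].
  by rewrite (le_trans (ler_normB _ _))// lerD// ger0_norm.
rewrite (le_trans _ (ltW h2))//.
have [M1 H1] := skorokhod_bounded xi; have [M2 H2] := skorokhod_bounded zeta.
apply: (@le_supnorm ((xi \o l) \- zeta) (M1 + M2)) => // {t t01} t t01 /=.
by rewrite (le_trans (ler_normB _ _))// lerD.
Qed.

Lemma dJ1_ge0 xi zeta : 0 <= dJ1 xi zeta.
Proof.
apply: lb_le_inf; first by eexists; exists id; [exact: time_change_id|].
by move=> _ [l _ <-]; rewrite le_max supnorm_ge0.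
Qed.

Lemma dJ1xx xi : dJ1 xi xi = 0.
Proof.
apply/eqP; rewrite eq_le dJ1_ge0 andbT; apply: J1_within_le.
exists id; first exact: time_change_id.
by move=> t _; rewrite !subrr normr0.
Qed.

Lemma dJ1_sym xi zeta : dJ1 xi zeta = dJ1 zeta xi.
Proof.
suff H : forall x z, dJ1 x z <= dJ1 z x by apply/eqP; rewrite eq_le !H.
move=> x z; apply/ler_addgt0Pl => e e0.
have /dJ1_lt_within[l tl H] : dJ1 z x < e + dJ1 z x by rewrite ltrDr.
have [m [tm lm ml]] := time_change_inv tl.
apply: J1_within_le; exists m => // t t01.
have /H : m t \in `[0, 1] by have [[+ _ _] _] := tm; apply.
by rewrite ml// distrC => -[? ?]; rewrite (distrC (x _)).
Qed.

Lemma dJ1_triangle zeta xi eta : dJ1 xi eta <= dJ1 xi zeta + dJ1 zeta eta.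
Proof.
apply/ler_addgt0Pl => e e0; have e20 : 0 < e / 2 by rewrite divr_gt0.
have /dJ1_lt_within[l tl H] : dJ1 xi zeta < e / 2 + dJ1 xi zeta.
  by rewrite ltrDr.
have /dJ1_lt_within[m tm K] : dJ1 zeta eta < e / 2 + dJ1 zeta eta.
  by rewrite ltrDr.
rewrite [e]splitr addrACA.
apply: J1_within_le; exists (l \o m); first exact: time_change_comp.
move=> t t01 /=; have [K1 K2] := K _ t01.
have /H[H1 H2] : m t \in `[0, 1] by have [[+ _ _] _] := tm; apply.
split.
  rewrite (_ : _ - _ = (l (m t) - m t) + (m t - t)); last by ring.
  by rewrite (le_trans (ler_normD _ _))// lerD.
rewrite (_ : _ - _ = (xi (l (m t)) - zeta (m t)) + (zeta (m t) - eta t));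
  last by ring.
by rewrite (le_trans (ler_normD _ _))// lerD.
Qed.

Let homeo01_endpoint l : time_change l -> l 1 = 1.
Proof.
move=> tl; have [[l01 _ _] hl] := tl.
have [m [[[m01 _ _] _] lm ml]] := time_change_inv tl.
have i1 : (1 : R) \in `[0, 1] by rewrite in_itv/= ler01 lexx.
apply/eqP; rewrite eq_le; apply/andP; split.
  by have := l01 _ i1; rewrite in_itv/= => /andP[].
rewrite -{1}(ml _ i1); apply: hl => //; first exact: m01.
by have := m01 _ i1; rewrite in_itv/= => /andP[].
Qed.

Lemma dJ1_positivity xi zeta : dJ1 xi zeta = 0 -> xi = zeta.
Proof.
move=> d0; apply/skorokhod_eq/funext => t.
have W e : 0 < e -> J1_within e xi zeta.
  by move=> e0; apply: dJ1_lt_within; rewrite d0.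
have [t01|t01] := boolP (t \in `[0, 1]); last by rewrite !skorokhod_out.
have [t1|t1] := ltP t 1; last first.
  have {t1 t01}-> : t = 1.
    by apply/eqP; rewrite eq_le t1 andbT; move: t01; rewrite in_itv/= => /andP[].
  apply/eqP; rewrite -subr_eq0 -normr_le0; apply/ler_addgt0Pl => e /W[l tl H].
  have i1 : (1 : R) \in `[0, 1] by rewrite in_itv/= ler01 lexx.
  by have [_] := H _ i1; rewrite addr0 (homeo01_endpoint tl).
have t0 : 0 <= t by move: t01; rewrite in_itv/= => /andP[].
apply/eqP; rewrite -subr_eq0 -normr_le0; apply/ler_addgt0Pl => e e0.
rewrite addr0; have e30 : 0 < e / 3 by rewrite divr_gt0.
have t011 : 0 <= t < 1 by rewrite t0.
have /cvgrPdist_le/(_ _ e30) Hx := (skorokhod_cadlag xi).1 _ t011.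
have /cvgrPdist_le/(_ _ e30) Hz := (skorokhod_cadlag zeta).1 _ t011.
have [r r0 Hr] : exists2 r, 0 < r & forall s, t < s < t + r ->
    [/\ `|xi t - xi s| <= e / 3, `|zeta t - zeta s| <= e / 3 & s < 1].
  have : \forall s \near t^'+,
     [/\ `|xi t - xi s| <= e / 3, `|zeta t - zeta s| <= e / 3 & s < 1].
    near=> s; split; near: s => //; exact: nbhs_right_lt.
  move=> [/= r r0 Hr]; exists r => // s /andP[ts sr]; apply: Hr => //=.
  by rewrite distrC gtr0_norm ?subr_gt0// ltrBlDl.
pose e' := Num.min (e / 3) (r / 3).
have e'0 : 0 < e' by rewrite lt_min e30 divr_gt0.
have [l tl H] := W _ e'0.
have [h1 h2 h3] : [/\ `|xi t - xi (t + r / 2)| <= e / 3,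
    `|zeta t - zeta (t + r / 2)| <= e / 3 & t + r / 2 < 1].
  by apply: Hr; apply/andP; split; lra.
have i2 : t + r / 2 \in `[0, 1].
  by rewrite in_itv/=; apply/andP; split; lra.
have [] := H _ i2; rewrite !le_min => /andP[_ k1] /andP[k2 _].
have [j1 j2 j3] : [/\ `|xi t - xi (l (t + r / 2))| <= e / 3,
    `|zeta t - zeta (l (t + r / 2))| <= e / 3 & l (t + r / 2) < 1].
  by apply: Hr; move: k1; rewrite ler_norml => /andP[? ?]; apply/andP; split; lra.
have -> : xi t - zeta t = (xi t - xi (l (t + r / 2))) +
  (xi (l (t + r / 2)) - zeta (t + r / 2)) - (zeta t - zeta (t + r / 2)) by ring.
have -> : e = e / 3 + e / 3 + e / 3 by field.
rewrite (le_trans (ler_normB _ _))// lerD//.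
by rewrite (le_trans (ler_normD _ _))// lerD.
Unshelve. all: by end_near. Qed.
End skorokhod.

HB.instance Definition _ (R : realType) := gen_eqMixin (skorokhod R).
HB.instance Definition _ (R : realType) := gen_choiceMixin (skorokhod R).
HB.instance Definition _ (R : realType) := isMetric.Build R (skorokhod R)
  (@dJ1xx R) (@dJ1_positivity R) (@dJ1_sym R) (@dJ1_triangle R).

(* The library metrizes products by the maximum of the coordinate distances;
   this copy of S^d carries their sum. *)
Definition sum_prod (R : realType) (S : metricType R) (d : nat) : Type :=
  'I_d -> S.

Section sum_prod.
Variables (R : realType) (S : metricType R) (d : nat).
Implicit Types x y z : sum_prod S d.

Definition sum_dist x y : R := \sum_(i < d) mdist (x i) (y i).

Lemma sum_distxx x : sum_dist x x = 0.
Proof. by rewrite /sum_dist big1// => i _; exact: mdistxx. Qed.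

Lemma sum_dist_positivity x y : sum_dist x y = 0 -> x = y.
Proof.
move=> /eqP; rewrite psumr_eq0; last by move=> i _; exact: mdist_ge0.
move=> /allP xy; apply/funext => i; apply/mdist_positivity/eqP.
exact/(xy i)/mem_index_enum.
Qed.

Lemma sum_dist_sym x y : sum_dist x y = sum_dist y x.
Proof. by apply: eq_bigr => i _; exact: metric_sym. Qed.

Lemma sum_dist_triangle y x z : sum_dist x z <= sum_dist x y + sum_dist y z.
Proof.
by rewrite -big_split/=; apply: ler_sum => i _; exact: metric_triangle.
Qed.

HB.instance Definition _ := gen_eqMixin (sum_prod S d).
HB.instance Definition _ := gen_choiceMixin (sum_prod S d).
HB.instance Definition _ := isMetric.Build R (sum_prod S d)
  sum_distxx sum_dist_positivity sum_dist_sym sum_dist_triangle.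
End sum_prod.

Section extended_LDP.
Local Open Scope ereal_scope.
Variables (R : realType) (dT : measure_display) (T : measurableType dT).
Variables (P : probability T R) (S : metricType R).

Definition dist_to (x : S) (A : set S) : \bar R :=
  ereal_inf [set (mdist x y)%:E | y in A].

Definition fattening (A : set S) (e : R) : set S :=
  [set x | dist_to x A <= e%:E].

Record extended_LDP (Y : nat -> T -> S) (I : S -> \bar R) (a : nat -> R) :
    Prop := {
  LDP_random_element : forall n G, open G -> measurable (Y n @^-1` G);
  LDP_speed : a n @[n --> \oo] --> +oo%R;
  LDP_rate_ge0 : forall x, 0 <= I x;
  LDP_rate_lsc : lower_semicontinuous I;
  LDP_lower : forall G, open G ->
    - ereal_inf [set I x | x in G] <=
    limn_einf (fun n => lne (P (Y n @^-1` G)) / (a n)%:E);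
  LDP_upper : forall F, closed F ->
    limn_esup (fun n => lne (P (Y n @^-1` F)) / (a n)%:E) <=
    - lim (ereal_inf [set I x | x in fattening F e] @[e --> 0%R^'+]) }.

End extended_LDP.

Section independence.
Local Open Scope ereal_scope.
Variables (R : realType) (dT : measure_display) (T : measurableType dT).
Variable P : probability T R.

(* F i is meant to be a sigma-algebra of events *)
Definition mutually_independent (I : eqType) (F : I -> set (set T)) : Prop :=
  forall (s : seq I) (A : I -> set T), uniq s ->
    (forall i, i \in s -> F i (A i)) ->
    P (\bigcap_(i in [set` s]) A i) = \prod_(i <- s) P (A i).

Definition sigma_RV (X : T -> R) : set (set T) :=
  preimage_set_system setT X measurable.

Definition sigma_RVs (X : nat -> T -> R) : set (set T) :=
  <<s \bigcup_j sigma_RV (X j) >>.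

Definition iid (X : nat -> {RV P >-> R}) : Prop :=
  mutually_independent (fun j => sigma_RV (X j)) /\
  forall j (A : set R), measurable A ->
    distribution P (X j) A = distribution P (X 0%N) A.

End independence.

Section random_walk.
Variable R : realType.
Implicit Types (z : nat -> R) (m t : R) (n : nat).

(* z j is the (j+1)-st summand; the paths vanish outside [0,1]. *)
Definition walk_fun z m n t : R :=
  if t \in `[0, 1] then
    n%:R^-1 * \sum_(j < Num.truncn (n%:R * t)) (z j - m)
  else 0.

Let truncn_right n t : 0 <= t ->
  \forall s \near t^'+, Num.truncn (n%:R * s) = Num.truncn (n%:R * t).
Proof.
move=> t0; have nt0 : 0 <= n%:R * t by rewrite mulr_ge0.
have /andP[h1 h2] := truncn_itv nt0.
have [->|n0] := eqVneq n 0%N; first by near=> s; rewrite !mul0r.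
have {}n0 : 0 < n%:R :> R by rewrite ltr0n lt0n.
have tlt : t < (Num.truncn (n%:R * t)).+1%:R / n%:R.
  by rewrite ltr_pdivlMr// mulrC.
near=> s; apply: truncn_def; apply/andP; split.
  by rewrite (le_trans h1)// ler_pM2l.
rewrite mulrC -ltr_pdivlMr//; near: s; exact: nbhs_right_lt.
Unshelve. all: by end_near. Qed.

Let truncn_left n t : 0 < t ->
  exists k, \forall s \near t^'-, Num.truncn (n%:R * s) = k.
Proof.
move=> t0.
have [->|n0] := eqVneq n 0%N.
  by exists 0%N; near=> s; rewrite mul0r truncn0.
have {}n0 : 0 < n%:R :> R by rewrite ltr0n lt0n.
have nt0 : 0 < n%:R * t by rewrite mulr_gt0.
have /andP[h1 h2] := truncn_itv (ltW nt0).
have [k k1 k2] : exists2 k : nat, k%:R < n%:R * t & n%:R * t <= k.+1%:R.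
  have [h3|h3] := ltP (Num.truncn (n%:R * t))%:R (n%:R * t).
    by exists (Num.truncn (n%:R * t)) => //; rewrite ltW.
  case: (Num.truncn (n%:R * t)) h1 h2 h3 => [|k] h1 h2 h3.
    by move: nt0; rewrite ltNge h3.
  by exists k => //; rewrite (lt_le_trans _ h1)// ltr_nat.
exists k; near=> s; apply: truncn_def; apply/andP; split.
  rewrite mulrC -ler_pdivrMr//; apply: ltW; near: s; apply: nbhs_left_gt.
  by rewrite ltr_pdivrMr// mulrC.
rewrite (lt_le_trans _ k2)// ltr_pM2l//; near: s; exact: nbhs_left_lt.
Unshelve. all: by end_near. Qed.

Lemma walk_cadlag z m n : cadlag (walk_fun z m n).
Proof.
split=> t /andP[t0 t1].
  apply: (@cvg_trans _ (walk_fun z m n t @[x --> t^'+])); last exact: cvg_cst.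
  apply: near_eq_cvg; near=> s.
  have s01 : s \in `[0, 1].
    rewrite in_itv/=; apply/andP; split.
      by rewrite (le_trans t0)//; near: s; exact: nbhs_right_ge.
    by near: s; exact: nbhs_right_le.
  rewrite /walk_fun s01 in_itv/= t0 (ltW t1)/=; do 2 f_equal.
  by rewrite (near (truncn_right n t0) s).
have [k hk] := truncn_left n t0.
apply/cvg_ex; exists (n%:R^-1 * \sum_(j < k) (z j - m)).
apply: (@cvg_trans _ ((n%:R^-1 * \sum_(j < k) (z j - m)) @[x --> t^'-]));
  last exact: cvg_cst.
apply: near_eq_cvg; near=> s.
have s01 : s \in `[0, 1].
  rewrite in_itv/=; apply/andP; split.
    by near: s; exact: nbhs_left_ge.
  by rewrite (le_trans _ t1)//; near: s; exact: nbhs_left_le.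
by rewrite /walk_fun s01 (near hk s).
Unshelve. all: by end_near. Qed.

Lemma walk_out z m n t : t \notin `[0, 1] -> walk_fun z m n t = 0.
Proof. by rewrite /walk_fun => /negbTE->. Qed.

Definition walk z m n : skorokhod R :=
  Skorokhod (@walk_cadlag z m n) (@walk_out z m n).

End random_walk.

Section rate_function.
Local Open Scope ereal_scope.
Variable R : realType.

Definition finite_jumps (xi : skorokhod R) : Prop :=
  exists (k : nat) (z t : 'I_k -> R),
    [/\ forall i, (0 < z i)%R, injective t, forall i, (0 < t i <= 1)%R &
     forall s, xi s = (\sum_(i < k) z i * \1_(`[t i, 1]) s)%R].

Definition jump_count (xi : skorokhod R) : \bar R :=
  \esum_(t in `[0%R, 1%R]) (if xi t != left_lim xi t then 1 else 0).

Definition rate_fun (d : nat) (lambda : 'I_d -> R)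
    (xi : sum_prod (skorokhod R) d) : \bar R :=
  if `[< forall i, finite_jumps (xi i) >]
  then \sum_(i < d) (lambda i)%:E * jump_count (xi i)
  else +oo.

End rate_function.

(* Main.v *)
Require Import Defs.
From HB Require Import structures.
From mathcomp Require Import all_boot all_order all_algebra.
From mathcomp Require Import all_classical all_reals all_analysis.
From mathcomp Require Import measurable_realfun ring lra.
Set Implicit Arguments.
Unset Strict Implicit.
Unset Printing Implicit Defensive.
Import Order.TTheory GRing.Theory Num.Theory.
Import numFieldNormedType.Exports.
Local Open Scope classical_set_scope.
Local Open Scope ring_scope.

(* With probability [1 - exp (- M log^gamma n)], for any prescribed [M], a
   walk stays uniformly close to the step path formed by its jumps larger than
   [dl * n], provided [dl] is small: the remaining truncated sums obey a
   Chernoff bound with parameter of order [log^gamma n / n].  Since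
   [log n = o (log^gamma n)], union bounds over the [n] indices cost nothing,
   and Markov's inequality for [exp (sum_i lambda_i (1 - eta) log^gamma n B_i)],
   [B_i] being the number of jumps larger than [dl * n], bounds the rate of such
   a path.  This gives the upper bound, with the fattening of [F] absorbing the
   uniform error.  For the lower bound, prescribe a large jump near each jump
   time of the target path, keep the other summands truncated, and move the jump
   times by a time change equal to the identity plus small tent functions. *)

(** * Expectations of products of independent variables *)

(** Since [ln (k * n) ^ gamma] is asymptotic to [ln n ^ gamma] for every fixed [k > 0], a jump of
    size [k * n] costs the same for every [k]. So the rate counts jumps and ignores their sizes, its
    sublevel sets are in general not compact, and the cut-off [dl * n] can be as small as the
    Chernoff bound demands without changing the cost of exceeding it. The delicate point is that
    bound: a summand truncated at [dl * n] can still have an exponent of order [dl * log^gamma n],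
    too large for a Taylor expansion. A second threshold [sqrt n] separates the summands governed by
    their second moment from those governed by the tail, and the smallness of [dl] comes from the
    latter. In the lower bound, the event that prescribes the jumps has itself a probability of
    order [exp (- C * log^gamma n)], which every error would have to beat. The Chernoff bound is
    therefore proved jointly with a rectangle of prescribed summands whose probability factors out,
    so errors have to be small only relative to it. *)

Section independent_products.
Local Open Scope ereal_scope.
Context (R : realType) (dT : measure_display) (T : measurableType dT).
Variable P : probability T R.

Import HBNNSimple.

(** Independence enters only through the product formula for indicators of [U]; it passes to
    nonnegative functions of [U] by simple functions and monotone convergence. In the application
    [g] is the product of all the other factors. *)
Lemma ge0_integral_mul_indep (U g : T -> R) (c : R) (f : R -> R) :
    measurable_fun setT U -> measurable_fun setT g ->
    (forall w, (0 <= g w)%R) -> (0 <= c)%R ->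
    (forall A, measurable A ->
      \int[P]_w (\1_A (U w) * g w)%:E = P (U @^-1` A) * c%:E) ->
    measurable_fun setT f -> (forall x, (0 <= f x)%R) ->
  \int[P]_w (f (U w) * g w)%:E = \int[P]_w (f (U w))%:E * c%:E.
Proof.
move=> mU mg g0 c0 Hg mf f0.
have mEf : measurable_fun setT (fun x => (f x)%:E) by exact/measurable_EFinP.
pose f_ := nnsfun_approx measurableT mEf.
have m1 (h : {nnsfun R >-> R}) : measurable_fun setT (fun w => h (U w)).
  by apply: measurableT_comp => //; exact: measurable_funTS.
have E (h : {nnsfun R >-> R}) :
    \int[P]_w (h (U w) * g w)%:E = \int[P]_w (h (U w))%:E * c%:E.
  have mI r : measurable_fun setT (fun w => \1_(h @^-1` [set r]) (U w) : R).
    apply: measurableT_comp => //; exact: measurable_indic.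
  have -> : \int[P]_w (h (U w))%:E =
      \sum_(r \in range h) r%:E * P (U @^-1` (h @^-1` [set r])).
    under eq_integral do rewrite fimfunE -fsumEFin//.
    rewrite ge0_integral_fsum//; last 2 first.
      - by move=> r; apply/measurable_EFinP/measurable_funM.
      - by move=> r w _; rewrite EFinM nnfun_muleindic_ge0.
    apply: eq_fsbigr => r /set_mem[x _ <-].
    under eq_integral do rewrite EFinM.
    rewrite ge0_integralZl//; [|exact/measurable_EFinP|by rewrite lee_fin].
    congr (_ * _); rewrite -(setIT (U @^-1` _)) -integral_indic//.
    rewrite -[X in measurable X](@setTI T); apply: mU => //.
  rewrite muleC ge0_mule_fsumr; last first.
    move=> r; have [rh|rh] := pselect (0 <= r)%R; first by rewrite mule_ge0.
    by rewrite preimage_nnfun0 ?preimage_set0 ?measure0 ?mule0// ltNge; apply/negP.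
  under eq_integral.
    move=> w _; rewrite EFinM fimfunE -fsumEFin// ge0_mule_fsuml; last first.
      by move=> r; rewrite EFinM nnfun_muleindic_ge0.
    over.
  rewrite ge0_integral_fsum//; last 2 first.
    - move=> r; under eq_fun do rewrite -EFinM.
      by apply/measurable_EFinP/measurable_funM => //; exact: measurable_funM.
    - by move=> r w _; rewrite mule_ge0 ?lee_fin// -lee_fin EFinM nnfun_muleindic_ge0.
  apply: eq_fsbigr => r /set_mem[x _ <-].
  under eq_integral do rewrite -EFinM -mulrA EFinM.
  rewrite ge0_integralZl ?lee_fin//.
  - by rewrite Hg// muleA muleC.
  - by apply/measurable_EFinP/measurable_funM.
  - by move=> w _; rewrite lee_fin mulr_ge0.
have nd : forall x, {homo (fun n => f_ n x) : m n / (m <= n)%N >-> (m <= n)%R}.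
  by move=> x m n mn; exact/lefP/nd_nnsfun_approx.
have cv x : (f_ n x)%:E @[n --> \oo] --> (f x)%:E.
  by apply: cvg_nnsfun_approx => // y _; rewrite lee_fin.
transitivity (limn (fun n => \int[P]_w (f_ n (U w) * g w)%:E)).
  rewrite -monotone_convergence//=.
  - apply: eq_integral => w _; apply/esym/cvg_lim => //=.
    under eq_fun do rewrite EFinM.
    by rewrite EFinM; apply: cvgeZr => //; exact: cv.
  - by move=> n; apply/measurable_EFinP/measurable_funM.
  - by move=> n w _; rewrite lee_fin mulr_ge0.
  - by move=> w _ m n mn; rewrite lee_fin ler_wpM2r//; exact: nd.
rewrite (_ : \int[P]_w (f (U w))%:E =
    limn (fun n => \int[P]_w (f_ n (U w))%:E)); last first.
  rewrite -monotone_convergence//=.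
  - by apply: eq_integral => w _; apply/esym/cvg_lim => //=; exact: cv.
  - by move=> n; apply/measurable_EFinP.
  - by move=> n w _; rewrite lee_fin.
  - by move=> w _ m n mn; rewrite lee_fin; exact: nd.
rewrite muleC -limeMl//.
  by congr (limn _); apply/funext => n /=; rewrite E muleC.
apply/ereal_nondecreasing_is_cvgn => m n mn; apply: ge0_le_integral => //.
- by move=> x _; rewrite lee_fin.
- exact/measurable_EFinP.
- exact/measurable_EFinP.
- by move=> w _; rewrite lee_fin; exact: nd.
Qed.

Lemma measurable_RV_preimage (X : {RV P >-> R}) (A : set R) :
  measurable A -> measurable (X @^-1` A).
Proof.
move=> mA; rewrite -[X in measurable X](setTI (_ @^-1` _)).
exact: measurable_funP.
Qed.

Lemma measurable_RV_gt (X : {RV P >-> R}) (x : R) :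
  measurable [set w | (x < X w)%R].
Proof.
rewrite (_ : [set _ | _] = X @^-1` `]x, +oo[%classic).
  by apply: measurable_RV_preimage; exact: measurable_itv.
by apply/seteqP; split => w /=; rewrite in_itv/= andbT.
Qed.

Lemma sigma_RV_preimage (X : T -> R) (A : set R) :
  measurable A -> sigma_RV X (X @^-1` A).
Proof. by move=> mA; exists A => //; rewrite setTI. Qed.

Lemma prod_indic (K : eqType) (s : seq K) (X : K -> T -> R) (A : K -> set R) w :
  (\prod_(k <- s) \1_(A k) (X k w) =
   \1_(\bigcap_(k in [set` s]) (X k @^-1` A k)) w :> R)%R.
Proof.
elim: s => [|k s IH].
  rewrite big_nil (_ : \bigcap_(_ in _) _ = setT) ?indicT//.
  by apply/seteqP; split.
rewrite big_cons IH (_ : \bigcap_(j in [set` k :: s]) _ =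
  X k @^-1` A k `&` \bigcap_(j in [set` s]) (X j @^-1` A j)) ?indicI//.
apply/seteqP; split=> [v H|v [H1 H2] j /=].
  split; first by apply: H; rewrite /= mem_head.
  by move=> j js; apply: H; rewrite /= inE js orbT.
by rewrite inE => /predU1P[->|/H2].
Qed.

(** Independence is a statement on events, that is on indicators, so the indicators are traded for
    functions one factor at a time. Finiteness of each expectation makes the product of the
    remaining ones a real constant, as the exchange step requires. *)
Lemma integral_prod_indep (K : eqType) (X : K -> {RV P >-> R}) (s : seq K)
    (f : K -> R -> R) :
    mutually_independent P (fun k => sigma_RV (X k)) -> uniq s ->
    (forall k, measurable_fun setT (f k)) -> (forall k x, (0 <= f k x)%R) ->
    (forall k, k \in s -> \int[P]_w (f k (X k w))%:E \is a fin_num) ->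
  \int[P]_w (\prod_(k <- s) f k (X k w))%:E =
  \prod_(k <- s) \int[P]_w (f k (X k w))%:E.
Proof.
move=> indep us mf f0 ffin.
have mX k (A : set R) : measurable A -> measurable (X k @^-1` A).
  exact: measurable_RV_preimage.
have int_indic (A : set R) k : measurable A ->
    \int[P]_w (\1_A (X k w))%:E = P (X k @^-1` A).
  by move=> mA; rewrite -(setIT (_ @^-1` _)) -integral_indic//; exact: mX.
have mprod (t : seq K) (g : K -> R -> R) : (forall k, measurable_fun setT (g k)) ->
    measurable_fun setT (fun w => \prod_(k <- t) g k (X k w))%R.
  move=> mg; apply: measurable_prod => k _.
  by apply: measurableT_comp => //; exact: measurable_funP.
(* Factors indexed by [t] are already the functions [f], those indexed by [u] are still indicators.
   The induction on [t] keeps [u] general: moving the head of [t] into [u] as an arbitrary indicator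
   [\1_B] yields the product formula that replaces [\1_B] by [f]. For empty [t] the claim is
   independence itself. *)
have H (t : seq K) : forall (u : seq K) (A : K -> set R) (g : K -> R -> R),
    uniq (t ++ u) -> {in t, g =1 f} -> (forall k, measurable_fun setT (g k)) ->
    (forall k x, 0 <= g k x)%R ->
    (forall k, measurable (A k)) ->
    {in u, forall k, g k = \1_(A k)} -> {subset t <= s} ->
    \int[P]_w (\prod_(k <- t ++ u) g k (X k w))%:E =
    \prod_(k <- t ++ u) \int[P]_w (g k (X k w))%:E.
  elim: t => [|k t IH] u A g /= utu gf mg g0 mA gA ts.
    transitivity (P (\bigcap_(k in [set` u]) (X k @^-1` A k))).
      rewrite -[X in P X]setIT -integral_indic//; last first.
        apply: fin_bigcap_measurable => // k _.
        exact: mX.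
      apply: eq_integral => w _; rewrite -prod_indic.
      by congr EFin; apply: eq_big_seq => k /gA ->.
    rewrite indep//; last by move=> k _; exact: sigma_RV_preimage.
    by apply: eq_big_seq => k ku; rewrite gA// int_indic.
  have /andP[kn utu'] := utu.
  have us' : {subset t <= s} by move=> k' k't; apply: ts; rewrite inE k't orbT.
  have gf' : {in t, g =1 f} by move=> k' k't; apply: gf; rewrite inE k't orbT.
  have step B : measurable B ->
      \int[P]_w (\1_B (X k w) * \prod_(j <- t ++ u) g j (X j w))%:E =
      P (X k @^-1` B) * \prod_(j <- t ++ u) \int[P]_w (g j (X j w))%:E.
    move=> mB.
    pose g' j := if j == k then \1_B else g j : R -> R.
    have kt : k \notin t by move: kn; rewrite mem_cat negb_or => /andP[].
    have ku : k \notin u by move: kn; rewrite mem_cat negb_or => /andP[].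
    have g'g : {in t ++ u, g' =1 g}.
      by move=> j jtu; rewrite /g'; case: eqP => // jk; rewrite -jk jtu in kn.
    have := IH (k :: u) (fun j => if j == k then B else A j) g'.
    have -> : (\int[P]_w (\prod_(j <- t ++ k :: u) g' j (X j w))%:E =
        \int[P]_w (\1_B (X k w) * \prod_(j <- t ++ u) g j (X j w))%:E).
      apply: eq_integral => w _; congr EFin.
      rewrite (perm_big (k :: t ++ u)) ?big_cons/=; last first.
        exact: (permEl (perm_catCA t [:: k] u)).
      rewrite {1}/g' eqxx; congr (_ * _)%R.
      by apply: eq_big_seq => j /g'g ->.
    have -> : \prod_(j <- t ++ k :: u) \int[P]_w (g' j (X j w))%:E =
        P (X k @^-1` B) * \prod_(j <- t ++ u) \int[P]_w (g j (X j w))%:E.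
      rewrite (perm_big (k :: t ++ u)) ?big_cons/=; last first.
        exact: (permEl (perm_catCA t [:: k] u)).
      rewrite {1}/g' eqxx int_indic//; congr (_ * _).
      by apply: eq_big_seq => j jtu; apply: eq_integral => w _; rewrite g'g.
    apply.
    - by rewrite (perm_uniq (permEl (perm_catCA t [:: k] u))).
    - move=> j jt; have jk : j != k by apply: contraNneq kt => <-.
      by rewrite /g' (negbTE jk); exact: gf'.
    - move=> j; rewrite /g'; case: eqP => // _; exact: measurable_indic.
    - by move=> j x; rewrite /g'; case: eqP.
    - by move=> j; case: eqP.
    - move=> j; rewrite inE => /orP[/eqP ->|ju]; first by rewrite /g' eqxx.
      have jk : j != k by apply: contraNneq ku => <-.
      by rewrite /g' (negbTE jk) gA.
    - exact: us'.
  pose c := fine (\prod_(j <- t ++ u) \int[P]_w (g j (X j w))%:E).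
  have cE : \prod_(j <- t ++ u) \int[P]_w (g j (X j w))%:E = c%:E.
    rewrite /c fineK// big_seq; apply: prode_fin_num => j.
    rewrite mem_cat => /orP[jt|ju].
      under eq_integral do rewrite gf'//.
      exact/ffin/us'.
    by rewrite gA// int_indic// fin_num_measure//; exact: mX.
  rewrite cE in step.
  under eq_integral do rewrite big_cons.
  rewrite big_cons cE; apply: (ge0_integral_mul_indep
    (g := fun w => \prod_(j <- t ++ u) g j (X j w))%R) => //.
  - exact: mprod.
  - by move=> w; apply: prodr_ge0.
  - rewrite -lee_fin -cE; apply: prode_ge0 => j _.
    by apply: integral_ge0 => w _; rewrite lee_fin.
have := H s [::] (fun=> setT) f; rewrite cats0; apply => //.
Qed.

(** A finite set of pairs is split into its fibres over the first component: the intersection over a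
    fibre is an event of [F i], so [F] separates the fibres and [G i] then separates the events
    inside each. *)
Lemma mutually_independent_pairs (I : finType) (J : eqType)
    (F : I -> set (set T)) (G : I -> J -> set (set T)) :
    mutually_independent P F -> (forall i, mutually_independent P (G i)) ->
    (forall i (s : seq J) (A : J -> set T),
      (forall j, j \in s -> G i j (A j)) ->
      F i (\bigcap_(j in [set` s]) A j)) ->
  mutually_independent P (fun p : I * J => G p.1 p.2).
Proof.
move=> indepF indepG GF s A us sA.
pose S i := [seq p.2 | p <- s & p.1 == i].
have uS i : uniq (S i).
  rewrite map_inj_in_uniq ?filter_uniq// => -[i1 j1] [i2 j2].
  by rewrite !mem_filter/= => /andP[/eqP-> _] /andP[/eqP-> _] ->.
have memS i j : (j \in S i) = ((i, j) \in s).
  apply/mapP/idP => [[[i' j']]|ijs]; last by exists (i, j); rewrite ?mem_filter/= ?eqxx.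
  by rewrite mem_filter/= => /andP[/eqP-> ijs] ->.
have -> : \bigcap_(p in [set` s]) A p =
    \bigcap_(i in [set` index_enum I]) \bigcap_(j in [set` S i]) A (i, j).
  apply/seteqP; split=> w Hw.
    by move=> i _ j /=; rewrite memS => /Hw.
  move=> [i j] /= ijs; apply: (Hw i); last by rewrite /= memS.
  by rewrite /= mem_index_enum.
rewrite indepF ?index_enum_uniq//; last first.
  by move=> i _; apply: GF => j; rewrite memS => /sA.
rewrite (partition_big (fun p : I * J => p.1) xpredT)//=.
apply: eq_bigr => i _; rewrite (indepG i)//; last by move=> j; rewrite memS => /sA.
by rewrite big_map big_filter; apply: eq_bigr => -[i' j'] /= /eqP ->.
Qed.

Lemma sigma_RVs_bigcap (X : nat -> T -> R) (s : seq nat) (A : nat -> set T) :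
  (forall j, j \in s -> sigma_RV (X j) (A j)) ->
  sigma_RVs X (\bigcap_(j in [set` s]) A j).
Proof.
move=> XA; rewrite /sigma_RVs.
have := @fin_bigcap_measurable _ (g_sigma_algebraType (\bigcup_j sigma_RV (X j))).
apply => //= j js; apply: sub_sigma_algebra; exists j => //; exact: XA.
Qed.

Lemma walks_independent (d : nat) (Z : 'I_d -> nat -> {RV P >-> R}) :
    (forall i, iid (Z i)) ->
    mutually_independent P (fun i => sigma_RVs (Z i)) ->
  mutually_independent P (fun p : 'I_d * nat => sigma_RV (Z p.1 p.2)).
Proof.
move=> iidZ indepZ.
apply: (mutually_independent_pairs (G := fun i j => sigma_RV (Z i j))) indepZ _ _.
  by move=> i; case: (iidZ i).
by move=> i; exact: sigma_RVs_bigcap.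
Qed.

End independent_products.

(** * Lognormal-type tails *)

Section log_scale_asymptotics.
Context (R : realType).
Implicit Types (q g b k m : R).

Lemma near_powR_ge g m : 0 < g -> \forall q \near +oo, m <= q `^ g.
Proof.
move=> g0; near=> q.
have m0 : 0 < Num.max m 1 by rewrite lt_max ltr01 orbT.
rewrite (@le_trans _ _ (Num.max m 1))// ?le_max ?lexx//.
rewrite -[leLHS]powRr1 ?(ltW m0)// -(@mulVf _ g) ?gt_eqF// powRrM.
by apply: ge0_ler_powR; rewrite ?nnegrE ?powR_ge0 ?(ltW g0).
Unshelve. all: by end_near. Qed.

Lemma near_addr_pinfty b (Q : R -> Prop) :
  (\forall q \near +oo, Q q) -> \forall q \near +oo, Q (q + b).
Proof.
move=> [M [_ HM]]; near=> q; apply: HM.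
by rewrite -ltrBlDr; near: q; apply: nbhs_pinfty_gt; exact: num_real.
Unshelve. all: by end_near. Qed.

Lemma near_linear_le_powR g m : 1 < g -> \forall q \near +oo, m * q <= q `^ g.
Proof.
move=> g1; near=> q.
have q0 : 0 < q by [].
rewrite -(@mulr_powRB1 _ q) ?(ltW q0) ?(lt_trans ltr01)// mulrC.
rewrite ler_wpM2l ?(ltW q0)//; near: q; apply: near_powR_ge.
by rewrite subr_gt0.
Unshelve. all: by end_near. Qed.

Lemma cvg_powRV g : 0 < g -> (q `^ g)^-1 @[q --> +oo] --> 0.
Proof.
move=> g0; apply/gtr0_cvgV0.
  by near=> q; apply: powR_gt0.
by apply/cvgryPge => A; exact: near_powR_ge.
Unshelve. all: by end_near. Qed.

Lemma continuous_powR g k : 0 < k -> {for k, continuous (fun x => x `^ g)}.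
Proof.
move=> k0; apply/differentiable_continuous/derivable1_diffP.
by apply: derivable_powR; rewrite in_itv/= andbT.
Qed.

(** This is [1 + y <= expR y] at [y = q / (8 * g)], raised to the power [g]. The exponent [q / 8]
    lies well below the [q / 2] of [sqrt n] at [q = ln n], and the difference later absorbs the
    constant. *)
Lemma powR_le_expR g q : 1 < g -> 0 < q ->
  q `^ g <= (8 * g) `^ g * expR (q / 8).
Proof.
move=> g1 q0; have g0 : 0 < g by rewrite (lt_trans ltr01).
have -> : expR (q / 8) = expR (q / (8 * g)) `^ g.
  by rewrite -expRM; congr expR; field; rewrite gt_eqF.
rewrite -powRM ?expR_ge0 ?mulr_ge0 ?(ltW g0)//.
apply: ge0_ler_powR; rewrite ?nnegrE ?(ltW g0) ?(ltW q0)//.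
  by rewrite mulr_ge0 ?expR_ge0// mulr_ge0 ?(ltW g0).
have := expR_ge1Dx (q / (8 * g)); rewrite -(ler_pM2l (_ : 0 < 8 * g)) ?mulr_gt0//.
apply: le_trans; rewrite mulrDr mulr1 mulrCA divff ?mulr1 ?gt_eqF ?mulr_gt0//.
by rewrite lerDr mulr_ge0// ltW.
Qed.

(* The logarithm of the tail [c x^beta exp (- lam (ln x)^g)] at [x = exp v],
   with [l = ln c]. *)
Definition log_tail (l beta lam g v : R) := l + beta * v - lam * v `^ g.

(** With [q = ln n] the argument [k * q + b] is the logarithm of [expR b * n ^ k]. The limit depends
    on the power [k] but not on the factor [expR b]: this is why jump sizes do not enter the
    rate. *)
Lemma cvg_log_tail l beta lam g k b : 1 < g -> 0 < k ->
  log_tail l beta lam g (k * q + b) / q `^ g @[q --> +oo] --> - (lam * k `^ g).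
Proof.
move=> g1 k0; have g0 : 0 < g by rewrite (lt_trans ltr01).
apply: (@cvg_trans _ ((l + beta * b) * (q `^ g)^-1 +
    beta * k * (q `^ (g - 1))^-1 - lam * (k + b * (q `^ 1)^-1) `^ g
    @[q --> +oo])).
  apply: near_eq_cvg; near=> q.
  have q0 : 0 < q by [].
  have kbq : 0 < k * q + b.
    rewrite -ltrBlDr sub0r [k * q]mulrC -ltr_pdivrMr//; near: q.
    by apply: nbhs_pinfty_gt; exact: num_real.
  rewrite /= powRr1 ?(ltW q0)//.
  have qV : q^-1 `^ g = (q `^ g)^-1.
    by rewrite -powR_inv1 ?(ltW q0)// -powRrM mulN1r powRN.
  rewrite (_ : k + b * q^-1 = (k * q + b) / q); last by field; rewrite gt_eqF.
  rewrite powRM ?invr_ge0 ?(ltW q0) ?(ltW kbq)//.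
  rewrite qV -(@mulr_powRB1 _ q g) ?(ltW q0)//.
  rewrite /log_tail; field.
  by rewrite !gt_eqF ?powR_gt0.
rewrite -[- (lam * k `^ g)]add0r; apply: cvgB.
  rewrite -(addr0 (0 : R)); apply: cvgD.
    rewrite -(mulr0 (l + beta * b)); apply: cvgMr; exact: cvg_powRV.
  rewrite -(mulr0 (beta * k)); apply: cvgMr; apply: cvg_powRV.
  by rewrite subr_gt0.
apply: cvgMr.
have : k + b * (q `^ 1)^-1 @[q --> +oo] --> k.
  rewrite -{2}[k]addr0 -(mulr0 b); apply: cvgD; first exact: cvg_cst.
  by apply: cvgMr; exact: cvg_powRV.
by move=> H; have := cvg_comp _ _ H (@continuous_powR g k k0).
Unshelve. all: by end_near. Qed.

Lemma near_log_tail_le l beta lam g k b eta : 1 < g -> 0 < k ->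
    - (lam * k `^ g) < eta ->
  \forall q \near +oo, log_tail l beta lam g (k * q + b) <= eta * q `^ g.
Proof.
move=> g1 k0 e; near=> q.
rewrite -ler_pdivrMr ?powR_gt0//; apply: ltW; near: q.
by have /cvgr_lt/(_ _ e) := @cvg_log_tail l beta lam g k b g1 k0.
Unshelve. all: by end_near. Qed.

Lemma near_log_tail_ge l beta lam g k b eta : 1 < g -> 0 < k ->
    eta < - (lam * k `^ g) ->
  \forall q \near +oo, eta * q `^ g <= log_tail l beta lam g (k * q + b).
Proof.
move=> g1 k0 e; near=> q.
rewrite -ler_pdivlMr ?powR_gt0//; apply: ltW; near: q.
by have /cvgr_gt/(_ _ e) := @cvg_log_tail l beta lam g k b g1 k0.
Unshelve. all: by end_near. Qed.

Lemma near_log_tail_le_linear l beta lam g m : 1 < g -> 0 < lam ->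
  \forall v \near +oo, log_tail l beta lam g v <= - (m * v).
Proof.
move=> g1 lam0; near=> v.
have v0 : 0 < v by [].
rewrite /log_tail lerBlDr -lerBlDl opprK.
have : (m + beta + 1) / lam * v <= v `^ g.
  by near: v; exact: near_linear_le_powR.
rewrite mulrAC ler_pdivrMr// [_ * lam]mulrC; apply: le_trans.
have : l <= v by near: v; apply: nbhs_pinfty_ge; exact: num_real.
lra.
Unshelve. all: by end_near. Qed.

(** Because [g > 1], the slope of [lam * v]^ g[tends to infinity, so multiplying the level by the
    fixed factor]expR e[divides the tail by more than any given]expR
    m[. The slope is bounded below by writing](q + b + e) [^ g] as [(q + b + e)] times its power
    [g - 1]. *)
Lemma near_log_tail_shift l beta lam g b e m : 1 < g -> 0 < lam -> 0 < e ->
  \forall q \near +oo, log_tail l beta lam g (q + b + e) + m <=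
    log_tail l beta lam g (q + b).
Proof.
move=> g1 lam0 e0; near=> q.
have g0 : 0 < g by rewrite (lt_trans ltr01).
have qb : 0 < q + b.
  by rewrite -ltrBlDr; near: q; apply: nbhs_pinfty_gt; exact: num_real.
have : (beta * e + m) / (lam * e) <= (q + b) `^ (g - 1).
  near: q; apply: (@near_addr_pinfty b
    (fun q => (beta * e + m) / (lam * e) <= q `^ (g - 1))).
  by apply: near_powR_ge; rewrite subr_gt0.
rewrite ler_pdivrMr ?mulr_gt0// => H.
have : (q + b) `^ g + (q + b) `^ (g - 1) * e <= (q + b + e) `^ g.
  have g10 : 0 < g - 1 by rewrite subr_gt0.
  have qbe : 0 < q + b + e by rewrite addr_gt0.
  rewrite -(@mulr_powRB1 _ (q + b)) ?(ltW qb)// [_ `^ (g - 1) * e]mulrC -mulrDl.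
  rewrite -(@mulr_powRB1 _ (q + b + e)) ?(ltW qbe)// ler_pM2l//.
  by apply: ge0_ler_powR; rewrite ?nnegrE ?ltW// ltrDl.
move=> /(ler_wpM2l (ltW lam0)); rewrite /log_tail mulrDr; move: H.
lra.
Unshelve. all: by end_near. Qed.

Lemma cvg_ln_natr : ln (n%:R : R) @[n --> \oo] --> +oo.
Proof.
apply/cvgryPge => A; near=> n.
rewrite -[A]expRK ler_ln ?posrE ?expR_gt0 ?ltr0n//; last by near: n; exists 1%N.
near: n; exact: nbhs_infty_ger.
Unshelve. all: by end_near. Qed.

Lemma near_ln_natr (Q : R -> Prop) : (\forall q \near +oo, Q q) ->
  \forall n \near \oo, (0 < n)%N /\ Q (ln n%:R).
Proof.
move=> /cvg_ln_natr H; have n0 : \forall n \near \oo, (0 < n)%N by exists 1%N.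
exact: filterI n0 H.
Qed.

End log_scale_asymptotics.

(** * Tail probabilities at the scales [n] and [sqrt n], and second moments *)

Section tails.
Context (R : realType) (dT : measure_display) (T : measurableType dT).
Context (P : probability T R) (X : {RV P >-> R}) (l beta lam g : R).
Hypothesis g1 : 1 < g.
Hypothesis lam0 : 0 < lam.
Local Notation tail x := (P [set w | (x < X w)%R]).

Hypothesis X_tail : \forall v \near +oo,
  tail (expR v) = (expR (log_tail l beta lam g v))%:E.

Let measurable_gt x : measurable [set w | x < X w] := measurable_RV_gt X x.

(** The tail decays faster than any power; the constant covers small [v], where the probability is
    at most 1. The cube suits the second moment: dyadic blocks weighted by [4 ^ k] have probability
    of order [8 ^ - k]. *)
Lemma tail_cubic :
  exists2 C, 0 <= C & forall v, (tail (expR v) <= (C * expR (- (3 * v)))%:E)%E.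
Proof.
have [v0 [_ Hv0]] := X_tail.
have [v1 [_ Hv1]] := near_log_tail_le_linear l beta 3 g1 lam0.
exists (expR (3 * Num.max (Num.max v0 v1) 0)); first exact: expR_ge0.
move=> v; rewrite -expRD -mulrBr.
have [vl|vg] := leP v (Num.max v0 v1).
  apply: (@le_trans _ _ 1%E); first exact: probability_le1.
  rewrite lee_fin -expR0 ler_expR mulr_ge0// subr_ge0.
  by rewrite le_max vl.
move: vg; rewrite gt_max => /andP[v0v v1v].
rewrite Hv0// lee_fin ler_expR (le_trans (Hv1 _ v1v))//.
rewrite mulrBr lerDr mulr_ge0// le_max lexx orbT//.
Qed.

Lemma near_tail_scale_le k rho : 0 < k -> rho < lam -> \forall n \near \oo,
  (tail (k * n%:R) <= (expR (- (rho * ln n%:R `^ g)))%:E)%E.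
Proof.
move=> k0 rl; have : \forall q \near +oo, (tail (expR (q + ln k)) <=
    (expR (- (rho * q `^ g)))%:E)%E.
  near=> q; rewrite (near (near_addr_pinfty _ X_tail) q)//.
  rewrite lee_fin ler_expR -mulNr -[q in X in X <= _]mul1r; near: q.
  by apply: near_log_tail_le; rewrite ?powR1 ?mulr1 ?ltrN2.
move=> /near_ln_natr; apply: filterS => n [n0].
rewrite expRD !lnK ?posrE//; last by rewrite ltr0n.
by rewrite [k * _]mulrC.
Unshelve. all: by end_near. Qed.

Lemma near_tail_sqrt_le rho : rho < lam * 2^-1 `^ g -> \forall n \near \oo,
  (tail (Num.sqrt n%:R) <= (expR (- (rho * ln n%:R `^ g)))%:E)%E.
Proof.
move=> rl; have : \forall q \near +oo, (tail (expR (2^-1 * q)) <=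
    (expR (- (rho * q `^ g)))%:E)%E.
  near=> q; rewrite (_ : tail _ = (expR (log_tail l beta lam g (2^-1 * q + 0)))%:E).
    rewrite lee_fin ler_expR -mulNr; near: q.
    by apply: near_log_tail_le; rewrite ?ltrN2.
  rewrite addr0; near: q.
  have [v0 [_ Hv0]] := X_tail; near=> q; apply: Hv0.
  rewrite mulrC ltr_pdivlMr//; near: q.
  by apply: nbhs_pinfty_gt; exact: num_real.
move=> /near_ln_natr; apply: filterS => n [n0].
by rewrite mulrC expRM lnK ?posrE ?ltr0n// powR12_sqrt.
Unshelve. all: by end_near. Qed.

(** The window is a difference of two tails, the second at most half of the first by
    [near_log_tail_shift] with [m = ln 2]. The tail itself is compared with the intermediate rate
    [rho'], and the lost factor 2 is paid by [rho - rho']. *)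
Lemma near_tail_window_ge k e rho : 0 < k -> 0 < e -> lam < rho ->
  \forall n \near \oo, ((expR (- (rho * ln n%:R `^ g)))%:E <=
    P [set w | (k * n%:R < X w <= (k + e) * n%:R)%R])%E.
Proof.
move=> k0 e0 rl.
pose rho' := (lam + rho) / 2.
pose b := ln k; pose h := ln (k + e) - ln k.
have h0 : 0 < h by rewrite subr_gt0 ltr_ln ?posrE ?addr_gt0// ltrDl.
have : \forall q \near +oo, ((expR (- (rho * q `^ g)))%:E <=
    P [set w | (expR (q + b) < X w)%R && (X w <= expR (q + b + h))%R])%E.
  have r1 : lam < rho' by rewrite /rho'; lra.
  have r2 : rho' < rho by rewrite /rho'; lra.
  near=> q.
  have -> : [set w | (expR (q + b) < X w)%R && (X w <= expR (q + b + h))%R] =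
      [set w | expR (q + b) < X w] `\` [set w | expR (q + b + h) < X w].
    apply/seteqP; split=> w /=.
      by move=> /andP[-> ?]; split => //; apply/negP; rewrite -leNgt.
    by move=> [-> /negP]; rewrite -leNgt.
  have E1 : tail (expR (q + b)) = (expR (log_tail l beta lam g (q + b)))%:E.
    by near: q; exact: near_addr_pinfty X_tail.
  have E2 : tail (expR (q + b + h)) =
      (expR (log_tail l beta lam g (q + b + h)))%:E.
    rewrite -(addrA q); near: q.
    exact: near_addr_pinfty X_tail.
  rewrite [leRHS](_ : _ = (expR (log_tail l beta lam g (q + b)) -
      expR (log_tail l beta lam g (q + b + h)))%:E); last first.
    transitivity (tail (expR (q + b)) - tail (expR (q + b + h)))%E.
      rewrite measureD//; last by rewrite (le_lt_trans (probability_le1 _ _)) ?ltry.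
      congr (_ - P _)%E; apply: setIidr => w /=.
      by apply: le_lt_trans; rewrite ler_expR lerDl ltW.
    by rewrite E1 E2 -EFinB.
  rewrite lee_fin.
  have : log_tail l beta lam g (q + b + h) + ln 2 <= log_tail l beta lam g (q + b).
    by near: q; exact: near_log_tail_shift.
  rewrite -ler_expR expRD lnK ?posrE// => H.
  have : - rho' * q `^ g <= log_tail l beta lam g (1 * q + b).
    by near: q; apply: near_log_tail_ge; rewrite ?powR1 ?mulr1 ?ltrN2.
  rewrite mul1r -ler_expR => H'.
  have : ln 2 <= (rho - rho') * q `^ g.
    rewrite mulrC -ler_pdivrMr ?subr_gt0//; near: q; apply: near_powR_ge.
    exact: lt_trans g1.
  rewrite -ler_expR lnK ?posrE// mulrBl expRB => H2.
  have : expR (- (rho * q `^ g)) * 2 <= expR (- rho' * q `^ g).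
    rewrite mulNr !expRN -ler_pdivlMl ?invr_gt0 ?expR_gt0// invrK.
    by rewrite (le_trans H2).
  lra.
move=> /near_ln_natr; apply: filterS => n [n0]; rewrite /b /h -addrA subrKC.
by rewrite !expRD !lnK ?posrE ?addr_gt0 ?ltr0n// ![n%:R * _]mulrC.
Unshelve. all: by end_near. Qed.

Hypothesis X0 : {ae P, forall w, 0 <= X w}.

Lemma tail_square_integrable : P.-integrable setT (fun w => ((X w) ^+ 2)%:E).
Proof.
have [C C0 HC] := tail_cubic.
have mX2 : measurable_fun setT (fun w => ((X w) ^+ 2)%:E).
  by apply/measurable_EFinP; apply: measurable_funX.
apply/integrableP; split => //.
(* Dyadic domination [X ^+ 2 <= 4 + \sum_k u k]: if [2 ^ k.+1 <= X <= 2 ^ k.+2], then [X > 2 ^ k]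
   strictly and [X ^+ 2 <= (2 ^ k.+2) ^+ 2 = 16 * 4 ^ k]. The 4 takes care of [X <= 2]. *)
pose u k w := ((16 * 4 ^+ k) * \1_[set w | 2 ^+ k < X w] w)%:E : \bar R.
have u0 k w : (0 <= u k w)%E by rewrite lee_fin !mulr_ge0 ?exprn_ge0.
have mu k : measurable_fun setT (u k).
  by apply/measurable_EFinP/measurable_funM => //; exact: measurable_indic.
have mU : measurable_fun setT (fun w => \sum_(k <oo) u k w)%E.
  by apply: ge0_emeasurable_sum.
apply: (@le_lt_trans _ _ (\int[P]_w (4%:E + \sum_(k <oo) u k w))%E).
  apply: ae_ge0_le_integral => //.
  - exact: measurableT_comp.
  - by move=> w _; rewrite adde_ge0 ?nneseries_ge0 ?lee_fin.
  - exact: emeasurable_funD.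
  - apply: filterS X0 => w Xw0 _.
    rewrite gee0_abs ?lee_fin ?exprn_ge0//.
    have [X2|X2] := leP (X w) 2.
      rewrite -[leLHS]addr0 leeD ?nneseries_ge0//.
      by rewrite lee_fin (_ : 4 = 2 ^+ 2)//; [rewrite lerXn2r ?nnegrE|rewrite expr2; lra].
    have t2 : (2 <= Num.truncn (X w))%N by rewrite truncn_ge_nat// ltW.
    have /andP[tX Xt] := truncn_itv Xw0.
    have /andP[] := trunc_log_bounds (isT : (1 < 2)%N) (ltnW t2).
    case: (trunc_log _ _) => [|k] b1 b2; first by move: t2; rewrite leqNgt b2.
    have Xk : 2 ^+ k < X w.
      rewrite (lt_le_trans _ tX)// (@lt_le_trans _ _ (2 ^+ k.+1))//.
        by rewrite ltr_eXn2l ?ltr1n.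
      by rewrite -natrX ler_nat.
    have kX : X w <= 2 ^+ k.+2.
      by rewrite (le_trans (ltW Xt))// -natrX ler_nat.
    apply: (@le_trans _ _ (u k w)).
      rewrite /u indicE mem_set//= mulr1 lee_fin.
      have -> : 16 * 4 ^+ k = (2 ^+ k.+2) ^+ 2 :> R.
        by rewrite -exprM mulnC exprM (_ : 2 ^+ 2 = 4 :> R) ?exprS; ring.
      by rewrite lerXn2r ?nnegrE.
    rewrite -[leLHS]add0e leeD ?lee_fin//.
    rewrite (@nneseriesD1 _ _ k)//.
    by rewrite leeDl// nneseries_ge0.
rewrite ge0_integralD//; last by move=> w _; rewrite nneseries_ge0.
rewrite integral_cst//= probability_setT mule1 integral_nneseries//.
rewrite lte_add_pinfty ?ltry//.
apply: (@le_lt_trans _ _ (\sum_(k <oo) ((32 * C) / (2 ^ (k + 1))%:R)%:E)%E).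
  apply: lee_nneseries; first by move=> k _ _; exact: integral_ge0.
  move=> k _; rewrite /u; under eq_integral do rewrite EFinM.
  rewrite ge0_integralZl//; last first.
    by apply/measurable_EFinP; exact: measurable_indic.
  rewrite integral_indic// setIT.
  have k2 : 2 ^+ k = expR (ln 2 * k%:R) :> R by rewrite expRM_natr lnK// posrE.
  have := HC (ln 2 * k%:R); rewrite -k2 => /lee_wpmul2l H.
  apply: (le_trans (H (16 * 4 ^+ k)%:E _)); first by rewrite lee_fin mulr_ge0// exprn_ge0.
  rewrite -EFinM lee_fin natrX.
  have -> : expR (- (3 * (ln 2 * k%:R))) = (2 ^+ k)^-1 ^+ 3 :> R.
    by rewrite k2 -expRN -expRM_natl mulrN.
  have -> : 4 ^+ k = (2 ^+ k) ^+ 2 :> R by rewrite -exprM mulnC exprM; congr (_ ^+ _); ring.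
  rewrite exprD expr1 le_eqVlt; apply/orP; left; apply/eqP; field.
  by rewrite expf_neq0.
have /cvg_lim := @cvg_geometric_eseries_half R (32 * C) 0.
by rewrite /eseries/= => -> //; rewrite ltry.
Qed.

Lemma tail_integrable : P.-integrable setT (EFin \o X).
Proof.
apply: (@le_integrable _ _ _ P setT measurableT _
    (fun w => (1 + (X w) ^+ 2)%:E)) => //.
- exact/measurable_EFinP.
- move=> w _ /=; rewrite lee_fin [leRHS]ger0_norm ?addr_ge0 ?sqr_ge0//.
  rewrite -(real_normK (num_real (X w))).
  have := sqr_ge0 (`|X w| - 1); rewrite sqrrB1.
  have := sqr_ge0 `|X w|.
  lra.
- under eq_fun do rewrite EFinD; apply: integrableD => //.
    exact: finite_measure_integrable_cst.
  exact: tail_square_integrable.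
Qed.

End tails.

(** * Exponential bounds for truncated variables *)

Section exponential_bounds.
Context (R : realType).
Implicit Types (x y b u th g e : R) (n : nat).

(* [exp y = exp (y / 2) ^ 2 <= (1 - y / 2)^-2], which is at most
   [1 + y + 2 y^2] because [(1 + y + 2 y^2) (1 - y / 2)^2 - 1 =
   y^2 (1 - y) (5 - 2 y) / 4]. *)
Lemma expR_le_quad y : y <= 1 -> expR y <= 1 + y + 2 * y ^+ 2.
Proof.
move=> y1; have h0 : 0 < 1 - y / 2 by lra.
have H : expR (y / 2) <= (1 - y / 2)^-1.
  rewrite -[leLHS]invrK -expRN lef_pV2 ?posrE ?expR_gt0//.
  exact: expR_ge1Dx.
have -> : expR y = expR (y / 2) ^+ 2 by rewrite -expRM_natl; congr expR; field.
apply: (@le_trans _ _ ((1 - y / 2)^-1 ^+ 2)).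
  by rewrite lerXn2r ?nnegrE ?expR_ge0 ?invr_ge0 ?(ltW h0).
rewrite exprVn -[leLHS]mul1r ler_pdivrMr ?exprn_gt0// -subr_ge0.
rewrite (_ : _ - 1 = y ^+ 2 * ((1 - y) * (5 - 2 * y)) / 4); last by field.
rewrite divr_ge0// mulr_ge0 ?sqr_ge0// mulr_ge0 ?subr_ge0//; lra.
Qed.

(** Values above [b] are sent to 0 and not to [b], so that [x - cut b x] is either 0 or the whole
    big value. *)
Definition cut b x := if x <= b then x else 0.

(** The quadratic bound covers the uncut values, up to [u] when the sign is plus. For the plus sign
    and [x > u] the crude bound [expR (th * b)] is used. For the minus sign and [x > b] the left
    side is 1 while [- th * x] survives on the right; the term [th / b * x ^+ 2 >= th * x]
    compensates it. *)
Lemma cut_exp_bound (sg : bool) th u b x : 0 <= x -> 0 < b -> 0 <= th ->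
    th * u <= 1 ->
  expR ((-1) ^+ sg * th * cut b x) <= 1 + (-1) ^+ sg * th * x +
    (2 * th ^+ 2 + th / b) * x ^+ 2 + expR (th * b) * (u < x)%R%:R.
Proof.
move=> x0 b0 th0 thu.
have thx : 0 <= th * x by rewrite mulr_ge0.
have q1 : 0 <= th ^+ 2 * x ^+ 2 by rewrite mulr_ge0 ?sqr_ge0.
have q2 : 0 <= th / b * x ^+ 2 by rewrite mulr_ge0 ?sqr_ge0 ?divr_ge0 ?(ltW b0).
have q3 : 0 <= expR (th * b) * (u < x)%R%:R by rewrite mulr_ge0 ?expR_ge0.
rewrite mulrDl -mulrA; case: sg => /=; rewrite ?expr0 ?expr1 ?mul1r ?mulN1r /cut.
  case: ifPn => [xb|]; rewrite ?mulNr.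
    have := @expR_le_quad (- (th * x)); rewrite sqrrN exprMn => H.
    have {}H := H (le_trans (_ : _ <= 0) ler01).
    rewrite oppr_le0 in H; have := H thx; lra.
  rewrite -ltNge => bx; rewrite mulr0 oppr0 expR0.
  have : th * x <= th / b * x ^+ 2.
    rewrite expr2 mulrA ler_wpM2r// mulrAC ler_pdivlMr//.
    by rewrite ler_wpM2l// ltW.
  lra.
have [xu|ux] := leP x u.
  rewrite mulr0; case: ifPn => [xb|]; last by rewrite mulr0 expR0; lra.
  have : th * x <= 1 by rewrite (le_trans _ thu)// ler_wpM2l.
  by move=> /expR_le_quad; rewrite exprMn; lra.
rewrite mulr1.
have : expR (th * (if x <= b then x else 0)) <= expR (th * b).
  by rewrite ler_expR ler_wpM2l//; case: ifP => // _; exact: ltW.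
lra.
Qed.

Lemma cut_big_jump b x : 0 < b -> (0 < x - cut b x) = (b < x).
Proof.
rewrite /cut; case: ifPn => [xb _|]; first by rewrite subrr ltxx ltNge xb.
by rewrite -ltNge subr0 => bx b0; rewrite bx (lt_trans b0).
Qed.

Lemma cut_remainder_ge0 b x : 0 < b -> 0 <= x - cut b x.
Proof.
rewrite /cut; case: ifPn => [_ _|]; first by rewrite subrr.
by rewrite -ltNge subr0 => bx b0; rewrite ltW// (lt_trans b0).
Qed.

Lemma near_speed_le_sqrt g e : 1 < g -> 0 < e ->
  \forall n \near \oo, ln n%:R `^ g <= e * Num.sqrt n%:R.
Proof.
move=> g1 e0; have : \forall q \near +oo, q `^ g <= e * expR (2^-1 * q).
  near=> q; have q0 : 0 < q by [].
  rewrite (le_trans (powR_le_expR g1 q0))//.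
  have -> : 2^-1 * q = 3 / 8 * q + q / 8 by field.
  rewrite expRD mulrA ler_wpM2r ?expR_ge0// -ler_pdivrMl//.
  apply: le_trans (expR_ge1Dx _).
  rewrite -lerBlDl [3 / 8 * q]mulrC -ler_pdivrMr//; near: q.
move=> /near_ln_natr; apply: filterS => n [n0].
by rewrite [2^-1 * _]mulrC expRM lnK ?posrE ?ltr0n// powR12_sqrt.
Unshelve. all: by end_near. Qed.

Lemma near_ln_le_speed g m : 1 < g ->
  \forall n \near \oo, m * ln n%:R <= ln n%:R `^ g.
Proof.
by move=> g1; have /near_ln_natr := near_linear_le_powR m g1; apply: filterS => n [].
Qed.

Lemma near_speed_ge g m : 1 < g -> \forall n \near \oo, m <= ln n%:R `^ g.
Proof.
move=> g1; have /near_ln_natr := near_powR_ge m (lt_trans ltr01 g1).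
by apply: filterS => n [].
Qed.

Lemma near_natr_expR_speed_le g eta e : 1 < g -> 0 < eta -> 0 < e ->
  \forall n \near \oo, n%:R * expR (- (eta * ln n%:R `^ g)) <= e.
Proof.
move=> g1 eta0 e0; near=> n.
have n0 : (0 < n%:R :> R) by rewrite ltr0n; near: n; exists 1%N.
have : 2 / eta * ln n%:R <= ln n%:R `^ g.
  by near: n; exact: near_ln_le_speed.
rewrite mulrAC ler_pdivrMr// [_ * eta]mulrC => H.
apply: (@le_trans _ _ (n%:R * expR (- (2 * ln n%:R)))).
  by rewrite ler_wpM2l ?ler0n// ler_expR lerN2.
rewrite -mulrN mulrC expRM_natl -lnV ?posrE// lnK ?posrE ?invr_gt0//.
rewrite expr2 -mulrA mulVf ?gt_eqF// mulr1 invf_ple ?posrE//.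
near: n; exact: nbhs_infty_ger.
Unshelve. all: by end_near. Qed.

End exponential_bounds.

(** * Moment generating function of a centred truncated variable *)

Section truncated_mgf.
Context (R : realType) (dT : measure_display) (T : measurableType dT).
Context (P : probability T R) (X : {RV P >-> R}) (l beta lam g : R).
Hypothesis g1 : 1 < g.
Hypothesis lam0 : 0 < lam.
Hypothesis X_tail : \forall v \near +oo,
  P [set w | (expR v < X w)%R] = (expR (log_tail l beta lam g v))%:E.
Hypothesis X0 : {ae P, forall w, 0 <= X w}.

Let mu := fine 'E_P[X].
Let v := fine (\int[P]_w ((X w) ^+ 2)%:E).

Let v0 : 0 <= v.
Proof. by apply: fine_ge0; apply: integral_ge0 => w _; rewrite lee_fin sqr_ge0. Qed.

Let measurable_gt x : measurable [set w | x < X w] := measurable_RV_gt X x.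

Lemma measurable_cut (b : R) : measurable_fun setT (cut b).
Proof.
apply: measurable_fun_ifT => //.
exact: measurable_fun_ler.
Qed.

Lemma integral_quadratic_indic (A B D x : R) :
  (\int[P]_w (1 + A * X w + B * X w ^+ 2 + D * \1_[set w | (x < X w)%R] w)%:E =
   (1 + A * mu + B * v + D * fine (P [set w | (x < X w)%R]))%:E)%E.
Proof.
have i1 : P.-integrable setT (EFin \o X) by exact: tail_integrable X_tail X0.
have i2 : P.-integrable setT (fun w => ((X w) ^+ 2)%:E).
  exact: tail_square_integrable X_tail X0.
have i0 : P.-integrable setT (fun=> 1%:E : \bar R).
  exact: finite_measure_integrable_cst.
have i3 : P.-integrable setT (fun w => (\1_[set w | (x < X w)%R] w)%:E : \bar R).
  exact: integrable_indic.
have i1' := integrableZl measurableT A i1.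
have i2' := integrableZl measurableT B i2.
have i3' := integrableZl measurableT D i3.
have -> : (\int[P]_w (1 + A * X w + B * X w ^+ 2 +
      D * \1_[set w | (x < X w)%R] w)%:E)%E =
    (\int[P]_w (1%:E + A%:E * (X w)%:E + B%:E * (X w ^+ 2)%:E +
      D%:E * (\1_[set w | (x < X w)%R] w)%:E))%E by apply: eq_integral.
rewrite integralD//; last by do 2 (apply: integrableD => //).
rewrite integralD//; last by apply: integrableD.
rewrite integralD// !integralZl//.
have -> : (\int[P]_w (1%:E : \bar R) = 1)%E by rewrite integral_cst//= probability_setT mule1.
rewrite integral_indic// setIT !EFinD !EFinM; congr (_ + _ * _ + _ * _ + _ * _)%E.
- by rewrite /mu expectation_def fineK//; exact: integrable_fin_num.
- by rewrite fineK//; exact: integrable_fin_num.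
- by rewrite fineK// fin_num_measure.
Qed.

(* The quadratic bound on [expR] is used below [Num.sqrt n%:R], where the
   exponent is at most 1; above, the tail at [Num.sqrt n%:R] decays like
   [expR (- lam * 2^-1 `^ g * ln n `^ g)] and beats the largest value
   [expR (s * dl * ln n `^ g)] of the integrand. *)
Lemma near_mgf_cut_le (s dl : R) : 0 < s -> 0 < dl ->
    s * dl < lam * 2^-1 `^ g ->
  \forall n \near \oo, forall sg : bool,
  (\int[P]_w (expR ((-1) ^+ sg * (s * ln n%:R `^ g / n%:R) *
     (cut (dl * n%:R) (X w) - mu)))%:E <= (expR n%:R^-1)%:E)%E.
Proof.
move=> s0 dl0 sdl.
(* A rate strictly below that of the tail at [sqrt n] and strictly above the largest exponent
   [s * dl], so that their product [expR (- ((rho - s * dl) * a))] is negligible against [n^-1]. *)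
pose rho := (s * dl + lam * 2^-1 `^ g) / 2.
have rho1 : rho < lam * 2^-1 `^ g by rewrite /rho; lra.
have rho2 : 0 < rho - s * dl by rewrite /rho; lra.
(* The condition [a <= e * sqrt n] is used three times: [e1] gives [th * sqrt n <= 1], [e2] gives
   [2 * th ^+ 2 * v <= 1 / (3 * n)], and [e3] gives [th / b * v <= 1 / (3 * n)]. The remaining third
   goes to the tail term. The [v + 1] avoids dividing by a vanishing second moment. *)
pose e1 := (s + 1)^-1; pose e2 := (6 * s ^+ 2 * (v + 1))^-1.
pose e3 := (6 * s * (v + 1) / dl)^-1.
have v1 : 0 < v + 1 by rewrite ltr_wpDl.
have e10 : 0 < e1 by rewrite invr_gt0 addr_gt0.
have e20 : 0 < e2 by rewrite invr_gt0 !mulr_gt0// exprn_gt0.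
have e30 : 0 < e3 by rewrite invr_gt0 divr_gt0 ?mulr_gt0// exprn_gt0.
pose e := Num.min (Num.min e1 1) (Num.min e2 e3).
have e0 : 0 < e by rewrite !lt_min e10 e20 e30 ltr01.
near=> n => sg.
set a := ln n%:R `^ g; set th := s * a / n%:R.
have n0 : 0 < n%:R :> R by rewrite ltr0n; near: n; exists 1%N.
set q : R := Num.sqrt n%:R.
have q0 : 0 < q by rewrite sqrtr_gt0.
have a0 : 0 <= a by exact: powR_ge0.
have ae : a <= e * q.
  by rewrite /a /q; near: n; exact: near_speed_le_sqrt.
have nE : n%:R = q * q :> R by rewrite -expr2 sqr_sqrtr// ltW.
have th0 : 0 <= th by rewrite divr_ge0 ?mulr_ge0 ?(ltW s0)// ltW.
have thsq : th <= s * e / q.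
  rewrite /th nE invfM mulrA ler_wpM2r ?invr_ge0 ?(ltW q0)//.
  by rewrite -mulrA ler_wpM2l ?(ltW s0)// ler_pdivrMr.
have thu : th * q <= 1.
  rewrite -ler_pdivlMr// (le_trans thsq)// ler_pM2r ?invr_gt0//.
  have : e <= e1 by rewrite /e !ge_min lexx.
  move=> /(ler_wpM2l (ltW s0)) /le_trans; apply.
  by rewrite ler_pdivrMr ?addr_gt0// mul1r lerDl.
pose b := dl * n%:R.
have b0 : 0 < b by rewrite mulr_gt0.
pose A := (-1) ^+ sg * th; pose B := 2 * th ^+ 2 + th / b; pose D := expR (th * b).
pose f2 w := 1 + A * X w + B * X w ^+ 2 + D * \1_[set w | (q < X w)%R] w.
have mf2 : measurable_fun setT f2.
  rewrite /f2; apply: measurable_funD; last exact: measurable_funM.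
  apply: measurable_funD; last by apply: measurable_funM => //; exact: measurable_funX.
  by apply: measurable_funD => //; exact: measurable_funM.
have f2ae : {ae P, forall w, expR (A * cut b (X w)) <= f2 w}.
  apply: filterS X0 => w Xw0.
  have := @cut_exp_bound _ sg th (q) b (X w) Xw0 b0 th0 thu.
  rewrite /f2 /A /B /D indicE (_ : (w \in _) = (q < X w)%R)//.
  by apply/idP/idP; rewrite inE.
have -> : (\int[P]_w (expR (A * (cut b (X w) - mu)))%:E)%E =
    (\int[P]_w ((expR (- (A * mu)))%:E * (expR (A * cut b (X w)))%:E))%E.
  by apply: eq_integral => w _; rewrite -EFinM -expRD; congr (expR _)%:E; ring.
have mcut : measurable_fun setT (fun w => expR (A * cut b (X w))).
  apply: measurableT_comp => //; apply: measurable_funM => //.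
  by apply: measurableT_comp => //; exact: measurable_cut.
rewrite ge0_integralZl ?lee_fin ?expR_ge0//; last first.
  exact/measurable_EFinP.
have H : (\int[P]_w (expR (A * cut b (X w)))%:E <=
    (1 + A * mu + B * v + D * fine (P [set w | (q < X w)%R]))%:E)%E.
  rewrite -integral_quadratic_indic.
  apply: (@le_trans _ _ (\int[P]_w (`|f2 w|)%:E)%E).
    apply: ae_ge0_le_integral => //.
    - exact/measurable_EFinP.
    - by apply/measurable_EFinP; exact: measurableT_comp.
    - by apply: filterS f2ae => w H _; rewrite lee_fin (le_trans H)// ler_norm.
  rewrite le_eqVlt; apply/orP; left; apply/eqP; apply: ae_eq_integral => //.
  - by apply/measurable_EFinP; exact: measurableT_comp.
  - exact/measurable_EFinP.
  - apply: filterS f2ae => w H _; congr EFin; apply: ger0_norm.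
    by rewrite (le_trans _ H)// expR_ge0.
have {}H := lee_wpmul2l (_ : 0 <= (expR (- (A * mu)))%:E)%E H.
apply: (le_trans (H _)); first by rewrite lee_fin expR_ge0.
rewrite -EFinM lee_fin.
have r : B * v + D * fine (P [set w | (q < X w)%R]) <= n%:R^-1.
  have p1 : (P [set w | (q < X w)%R] <= (expR (- (rho * a)))%:E)%E.
    by rewrite /a /q; near: n; exact: (near_tail_sqrt_le g1 X_tail rho1).
  have {p1} : fine (P [set w | (q < X w)%R]) <= expR (- (rho * a)).
    by rewrite -lee_fin fineK// fin_num_measure.
  move=> /(ler_wpM2l (expR_ge0 (th * b))); rewrite -expRD -/D.
  have -> : th * b - rho * a = - ((rho - s * dl) * a).
    by rewrite /th /b; field; rewrite gt_eqF.
  have : n%:R * expR (- ((rho - s * dl) * a)) <= 1 / 3.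
    by rewrite /a; near: n; exact: near_natr_expR_speed_le.
  rewrite -ler_pdivlMl// => H1 H2.
  have H3 : 2 * th ^+ 2 * v <= n%:R^-1 * (1 / 3).
    have t2 : th ^+ 2 <= s ^+ 2 * e ^+ 2 / n%:R.
      have -> : s ^+ 2 * e ^+ 2 / n%:R = (s * e / q) ^+ 2.
        by rewrite nE; field; rewrite gt_eqF.
      by rewrite lerXn2r// nnegrE divr_ge0 ?mulr_ge0 ?ltW.
    have : e ^+ 2 <= e2.
      by rewrite expr2 -[leRHS]mulr1 ler_pM ?(ltW e0)// /e !ge_min ?lexx ?orbT.
    rewrite /e2 -div1r ler_pdivlMr ?mulr_gt0 ?exprn_gt0//.
    rewrite (_ : e ^+ 2 * (6 * s ^+ 2 * (v + 1)) =
      6 * (s ^+ 2 * e ^+ 2) * v + 6 * (s ^+ 2 * e ^+ 2)); last by ring.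
    move=> He.
    have := ler_wpM2r v0 (ler_wpM2l (ler0n R 2) t2) => /le_trans; apply.
    rewrite [leLHS](_ : _ = n%:R^-1 * (2 * (s ^+ 2 * e ^+ 2) * v)); last by ring.
    rewrite ler_wpM2l ?invr_ge0 ?(ltW n0)//.
    have : 0 <= s ^+ 2 * e ^+ 2 by rewrite mulr_ge0 ?sqr_ge0.
    lra.
  have H4 : th / b * v <= n%:R^-1 * (1 / 3).
    have q1 : 1 <= q by rewrite -sqrtr1 ler_wsqrtr// ler1n -(ltr0n R).
    have an : a <= e * n%:R.
      by rewrite (le_trans ae)// ler_wpM2l ?(ltW e0)// nE ler_pMl.
    have -> : th / b * v = n%:R^-1 * (s * v / dl * (a / n%:R)).
      by rewrite /th /b; field; rewrite !gt_eqF.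
    rewrite ler_wpM2l ?invr_ge0 ?(ltW n0)//.
    have : a / n%:R <= e3.
      by rewrite ler_pdivrMr// (le_trans an)// ler_wpM2r ?(ltW n0)// /e !ge_min lexx !orbT.
    rewrite /e3 -[X in _ <= X]div1r ler_pdivlMr ?divr_gt0 ?mulr_gt0//.
    have : 0 <= s / dl * (a / n%:R) by rewrite mulr_ge0 ?divr_ge0 ?(ltW s0) ?(ltW dl0) ?(ltW n0).
    have -> : a / n%:R * (6 * s * (v + 1) / dl) =
      6 * (s * v / dl * (a / n%:R)) + 6 * (s / dl * (a / n%:R)) by ring.
    lra.
  rewrite /B mulrDl; lra.
(* The linear term [A * mu] cancels the centring factor and leaves an error [n^-1] in the exponent;
   at most [n] summands therefore cost a factor of at most [expR 1]. *)
apply: (@le_trans _ _ (expR (- (A * mu)) * expR (A * mu + n%:R^-1))).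
  rewrite ler_wpM2l ?expR_ge0//; apply: le_trans (expR_ge1Dx _); lra.
by rewrite -expRD addKr.
Unshelve. all: by end_near. Qed.

End truncated_mgf.

(** * Chernoff bounds jointly with prescribed summands *)

Section chernoff.
Local Open Scope ereal_scope.
Context (R : realType) (dT : measure_display) (T : measurableType dT).
Context (P : probability T R).

(** The event that prescribes windows for finitely many summands. For empty [s] it is the whole
    space, which gives the unconditional bounds. *)
Definition rectangle (K : eqType) (X : K -> T -> R) (s : seq K) (A : K -> set R) :
  set T := \bigcap_(k in [set` s]) (X k @^-1` A k).

Lemma measurable_rectangle (K : eqType) (X : K -> {RV P >-> R}) s A :
  (forall k, measurable (A k)) -> measurable (rectangle X s A).
Proof.
by move=> mA; apply: fin_bigcap_measurable => // k _; exact: measurable_RV_preimage.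
Qed.

Lemma rectangle_prob (K : eqType) (X : K -> {RV P >-> R}) s A :
  mutually_independent P (fun k => sigma_RV (X k)) -> uniq s ->
  (forall k, measurable (A k)) ->
  P (rectangle X s A) = \prod_(k <- s) P (X k @^-1` A k).
Proof. by move=> indep us mA; apply: indep => // k _; exact: sigma_RV_preimage. Qed.

Lemma lee_prod_ge0 (I : eqType) (s : seq I) (f g : I -> \bar R) :
  (forall i, i \in s -> 0 <= f i /\ f i <= g i) ->
  \prod_(i <- s) f i <= \prod_(i <- s) g i.
Proof.
move=> fg; rewrite big_seq [leRHS]big_seq.
suff [] : 0 <= \prod_(i <- s | i \in s) f i /\
  \prod_(i <- s | i \in s) f i <= \prod_(i <- s | i \in s) g i by [].
apply: (big_ind2 (fun x y : \bar R => 0 <= x /\ x <= y)) => //.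
by move=> x1 x2 y1 y2 [x10 x12] [y10 y12]; split; [exact: mule_ge0|exact: lee_pmul].
Qed.

(** Markov's inequality for the exponential of the sum, with the indicator of the rectangle kept as
    further factors of the same product. As [s] and [u] are disjoint, the expectation splits and the
    probability of the rectangle comes out exactly. *)
Lemma chernoff_indep (K : eqType) (X : K -> {RV P >-> R}) (s u : seq K)
    (A : K -> set R) (h : K -> R -> R) (r : K -> R) (t : R) :
    mutually_independent P (fun k => sigma_RV (X k)) -> uniq (s ++ u) ->
    (forall k, measurable (A k)) -> (forall k, measurable_fun setT (h k)) ->
    (forall k, k \in u -> \int[P]_w (expR (h k (X k w)))%:E <= (expR (r k))%:E) ->
  P (rectangle X s A `&` [set w | (t <= \sum_(k <- u) h k (X k w))%R]) <=
    P (rectangle X s A) * (expR (\sum_(k <- u) r k - t))%:E.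
Proof.
move=> indep usu mA mh hr.
have /and3P[us /hasPn su' uu] : [&& uniq s, ~~ has (mem s) u & uniq u].
  by rewrite -cat_uniq.
have su k : k \in u -> k \notin s by exact: su'.
pose f k := if k \in s then \1_(A k) else (fun x => expR (h k x)).
have mhX k : measurable_fun setT (fun w => h k (X k w)).
  by apply: measurableT_comp => //; exact: measurable_funP.
have mf k : measurable_fun setT (f k).
  rewrite /f; case: ifP => _; first exact: measurable_indic.
  exact: measurableT_comp.
have f0 k x : (0 <= f k x)%R by rewrite /f; case: ifP => _ //; exact: expR_ge0.
have mprod : measurable_fun setT (fun w => \prod_(k <- s ++ u) f k (X k w))%R.
  apply: measurable_prod => k _.
  by apply: measurableT_comp => //; exact: measurable_funP.
have fs k : k \in s -> \int[P]_w (f k (X k w))%:E = P (X k @^-1` A k).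
  move=> ks; rewrite /f ks -(setIT (_ @^-1` _)) -integral_indic//.
  exact: measurable_RV_preimage.
have fu k : k \in u -> \int[P]_w (f k (X k w))%:E <= (expR (r k))%:E.
  by move=> ku; rewrite /f (negbTE (su _ ku)) hr.
have mS : measurable_fun setT (fun w => \sum_(k <- u) h k (X k w))%R.
  exact: measurable_sum.
have mE : measurable [set w | (t <= \sum_(k <- u) h k (X k w))%R].
  rewrite (_ : [set _ | _] = (fun w => \sum_(k <- u) h k (X k w))%R @^-1` `[t, +oo[%classic).
    by rewrite -[X in measurable X](setTI (_ @^-1` _)); exact: mS.
  by apply/seteqP; split => w /=; rewrite in_itv/= andbT.
have mA' := measurable_rectangle X s mA.
rewrite -(setIT (_ `&` _)) -integral_indic//; last exact: measurableI.
apply: (@le_trans _ _ (\int[P]_w ((expR (- t))%:E * (\prod_(k <- s ++ u) f k (X k w))%:E))).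
  apply: ge0_le_integral => //.
  - by apply/measurable_EFinP; apply: measurable_indic; exact: measurableI.
  - by apply: measurable_funeM; exact/measurable_EFinP.
  - move=> w _; rewrite -EFinM lee_fin big_cat/= indicI/=.
    rewrite (_ : \prod_(k <- s) f k (X k w) = \1_(rectangle X s A) w)%R; last first.
      by rewrite -prod_indic; apply: eq_big_seq => k ks; rewrite /f ks.
    rewrite (_ : \prod_(k <- u) _ = expR (\sum_(k <- u) h k (X k w)))%R; last first.
      by rewrite expR_sum; apply: eq_big_seq => k ku; rewrite /f (negbTE (su _ ku)).
    rewrite mulrCA ler_wpM2l// -expRD [X in (X <= _)%R]indicE.
    case: (boolP (w \in _)) => [|_]; last exact: expR_ge0.
    by rewrite inE/= -expR0 ler_expR addrC subr_ge0.
rewrite ge0_integralZl ?lee_fin ?expR_ge0//; last 2 first.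
  - exact/measurable_EFinP.
  - by move=> w _; rewrite lee_fin prodr_ge0.
rewrite integral_prod_indep//; last first.
  move=> k; rewrite mem_cat => /orP[ks|ku].
    by rewrite fs// fin_num_measure//; exact: measurable_RV_preimage.
  rewrite ge0_fin_numE; first exact: le_lt_trans (fu _ ku) (ltry _).
  by apply: integral_ge0 => w _; rewrite lee_fin.
rewrite rectangle_prob// big_cat/= muleCA (eq_big_seq _ fs).
rewrite lee_wpmul2l//; first by apply: prode_ge0.
rewrite muleC expRD EFinM lee_wpmul2r ?lee_fin ?expR_ge0//.
rewrite expR_sum -prodEFin; apply: lee_prod_ge0 => k ku; split; last exact: fu.
by apply: integral_ge0 => w _; rewrite lee_fin.
Qed.

Lemma rectangle_setI (K : eqType) (X : K -> {RV P >-> R}) s A k B :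
    mutually_independent P (fun k => sigma_RV (X k)) -> uniq s -> k \notin s ->
    (forall k, measurable (A k)) -> measurable B ->
  P (rectangle X s A `&` X k @^-1` B) = P (rectangle X s A) * P (X k @^-1` B).
Proof.
move=> indep us ks mA mB; pose A' j := if j == k then B else A j.
have mA' j : measurable (A' j) by rewrite /A'; case: ifP.
have A'A j : j \in s -> A' j = A j.
  by move=> js; rewrite /A'; case: eqP => // jk; rewrite -jk js in ks.
have A'k : A' k = B by rewrite /A' eqxx.
rewrite (_ : _ `&` _ = rectangle X (k :: s) A'); last first.
  apply/seteqP; split=> [w [Rw Bw] j /=|w Rw].
    rewrite inE => /predU1P[->|js]; first by rewrite A'k.
    by rewrite A'A//; exact: Rw.
  split; last by have := Rw k; rewrite A'k; apply; rewrite /= mem_head.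
  by move=> j js; have := Rw j; rewrite A'A//; apply; rewrite /= inE js orbT.
rewrite !rectangle_prob//= ?ks// big_cons A'k muleC; congr (_ * _).
by apply: eq_big_seq => j js; rewrite A'A.
Qed.

Lemma prob_bigsetU_le (I : Type) (s : seq I) (A : I -> set T) :
  (forall i, measurable (A i)) ->
  P (\big[setU/set0]_(i <- s) A i) <= \sum_(i <- s) P (A i).
Proof.
move=> mA; elim: s => [|i s IH]; first by rewrite !big_nil measure0.
rewrite !big_cons (le_trans (measureU2 _ _ _))//; last by rewrite leeD2l.
exact: bigsetU_measurable.
Qed.

End chernoff.

(** * Step paths in the J1 topology *)

Section step_paths.
Context (R : realType).
Implicit Types (xi zeta : skorokhod R) (b e m s : R) (n k : nat).

(** The data hidden by the existential quantifiers of [finite_jumps], exposed so that the number of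
    jumps can be computed with. *)
Definition step_path k (z t : 'I_k -> R) xi : Prop :=
  [/\ forall i, 0 < z i, injective t, forall i, 0 < t i <= 1 &
   forall s, xi s = \sum_(i < k) z i * \1_(`[t i, 1]) s].

Lemma step_path_finite_jumps k (z t : 'I_k -> R) xi :
  step_path z t xi -> finite_jumps xi.
Proof. by move=> H; exists k, z, t. Qed.

Lemma indic_itv_le (t s : R) : s <= 1 -> \1_(`[t, 1]) s = (t <= s)%R%:R :> R.
Proof.
move=> s1; rewrite indicE; congr (nat_of_bool _)%:R.
by apply/idP/idP; rewrite inE/= in_itv/= s1 andbT.
Qed.

Lemma step_path_left_lim k (z t : 'I_k -> R) xi s : step_path z t xi ->
  s <= 1 -> left_lim xi s = \sum_(i < k) z i * (t i < s)%R%:R.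
Proof.
move=> [z0 tI t01 xiE] s1; apply: cvg_lim => //.
have H : \forall x \near s^'-, forall i, t i < s -> t i <= x.
  apply: filter_forall => j; have [tjs|_] := ltP (t j) s; last exact: nearW.
  by near=> x => _; near: x; exact: nbhs_left_ge.
apply: cvg_near_cst; near=> x; rewrite xiE; apply: eq_bigr => i _.
have xs : x < s by near: x; exact: nbhs_left_lt.
rewrite indic_itv_le ?(ltW (lt_le_trans xs s1))//; congr (_ * (nat_of_bool _)%:R).
apply/idP/idP => [tx|ts]; first exact: le_lt_trans xs.
by have := near H x; apply.
Unshelve. all: by end_near. Qed.

(** The jump at [s] is the sum of the [z i] with [t i = s]; positivity excludes cancellation, and
    injectivity of [t] makes the [k] jump times distinct. *)
Lemma step_path_jump_count k (z t : 'I_k -> R) xi :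
  step_path z t xi -> jump_count xi = k%:R%:E.
Proof.
move=> st; have [z0 tI t01 xiE] := st.
rewrite /jump_count.
rewrite (eq_esum (b := fun s => if s \in t @` setT then 1%E else 0%E)); last first.
  move=> s /=; rewrite in_itv/= => /andP[s0 s1].
  congr (if _ then _ else _); rewrite (step_path_left_lim st s1) xiE.
  rewrite -subr_eq0 -sumrB.
  have E : \sum_(i < k) (z i * \1_(`[t i, 1]) s - z i * (t i < s)%R%:R) =
      \sum_(i < k) z i * (t i == s)%:R.
    apply: eq_bigr => i _; rewrite indic_itv_le// -mulrBr; congr (_ * _).
    by case: ltgtP => _; rewrite ?subr0 ?subrr.
  rewrite E psumr_neq0; last by move=> i _; rewrite mulr_ge0 ?(ltW (z0 i)).
  apply/hasP/idP => [[i _ /=]|].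
    case: eqP => [<- _|]; last by rewrite mulr0 ltxx.
    by rewrite inE; exists i.
  rewrite inE => -[i _ <-]; exists i; rewrite ?mem_index_enum//= eqxx mulr1.
  exact: z0.
rewrite -esum_mkcondr setIidr; last first.
  by move=> _ [i _ <-] /=; rewrite in_itv/=; have /andP[/ltW-> ->] := t01 i.
rewrite esum_image; last by move=> i j _ _; exact: tI.
rewrite esum_fset//; last exact: finite_finset.
rewrite (fsbigE (index_enum 'I_k)) ?index_enum_uniq//; last first.
  by move=> i _ /=; rewrite mem_index_enum.
rewrite (eq_bigl xpredT); last by move=> i; rewrite in_setT.
by rewrite sumEFin sumr_const card_ord.
Qed.

Lemma step_path_sum (I : finType) (Q : pred I) (z t : I -> R) xi :
    (forall i, Q i -> 0 < z i) -> injective t -> (forall i, 0 < t i <= 1) ->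
    (forall s, xi s = \sum_(i | Q i) z i * \1_(`[t i, 1]) s) ->
  exists z' t', @step_path #|Q| z' t' xi.
Proof.
move=> z0 tI t01 xiE.
exists (fun i => z (enum_val i)), (fun i => t (enum_val i)); split.
- by move=> i; apply: z0; exact: (enum_valP i).
- by move=> i j /tI /enum_val_inj.
- by move=> i.
- by move=> s; rewrite xiE (big_enum_val (A := Q) (fun i => z i * \1_(`[t i, 1]) s)).
Qed.

(** Summands are numbered from 0, so summand [j] enters at time [(j + 1) / n]. *)
Lemma walk_fun_indic (z : nat -> R) m n s : (0 < n)%N ->
  walk z m n s = \sum_(j < n) ((z j - m) / n%:R) * \1_(`[j.+1%:R / n%:R, 1]) s.
Proof.
move=> n0; have n0' : 0 < n%:R :> R by rewrite ltr0n.
rewrite /= /walk_fun; case: ifPn => [|s01]; last first.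
  rewrite big1// => j _; rewrite indicE memNset ?mulr0//=.
  rewrite in_itv/=; apply/negP; move: s01; apply: contra => /andP[js s1].
  by rewrite in_itv/= s1 andbT (le_trans _ js)// divr_ge0.
rewrite in_itv/= => /andP[s0 s1].
have ns0 : 0 <= n%:R * s by rewrite mulr_ge0.
have kn : (Num.truncn (n%:R * s) <= n)%N.
  rewrite -(ler_nat R) (@le_trans _ _ (n%:R * s)) ?truncn_le//.
  by rewrite -[leRHS]mulr1 ler_pM2l.
rewrite (big_ord_widen _ (fun j => z j - m) kn) big_mkcond mulr_sumr.
apply: eq_bigr => j _; rewrite indic_itv_le// ler_pdivrMr// -truncn_ge_nat ?mulr_ge0//.
rewrite [s * _]mulrC; case: ifP => _; last by rewrite !mulr0.
by rewrite mulr1 mulrC.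
Qed.

(** Jump heights of a step path are positive, so vanishing summands are dropped and only the
    positive ones are counted. *)
Lemma walk_step_path (z : nat -> R) n : (0 < n)%N ->
    (forall j : nat, 0 <= z j) ->
  exists z' t', @step_path #|[pred j : 'I_n | 0 < z j]| z' t' (walk z 0 n).
Proof.
move=> n0 z0; have n0' : 0 < n%:R :> R by rewrite ltr0n.
apply: (@step_path_sum _ [pred j : 'I_n | 0 < z j] (fun j : 'I_n => z j / n%:R)
  (fun j : 'I_n => j.+1%:R / n%:R)).
- by move=> j /= zj; rewrite divr_gt0.
- by move=> i j /(mulIf (invr_neq0 (lt0r_neq0 n0'))) /eqP; rewrite eqr_nat eqSS => /eqP/val_inj.
- by move=> j; rewrite divr_gt0//= ler_pdivrMr// mul1r ler_nat.
move=> s; rewrite walk_fun_indic// [RHS]big_mkcond; apply: eq_bigr => j _ /=.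
case: ifPn => [_|]; first by rewrite subr0.
rewrite -leNgt => zj; have -> : z j = 0 by apply/eqP; rewrite eq_le zj z0.
by rewrite subr0 !mul0r.
Qed.

Lemma dJ1_le_uniform xi zeta e :
  {in `[0, 1], forall t, `|xi t - zeta t| <= e} -> dJ1 xi zeta <= e.
Proof.
move=> H; apply: J1_within_le; exists id; first exact: time_change_id.
move=> t t01; split; last exact: H.
by rewrite subrr normr0 (le_trans _ (H _ t01)).
Qed.

Lemma walk_close (z z' : nat -> R) m m' n e : (0 < n)%N -> 0 <= e ->
    (forall k, (k <= n)%N ->
      `|\sum_(j <- iota 0 k) ((z j - m) - (z' j - m'))| <= e * n%:R) ->
  dJ1 (walk z m n) (walk z' m' n) <= e.
Proof.
move=> n0 e0 H; have n0' : 0 < n%:R :> R by rewrite ltr0n.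
apply: dJ1_le_uniform => t t01; rewrite /= /walk_fun t01 -mulrBr -sumrB.
rewrite normrM ger0_norm ?invr_ge0// mulrC ler_pdivrMr//.
rewrite -(big_mkord xpredT (fun j => (z j - m) - (z' j - m'))) /index_iota subn0.
apply: H; rewrite -(ler_nat R); move: t01; rewrite in_itv/= => /andP[t0 t1].
rewrite (@le_trans _ _ (n%:R * t)) ?truncn_le ?mulr_ge0//.
by rewrite -[leRHS]mulr1 ler_pM2l.
Qed.

End step_paths.

(** * Intrinsic characterization of step paths *)

Section few_values.
Context (R : realType).
Implicit Types (xi zeta : skorokhod R) (m k : nat) (vs : seq R).

Definition attained xi (v : R) := 0 < v /\ exists2 t, t \in `[0, 1] & xi t = v.

(* [xi] starts at 0, is nondecreasing on [0, 1], and has at most [m] positive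
   values there: an intrinsic description of the step paths with at most [m]
   jumps, whose failure is stable under small J1 perturbations. *)
Definition few_values xi m : Prop :=
  [/\ xi 0 = 0, {in `[0, 1] &, {homo xi : s t / s <= t}} &
   forall vs, uniq vs -> (forall v, v \in vs -> attained xi v) ->
     (size vs <= m)%N].

Let in01_0 : (0 : R) \in `[0, 1]. Proof. by rewrite in_itv/= lexx ler01. Qed.

Lemma step_path_few_values k (z t : 'I_k -> R) xi :
  step_path z t xi -> few_values xi k.
Proof.
move=> [z0 tI t01 xiE].
have E s : s \in `[0, 1] -> xi s = \sum_(i < k) z i * (t i <= s)%R%:R.
  rewrite in_itv/= => /andP[_ s1]; rewrite xiE; apply: eq_bigr => i _.
  by rewrite indic_itv_le.
split.
- rewrite E// big1// => i _; have /andP[ti0 _] := t01 i.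
  by rewrite leNgt ti0 mulr0.
- move=> s u s01 u01 su; rewrite !E//; apply: ler_sum => i _.
  rewrite ler_wpM2l ?(ltW (z0 i))// ler_nat.
  by case: (leP (t i) s) => // ts; rewrite (le_trans ts su).
move=> vs uvs Hvs.
have : {subset vs <= [seq xi (t i) | i <- enum 'I_k]}.
  move=> v /Hvs [v0 [s s01 sv]].
  have [i0 ti0] : exists i0, t i0 <= s.
    apply: contrapT => no; move: v0; rewrite -sv E// big1 ?ltxx// => i _.
    by case: leP => // ts; [case: no; exists i|rewrite mulr0].
  (* The last jump time not after [s]: the path is constant from there to [s], so every positive
     value is already taken at a jump time. *)
  pose i := [arg max_(j > i0 | t j <= s) t j]%O.
  have [ti tmax] : t i <= s /\ forall j, t j <= s -> t j <= t i.
    by rewrite /i; case: arg_maxP => // j tj jmax; split.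
  apply/mapP; exists i; rewrite ?mem_enum// -sv.
  have ti01 : t i \in `[0, 1].
    by rewrite in_itv/=; have /andP[/ltW -> ->] := t01 i.
  rewrite !E//; apply: eq_bigr => j _; congr (_ * (nat_of_bool _)%:R).
  by apply/idP/idP => [/tmax//|tj]; exact: le_trans ti.
by move=> /(uniq_leq_size uvs); rewrite size_map size_enum_ord.
Qed.

(** The positive values, in increasing order, are the levels of the path; the jump times are the
    first times at which each level is reached, and the heights are the differences of consecutive
    levels. *)
Lemma few_values_step_path xi m : few_values xi m ->
  exists2 k, (k <= m)%N & exists z t, @step_path R k z t xi.
Proof.
move=> [xi0 mono few].
(* The bound [few] permits choosing a longest list of distinct attained values; being longest, it
   contains all of them. *)
pose good n := `[< exists vs, [/\ uniq vs, forall v, v \in vs -> attained xi v & size vs = n] >].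
have g0 : exists n, good n by exists 0%N; apply/asboolP; exists [::].
have gm n : good n -> (n <= m)%N by move=> /asboolP[vs [uvs vsP <-]]; exact: few.
case: (ex_maxnP g0 gm) => k /asboolP[vs0 [uvs0 vs0P szk]] kmax.
exists k; first by apply: gm; apply/asboolP; exists vs0.
have all_vs v : attained xi v -> v \in vs0.
  move=> av; apply: contrapT => /negP vn; suff : (k.+1 <= k)%N by rewrite ltnn.
  apply: kmax; apply/asboolP; exists (v :: vs0); rewrite /= vn uvs0 szk; split => // x.
  by rewrite inE => /predU1P[->//|]; exact: vs0P.
pose vs := sort <=%O vs0.
have vsP v : (v \in vs) <-> attained xi v.
  by rewrite mem_sort; split => [/vs0P|/all_vs].
have svs : sorted <%O (0 :: vs).
  rewrite lt_sorted_uniq_le /= sort_uniq uvs0 andbT; apply/andP; split.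
    by apply/negP => /vsP[]; rewrite ltxx.
  rewrite path_min_sorted ?sort_le_sorted//.
  by apply/allP => v /vsP[/ltW].
have szvs : size vs = k by rewrite size_sort.
pose V j := nth 0 (0 :: vs) j.
have Vlt i j : (i < j <= k)%N -> V i < V j.
  move=> /andP[ij jk]; apply: (sorted_ltn_nth lt_trans) => //=; rewrite inE/= szvs ltnS//.
  by rewrite (leq_trans (ltnW ij)).
have Vval s : s \in `[0, 1] -> exists2 j, (j <= k)%N & xi s = V j.
  move=> s01; have : 0 <= xi s.
    by rewrite -xi0; apply: mono => //; move: s01; rewrite in_itv/= => /andP[].
  rewrite le_eqVlt => /predU1P[<-|xs0]; first by exists 0%N.
  have : xi s \in 0 :: vs by rewrite inE; apply/orP; right; apply/vsP; split => //; exists s.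
  by move=> /(nthP 0)[j /=]; rewrite szvs ltnS => jk <-; exists j.
have att (j : 'I_k) : exists2 s, s \in `[0, 1] & xi s = V j.+1.
  have : V j.+1 \in vs by rewrite /V/= mem_nth// szvs.
  by move=> /vsP[_ [s s01 sV]]; exists s.
pose L (j : 'I_k) := [set s | s \in `[0, 1] /\ V j.+1 <= xi s].
pose t (j : 'I_k) := inf (L j).
have L0 j : L j !=set0 by have [s s01 sV] := att j; exists s; split => //; rewrite sV.
have Llb j : has_lbound (L j) by exists 0 => s [+ _]; rewrite in_itv/= => /andP[].
have tin j : t j \in `[0, 1].
  rewrite in_itv/=; apply/andP; split.
    by apply: lb_le_inf => // s [+ _]; rewrite in_itv/= => /andP[].
  have [s [s01 sV]] := L0 j; rewrite (@le_trans _ _ s)//; first by apply: ge_inf.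
  by move: s01; rewrite in_itv/= => /andP[].
(* The infimum is attained by right-continuity: were the value at [t j] below the level, it would
   stay below on an interval to the right. When [t j = 1] there is no such interval, but the level
   is then reached at 1 itself. *)
have tL (j : 'I_k) : V j.+1 <= xi (t j).
  rewrite leNgt; apply/negP => xV.
  have := tin j; rewrite in_itv/= => /andP[tj0 tj1].
  have tj_lt1 : t j < 1.
    rewrite lt_neqAle tj1 andbT; apply/eqP => tj_eq1.
    have [s [s01 sV]] := L0 j; have : t j <= s by apply: ge_inf.
    rewrite tj_eq1 => s1; have s_eq1 : s = 1.
      by apply/eqP; rewrite eq_le s1 andbT; move: s01; rewrite in_itv/= => /andP[].
    by move: xV; rewrite tj_eq1 -s_eq1 ltNge sV.
  have [|/= r r0 Hr] := cvgr_lt _ ((skorokhod_cadlag xi).1 (t j) _) _ xV.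
    by rewrite tj0.
  have [s [s01 sV] str] : exists2 s, L j s & s < t j + r.
    by apply: inf_adherent => //; split.
  have ts : t j <= s by apply: ge_inf.
  move: ts; rewrite le_eqVlt => /predU1P[tjs|ts].
    by move: xV; rewrite tjs ltNge sV.
  have := Hr s; rewrite /= distrC gtr0_norm ?subr_gt0// ltrBlDl => /(_ str ts).
  by rewrite ltNge sV.
have LE (j : 'I_k) s : s \in `[0, 1] -> (V j.+1 <= xi s) = (t j <= s).
  move=> s01; apply/idP/idP => [Vs|ts]; first by apply: ge_inf.
  by rewrite (le_trans (tL j))//; apply: mono.
exists (fun j : 'I_k => V j.+1 - V j), t; split.
- by move=> j; rewrite subr_gt0 Vlt// leqnn/=.
(* The level [V i.+1] is attained at some [s]. If [t i = t j], then reaching it would already mean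
   reaching the strictly higher level [V j.+1]. *)
- have H (i j : 'I_k) : (i < j)%N -> t i != t j.
    move=> ij; apply/eqP => tij.
    have [s s01 sV] := att i.
    have : V j.+1 <= xi s by rewrite LE// -tij -LE// sV.
    by rewrite sV leNgt Vlt// ltnS ij/= ltn_ord.
  move=> i j tij; have [ij|ji|] := ltngtP (nat_of_ord i) (nat_of_ord j).
  - by have := H _ _ ij; rewrite tij eqxx.
  - by have := H _ _ ji; rewrite tij eqxx.
  - exact: val_inj.
- move=> j; have := tin j; rewrite in_itv/= => /andP[t0 ->]; rewrite andbT.
  rewrite lt_neqAle t0 andbT; apply/eqP => t00.
  have := tL j; rewrite -t00 xi0 leNgt.
  by have := @Vlt 0%N j.+1; rewrite /V/= => ->.
move=> s; have [s01|s01] := boolP (s \in `[0, 1]); last first.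
  rewrite skorokhod_out// big1// => i _; rewrite indicE memNset ?mulr0//=.
  rewrite in_itv/=; apply/negP; move: s01; apply: contra => /andP[ts s1].
  rewrite in_itv/= s1 andbT.
  by rewrite (le_trans _ ts)//; have := tin i; rewrite in_itv/= => /andP[].
have [j jk sj] := Vval s s01.
have s1 : s <= 1 by move: s01; rewrite in_itv/= => /andP[].
rewrite sj.
transitivity (\sum_(i < k | (i < j)%N) (V i.+1 - V i)).
  rewrite -(big_ord_widen _ (fun i => V i.+1 - V i) jk).
  by rewrite -(big_mkord xpredT (fun i => V i.+1 - V i)) telescope_sumr// subr0.
rewrite big_mkcond; apply: eq_bigr => i _.
rewrite indic_itv_le// -LE// sj; case: ltnP => ij.
  rewrite (_ : (V i.+1 <= V j)%R = true) ?mulr1//.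
  move: ij; rewrite leq_eqVlt => /predU1P[->|ij]; first by rewrite lexx.
  by rewrite ltW// Vlt// ij jk.
by rewrite leNgt Vlt ?mulr0// ltnS ij/= ltn_ord.
Qed.

End few_values.

(** * Lower semicontinuity of the rate function *)

Section lower_semicontinuity.
Context (R : realType).
Implicit Types (xi zeta : skorokhod R) (m k : nat).

Lemma seq_gt0_lbound (r : seq R) : {in r, forall x, 0 < x} ->
  exists2 e, 0 < e & {in r, forall x, e <= x}.
Proof.
elim: r => [|x r IH] r0; first by exists 1.
have [e e0 er] := IH (fun y yr => r0 y (mem_behead (s := x :: r) yr)).
exists (Num.min x e); first by rewrite lt_min e0 r0 ?mem_head.
move=> y; rewrite inE => /predU1P[->|yr]; first by rewrite ge_min lexx.
by rewrite ge_min er ?orbT.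
Qed.

Lemma few_values_leq xi m k : (m <= k)%N -> few_values xi m -> few_values xi k.
Proof.
move=> mk [xi0 mono few]; split => // vs uvs /few => /(_ uvs) h.
exact: leq_trans mk.
Qed.

(** The inverse of the time change is used so that [xi] keeps its own time: properties of [xi] at
    chosen times can then be transferred to [zeta]. Monotonicity and [m 0 = 0] preserve the order of
    times and the starting point. *)
Lemma dJ1_lt_inverse xi zeta e : dJ1 xi zeta < e -> exists m : R -> R,
  [/\ {homo m : t / t \in `[0, 1]}, {in `[0, 1] &, {homo m : s t / s <= t}},
   m 0 = 0 & {in `[0, 1], forall t, `|xi t - zeta (m t)| <= e}].
Proof.
move=> /dJ1_lt_within[l tl H]; have [m [tm lm ml]] := time_change_inv tl.
have in0 : (0 : R) \in `[0, 1] by rewrite in_itv/= lexx ler01.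
have [[m01 _ _] mmono] := tm; have [[l01 _ _] _] := tl.
exists m; split => //; last by move=> t t01; have [_] := H _ (m01 _ t01); rewrite ml.
apply/eqP; rewrite eq_le; apply/andP; split; last first.
  by have := m01 _ in0; rewrite in_itv/= => /andP[].
rewrite -[leRHS](lm _ in0); apply: mmono => //; first exact: l01.
by have := l01 _ in0; rewrite in_itv/= => /andP[].
Qed.

(** Each of the three ways to fail is witnessed by finitely many values of [xi] and a strict
    inequality, and a small enough perturbation of these values keeps the inequality. *)
Lemma few_values_stable xi m : ~ few_values xi m ->
  exists2 e, 0 < e & forall zeta, dJ1 xi zeta < e -> ~ few_values zeta m.
Proof.
have in0 : (0 : R) \in `[0, 1] by rewrite in_itv/= lexx ler01.
move=> nfew; have [xi0|/eqP xi0] := pselect (xi 0 = 0); last first.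
  exists (`|xi 0| / 2); first by rewrite divr_gt0 ?normr_gt0.
  move=> zeta /dJ1_lt_inverse[l [_ _ l0 Hl]] [z0 _ _].
  have := Hl _ in0; rewrite l0 z0 subr0 leNgt.
  by rewrite ltr_pdivrMr// mulr_natr mulr2n ltrDl normr_gt0 xi0.
have [mono|] := pselect ({in `[0, 1] &, {homo xi : s t / s <= t}}); last first.
  move=> /existsNP[s /existsNP[t]].
  move=> /not_implyP[s01 /not_implyP[t01 /not_implyP[st /negP]]].
  rewrite -ltNge => xts; exists ((xi s - xi t) / 3).
    by rewrite divr_gt0// subr_gt0.
  move=> zeta /dJ1_lt_inverse[l [l01 lmono _ Hl]] [_ zmono _].
  have := zmono _ _ (l01 _ s01) (l01 _ t01) (lmono _ _ s01 t01 st).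
  have := Hl _ s01; have := Hl _ t01; rewrite !ler_norml.
  by move=> /andP[? ?] /andP[? ?] ?; lra.
have [few|] := pselect (forall vs, uniq vs -> (forall v, v \in vs -> attained xi v) ->
     (size vs <= m)%N); first by case: nfew.
move=> /existsNP[vs /not_implyP[uvs /not_implyP[vsP /negP]]].
rewrite -ltnNge => mvs.
(* [e] bounds from below both the [m + 1] or more positive values and their mutual distances. A
   perturbation of [e / 3] leaves them positive, and two of them could merge only at distance at
   most [2 * e / 3]. *)
have [e e0 He] : exists2 e, 0 < e &
    {in vs ++ [seq `|x.1 - x.2| | x <- [seq (v, w) | v <- vs, w <- vs] & x.1 != x.2],
      forall x, e <= x}.
  apply: seq_gt0_lbound => x; rewrite mem_cat => /orP[/vsP[]//|].
  move=> /mapP[[v w]]; rewrite mem_filter/= => /andP[vw _] ->.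
  by rewrite normr_gt0 subr_eq0.
exists (e / 3); first by rewrite divr_gt0.
move=> zeta /dJ1_lt_inverse[l [l01 _ _ Hl]] [_ _ few].
have /choice[f Hf] : forall v, exists u, v \in vs ->
    [/\ u \in `[0, 1] & `|v - zeta u| <= e / 3].
  move=> v; have [vvs|vvs] := boolP (v \in vs); last by exists 0.
  have [_ [t t01 <-]] := vsP _ vvs.
  by exists (l t) => _; split; [exact: l01|exact: Hl].
have finj : {in vs &, injective (zeta \o f)}.
  move=> v w vvs wvs /= fvw; apply/eqP; apply: contrapT => /negP vw.
  have : e <= `|v - w|.
    apply: He; rewrite mem_cat; apply/orP; right; apply/mapP; exists (v, w) => //.
    by rewrite mem_filter/= vw; apply/allpairsP; exists (v, w).
  have [_ +] := Hf _ vvs; have [_ +] := Hf _ wvs; rewrite fvw => hw hv.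
  rewrite (_ : v - w = (v - zeta (f w)) - (w - zeta (f w))); last by ring.
  by move=> /le_trans/(_ (ler_normB _ _)); lra.
have := few [seq zeta (f v) | v <- vs].
rewrite size_map map_inj_in_uniq// => /(_ uvs).
rewrite leqNgt mvs => H; have : false; last by []. apply: H.
move=> _ /mapP[v vvs ->]; have [fv01 fv] := Hf _ vvs; split; last by exists (f v).
have : e <= v by apply: He; rewrite mem_cat vvs.
by move: fv; rewrite ler_norml => /andP[]; lra.
Qed.

Lemma rate_fun_finite d (lambda : 'I_d -> R) (x : sum_prod (skorokhod R) d)
    (k : 'I_d -> nat) :
  (forall i, exists z t, @step_path R (k i) z t (x i)) ->
  rate_fun lambda x = (\sum_(i < d) lambda i * (k i)%:R)%:E.
Proof.
move=> H; rewrite /rate_fun; case: ifPn => [_|/asboolPn []]; last first.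
  by move=> i; have [z [t /step_path_finite_jumps]] := H i.
rewrite -sumEFin; apply: eq_bigr => i _; have [z [t st]] := H i.
by rewrite (step_path_jump_count st).
Qed.

Lemma rate_fun_ge0 d (lambda : 'I_d -> R) (x : sum_prod (skorokhod R) d) :
  (forall i, 0 < lambda i) -> (0 <= rate_fun lambda x)%E.
Proof.
move=> lambda0; rewrite /rate_fun; case: ifP => // _.
apply: sume_ge0 => i _; apply: mule_ge0; first by rewrite lee_fin ltW.
by apply: esum_ge0 => t _; case: ifP.
Qed.

Lemma rate_funP d (lambda : 'I_d -> R) (x : sum_prod (skorokhod R) d) :
  rate_fun lambda x = +oo%E \/
  exists2 k : 'I_d -> nat, rate_fun lambda x = (\sum_(i < d) lambda i * (k i)%:R)%:E &
   forall i, exists z t, @step_path R (k i) z t (x i).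
Proof.
have [fj|nfj] := pselect (forall i, finite_jumps (x i)); last first.
  by left; rewrite /rate_fun; case: ifPn => // /asboolP.
right; have /choice[k kP] : forall i, exists k, exists z t, @step_path R k z t (x i).
  by move=> i; have [k [z [t H]]] := fj i; exists k, z, t.
by exists k => //; exact: rate_fun_finite.
Qed.

(** Failing [few_values] at [(M i).-1] forces at least [M i] jumps on a step path, and this failure
    is stable. It thus suffices to find integers [M i] of total cost above [a] that are forced at
    [x]. *)
Lemma rate_fun_lower_semicontinuous d (lambda : 'I_d -> R) :
  (forall i, 0 < lambda i) ->
  lower_semicontinuous (rate_fun lambda : sum_prod (skorokhod R) d -> \bar R).
Proof.
move=> lambda0 x a ax.
(* [M i = 0] forces nothing, whence the disjunction. If all coordinates are step paths, [M] counts
   their jumps; otherwise some coordinate fails [few_values] at every bound, and an [M] large there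
   and 0 elsewhere exceeds [a]. *)
have [M aM MP] : exists2 M : 'I_d -> nat, a < \sum_(i < d) lambda i * (M i)%:R &
    forall i, M i = 0%N \/ ~ few_values (x i) (M i).-1.
  have [fj|] := pselect (forall i, finite_jumps (x i)).
    have [Ioo|[k Ik kP]] := rate_funP lambda x.
      have /choice[k kP] : forall i, exists k, exists z t, @step_path R k z t (x i).
        by move=> i; have [k [z [t H]]] := fj i; exists k, z, t.
      by move: Ioo; rewrite (rate_fun_finite _ kP).
    exists k; first by rewrite -lte_fin -Ik.
    move=> i; case E : (k i) => [|m]; [by left|right => /few_values_step_path].
    move=> [j jm [z' [t' st']]]; have [z [t st]] := kP i.
    have := step_path_jump_count st'; rewrite (step_path_jump_count st) => -[].
    by move/eqP; rewrite eqr_nat E => /eqP mj; move: jm; rewrite -mj ltnn.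
  move=> /existsNP[i0 nfj].
  pose N := (Num.truncn (`|a| / lambda i0)).+1.
  exists (fun i => if i == i0 then N else 0%N).
    rewrite (bigD1 i0)//= eqxx big1 ?addr0; last first.
      by move=> i /negbTE ->; rewrite mulr0.
    rewrite mulrC -ltr_pdivrMr// (le_lt_trans _ (truncnS_gt _))//.
    by rewrite ler_pM2r ?invr_gt0// ler_norm.
  move=> i; case: eqP => [->|_]; [right|by left] => /few_values_step_path.
  by move=> [k _ [z [t /step_path_finite_jumps]]].
have [e e0 He] : exists2 e, 0 < e & forall i zeta, dJ1 (x i) zeta < e ->
    M i = 0%N \/ ~ few_values zeta (M i).-1.
  have : \forall e \near (0 : R)^'+, forall i zeta, dJ1 (x i) zeta < e ->
      M i = 0%N \/ ~ few_values zeta (M i).-1.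
    apply: filter_forall => i; have [Mi|/few_values_stable[e e0 He]] := MP i.
      by apply: nearW => e zeta _; left.
    near=> e' => zeta xz; right; apply: He; apply: lt_le_trans xz _.
    by near: e'; exact: nbhs_right_le.
  move=> H.
  have : \forall e \near (0 : R)^'+, 0 < e by exact: nbhs_right_gt.
  by move=> /(filterI H) /filter_ex[e [He e0]]; exists e.
exists (ball x e); first exact: nbhsx_ballx.
move=> y; rewrite ballEmdist/= => xy.
have [->|[k -> kP]] := rate_funP lambda y; first exact: ltry.
rewrite lte_fin (lt_le_trans aM)//; apply: ler_sum => i _.
rewrite ler_wpM2l ?(ltW (lambda0 i))// ler_nat.
have xyi : dJ1 (x i) (y i) < e.
  apply: le_lt_trans xy; rewrite [leRHS](_ : _ = \sum_(j < d) dJ1 (x j) (y j))//.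
  by rewrite (bigD1 i)//= lerDl sumr_ge0// => j _; exact: dJ1_ge0.
have [->//|nfew] := He i _ xyi.
have [z [t /step_path_few_values few]] := kP i.
rewrite leqNgt; apply/negP => kM; apply: nfew; apply: few_values_leq few.
by case: (M i) kM.
Unshelve. all: by end_near. Qed.

End lower_semicontinuity.

(** * Time changes that move finitely many points *)

Section tents.
Context (R : realType).
Implicit Types (x y s e r : R).

Lemma lipschitz01_continuous (f : R -> R) (K : R) : 0 < K ->
  {in `[0, 1] &, forall x y, `|f x - f y| <= K * `|x - y|} ->
  {within `[0, 1]%classic, continuous f}.
Proof.
move=> K0 fK; apply/subspace_continuousP => x x01.
apply/cvgrPdist_le => e e0; rewrite near_withinE; near=> y => y01.
rewrite (le_trans (fK _ _ x01 y01))// -ler_pdivlMl//.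
near: y; apply: cvgr_dist_le => //.
by rewrite mulr_gt0// invr_gt0.
Unshelve. all: by end_near. Qed.

(** The intermediate value theorem gives surjectivity; the lower slope bound [1 / 2] makes the
    inverse single-valued and 2-Lipschitz, hence continuous. *)
Lemma bilipschitz_time_change (l : R -> R) : l 0 = 0 -> l 1 = 1 ->
    (forall x y, x <= y -> (y - x) / 2 <= l y - l x) ->
    (forall x y, `|l x - l y| <= 2 * `|x - y|) ->
  time_change l.
Proof.
move=> l0 l1 lge lle.
have mono x y : x <= y -> l x <= l y.
  move=> xy; rewrite -subr_ge0 (le_trans _ (lge _ _ xy))//.
  by rewrite divr_ge0// subr_ge0.
have l01 : {homo l : t / t \in `[0, 1]}.
  by move=> t; rewrite !in_itv/= => /andP[/mono + /mono]; rewrite l0 l1 => -> ->.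
have cl : {within `[0, 1]%classic, continuous l}.
  by apply: (@lipschitz01_continuous _ 2) => // x y _ _; exact: lle.
have linj x y : `|x - y| <= 2 * `|l x - l y|.
  wlog xy : x y / x <= y.
    by move=> H; have [/H//|/ltW/H] := leP x y; rewrite distrC [`|l _ - _|]distrC.
  rewrite distrC [`|l _ - _|]distrC !ger0_norm ?subr_ge0 ?mono//.
  by have := lge _ _ xy; lra.
have /choice[m Hm] : forall y, exists x, y \in `[0, 1] -> x \in `[0, 1] /\ l x = y.
  move=> y; have [y01|_] := boolP (y \in `[0, 1]); last by exists 0.
  have [|x x01 <-] := @IVT R l 0 1 y ler01 cl.
    by rewrite l0 l1 minEle maxEle ler01; move: y01; rewrite in_itv.
  by exists x.
split; last by move=> s t _ _; exact: mono.
split => //; exists m; split.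
- by move=> t /Hm[].
- apply: (@lipschitz01_continuous _ 2) => // x y /Hm[_ E1] /Hm[_ E2].
  by rewrite -{2}E1 -{2}E2; exact: linj.
- move=> t t01; have [_ E] := Hm _ (l01 _ t01).
  apply/eqP; rewrite -subr_eq0 -normr_le0 (le_trans (linj _ _))//.
  by rewrite E subrr normr0 mulr0.
- by move=> t /Hm[].
Qed.

Definition tent (rho c x : R) : R := Num.max 0 (1 - `|x - c| / rho).

Lemma tent_ge0 rho c x : 0 <= tent rho c x.
Proof. by rewrite /tent le_max lexx. Qed.

Lemma tent_le1 rho c x : 0 < rho -> tent rho c x <= 1.
Proof.
by move=> r0; rewrite /tent ge_max ler01/= gerBl divr_ge0// ltW.
Qed.

Lemma tentcc rho c : tent rho c c = 1.
Proof. by rewrite /tent subrr normr0 mul0r subr0 max_r. Qed.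

Lemma tent_eq0 rho c x : 0 < rho -> rho <= `|x - c| -> tent rho c x = 0.
Proof.
by move=> r0 rx; rewrite /tent max_l// subr_le0 ler_pdivlMr// mul1r.
Qed.

Lemma tent_lipschitz rho c x y : 0 < rho ->
  `|tent rho c x - tent rho c y| <= `|x - y| / rho.
Proof.
move=> r0; have H : `| `|x - c| / rho - `|y - c| / rho| <= `|x - y| / rho.
  rewrite -mulrBl normrM [`|rho^-1|]gtr0_norm ?invr_gt0//.
  rewrite ler_wpM2r ?invr_ge0 ?(ltW r0)// (le_trans (ler_dist_dist _ _))//.
  by rewrite opprB addrA subrK.
have : 0 <= `|x - y| / rho by rewrite divr_ge0// ltW.
move: H; rewrite /tent; set u := `|x - c| / rho; set v := `|y - c| / rho.
move: (_ / rho) => w; rewrite !ler_norml => /andP[? ?] ?.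
rewrite !maxEle.
by case: (leP 0 (1 - u)) => ?; case: (leP 0 (1 - v)) => ?; apply/andP; split; lra.
Qed.

(** Take [l x = x + \sum_i (t' i - t i) * tent rho (t i) x]. The radius [rho] is at most every gap
    between the [t i], to 0, and to 1 when [t i < 1], so each tent vanishes at the other jump times
    and at the endpoints, and [l (t i) = t' i]. A jump time 1 cannot move, hence the last
    hypothesis. *)
Lemma time_change_moving k (t : 'I_k -> R) e : injective t ->
    (forall i, 0 < t i <= 1) -> 0 < e ->
  exists2 r, 0 < r & forall t' : 'I_k -> R,
    (forall i, `|t' i - t i| <= r) -> (forall i, t i = 1 -> t' i = 1) ->
  exists l, [/\ time_change l, forall s, `|l s - s| <= e &
    forall i s, (t' i <= l s) = (t i <= s)].
Proof.
move=> tI t01 e0.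
have [rho rho0 Hrho] : exists2 rho, 0 < rho &
    {in [seq t i | i <- enum 'I_k] ++ [seq 1 - t i | i <- enum 'I_k & t i < 1] ++
        [seq `|t p.1 - t p.2| | p <- enum {: 'I_k * 'I_k} & p.1 != p.2],
      forall x, rho <= x}.
  apply: seq_gt0_lbound => x; rewrite !mem_cat => /or3P[|/mapP[i]|/mapP[[i j]]].
  - by move=> /mapP[i _ ->]; have /andP[] := t01 i.
  - by rewrite mem_filter => /andP[ti _] ->; rewrite subr_gt0.
  - rewrite mem_filter/= => /andP[ij _] ->; rewrite normr_gt0 subr_eq0.
    by apply: contra ij => /eqP/tI ->.
have rt i : rho <= t i.
  by apply: Hrho; rewrite !mem_cat map_f ?mem_enum.
have rt1 i : t i < 1 -> rho <= 1 - t i.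
  move=> ti; apply: Hrho; rewrite !mem_cat; apply/or3P; apply: Or32.
  by apply/mapP; exists i => //; rewrite mem_filter ti mem_enum.
have rtt i j : i != j -> rho <= `|t i - t j|.
  move=> ij; apply: Hrho; rewrite !mem_cat; apply/or3P; apply: Or33.
  by apply/mapP; exists (i, j) => //; rewrite mem_filter ij mem_enum.
(* The total displacement is at most [c]. The bound [rho / 2] makes the perturbation
   [1 / 2]-Lipschitz, even where tents overlap, and the bound [e] controls the distance to the
   identity. Dividing by [k.+1] shares [c] among the [k] points. *)
pose c := Num.min (rho / 2) e.
have c0 : 0 < c by rewrite lt_min e0 divr_gt0.
exists (c / k.+1%:R); first by rewrite divr_gt0.
move=> t' tt' t'1; pose h i := t' i - t i.
pose D x := \sum_(i < k) h i * tent rho (t i) x.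
pose l x := x + D x.
have hc : \sum_(i < k) `|h i| <= c.
  apply: (@le_trans _ _ (\sum_(i < k) c / k.+1%:R)); first by apply: ler_sum => i _; exact: tt'.
  rewrite sumr_const card_ord -(mulr_natr _ k) mulrAC ler_pdivrMr//.
  by rewrite ler_wpM2l ?(ltW c0)// ler_nat.
have Dx x : `|D x| <= e.
  rewrite (le_trans (ler_norm_sum _ _ _))//.
  apply: (@le_trans _ _ (\sum_(i < k) `|h i|)); last by rewrite (le_trans hc)// ge_min lexx orbT.
  apply: ler_sum => i _; rewrite normrM ler_piMr//.
  by rewrite ger0_norm ?tent_ge0// tent_le1.
have DD x y : `|D x - D y| <= `|x - y| / 2.
  rewrite /D -sumrB (le_trans (ler_norm_sum _ _ _))//.
  apply: (@le_trans _ _ (\sum_(i < k) `|h i| * (`|x - y| / rho))).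
    apply: ler_sum => i _; rewrite -mulrBr normrM ler_wpM2l//.
    exact: tent_lipschitz.
  rewrite -mulr_suml mulrCA ler_wpM2l// ler_pdivrMr// mulrC (le_trans hc)//.
  by rewrite ge_min lexx.
have l0 : l 0 = 0.
  rewrite /l /D big1 ?addr0// => i _; rewrite tent_eq0 ?mulr0//.
  by rewrite sub0r normrN ger0_norm ?rt// (le_trans (ltW rho0)).
have l1 : l 1 = 1.
  rewrite /l /D big1 ?addr0// => i _; have /andP[_ ti1] := t01 i.
  have [ti|ti] := ltP (t i) 1; last first.
    have ti_eq1 : t i = 1 by apply/eqP; rewrite eq_le ti1.
    by rewrite /h t'1 ?ti_eq1 ?subrr ?mul0r.
  by rewrite tent_eq0 ?mulr0// ger0_norm ?subr_ge0// rt1.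
have lt_ i : l (t i) = t' i.
  rewrite /l /D (bigD1 i)//= tentcc mulr1 big1 ?addr0; first by rewrite /h; ring.
  move=> j ji; rewrite tent_eq0 ?mulr0// rtt// eq_sym//.
have lge x y : x <= y -> (y - x) / 2 <= l y - l x.
  move=> xy; have := DD y x; rewrite [`|y - x|]ger0_norm ?subr_ge0// ler_norml /l.
  by move=> /andP[]; lra.
have lle x y : `|l x - l y| <= 2 * `|x - y|.
  rewrite /l (_ : x + D x - _ = (x - y) + (D x - D y)); last by ring.
  rewrite (le_trans (ler_normD _ _))// (le_trans (lerD (lexx _) (DD _ _)))//.
  by have := normr_ge0 (x - y); lra.
exists l; split; first exact: bilipschitz_time_change.
  by move=> s; rewrite /l addrAC subrr add0r.
move=> i s; rewrite -lt_; apply/idP/idP => [|ts].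
  have [//|st] := leP (t i) s.
  by have := lge _ _ (ltW st); move: st; lra.
by have := lge _ _ ts; move: ts; lra.
Qed.

End tents.

(** * Walks with prescribed jumps *)

Section walks_near_step_paths.
Context (R : realType).

(** The index is the ceiling of [n * t] minus one, so that the summand enters at the first grid
    point not before [t]. *)
Lemma jump_index (n : nat) (t : R) : (0 < n)%N -> 0 < t <= 1 ->
  exists j : nat, [/\ (j < n)%N, j%:R < n%:R * t & n%:R * t <= j.+1%:R].
Proof.
move=> n0 /andP[t0 t1]; have n0' : 0 < n%:R :> R by rewrite ltr0n.
have nt0 : 0 < n%:R * t by rewrite mulr_gt0.
have ntn : n%:R * t <= n%:R by rewrite -[leRHS]mulr1 ler_pM2l.
have /andP[h1 h2] := truncn_itv (ltW nt0).
suff [j j1 j2] : exists2 j : nat, j%:R < n%:R * t & n%:R * t <= j.+1%:R.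
  by exists j; split => //; rewrite -(ltr_nat R) (lt_le_trans j1).
have [h3|h3] := ltP (Num.truncn (n%:R * t))%:R (n%:R * t).
  by exists (Num.truncn (n%:R * t)) => //; rewrite ltW.
case: (Num.truncn (n%:R * t)) h1 h2 h3 => [|k] h1 h2 h3.
  by move: nt0; rewrite ltNge h3.
by exists k => //; rewrite (lt_le_trans _ h1)// ltr_nat.
Qed.

Lemma sum_split_codom (k m : nat) (J : 'I_k -> nat) (F : nat -> R) :
  injective J ->
  \sum_(j <- iota 0 m) F j = \sum_(a < k) (if (J a < m)%N then F (J a) else 0) +
    \sum_(j <- iota 0 m | j \notin codom J) F j.
Proof.
move=> Ji; rewrite (bigID (fun j => j \in codom J))/=; congr (_ + _).
rewrite -big_mkcond -big_filter.
rewrite (perm_big [seq J a | a <- enum 'I_k & (J a < m)%N]).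
  by rewrite big_map big_filter big_enum_cond.
apply: uniq_perm; rewrite ?filter_uniq ?iota_uniq//.
  by rewrite (map_inj_uniq Ji); exact: filter_uniq (enum_uniq _).
move=> j; rewrite mem_filter mem_iota add0n /=; apply/andP/mapP.
  by move=> [/codomP[a ->] Jm]; exists a; rewrite // mem_filter Jm mem_enum.
by move=> [a]; rewrite mem_filter => /andP[Jm _] ->; rewrite codom_f.
Qed.

(** After the time change [l] the prescribed summands enter exactly when [xi] jumps. Each of the [k]
    jumps then contributes an error [eps] for its size and [eps] for its centring, and the remaining
    summands contribute one more [eps]. *)
Lemma walk_near_step_path k (z t : 'I_k -> R) xi n (x : nat -> R) m
    (J : 'I_k -> nat) (l : R -> R) (e eps : R) :
    step_path z t xi -> (0 < n)%N -> injective J -> time_change l ->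
    (forall s, `|l s - s| <= e) ->
    (forall a s, ((J a).+1%:R / n%:R <= l s) = (t a <= s)) ->
    (forall a, `|x (J a) - z a * n%:R| <= eps * n%:R) -> `|m| <= eps * n%:R ->
    (forall i, (i <= n)%N ->
      `|\sum_(j <- iota 0 i | j \notin codom J) (x j - m)| <= eps * n%:R) ->
  dJ1 (walk x m n) xi <= Num.max e ((2 * k%:R + 1) * eps).
Proof.
move=> [z0 tI t01 xiE] n0 Ji tl le Jl xJ mn rest.
have n0' : 0 < n%:R :> R by rewrite ltr0n.
apply: J1_within_le; exists l => // s s01; split; first by rewrite le_max le.
rewrite le_max; apply/orP; right.
have ls01 : l s \in `[0, 1] by have [[+ _ _] _] := tl; apply.
have [s1 [ls0 ls1]] : s <= 1 /\ (0 <= l s /\ l s <= 1).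
  by move: s01 ls01; rewrite !in_itv/= => /andP[_ ->] /andP[-> ->].
rewrite /= /walk_fun ls01; set i := Num.truncn _.
have il : (i <= n)%N.
  rewrite -(ler_nat R) (@le_trans _ _ (n%:R * l s)) ?truncn_le ?mulr_ge0//.
  by rewrite -[leRHS]mulr1 ler_pM2l.
have Ji_ a : (J a < i)%N = (t a <= s).
  by rewrite truncn_ge_nat ?mulr_ge0// -Jl ler_pdivrMr// mulrC.
rewrite -(big_mkord xpredT (fun j => x j - m)) /index_iota subn0.
rewrite (sum_split_codom i _ Ji) xiE mulrDr.
set rst := \sum_(j <- iota 0 i | _) _.
have -> : n%:R^-1 * \sum_(a < k) (if (J a < i)%N then x (J a) - m else 0) +
    n%:R^-1 * rst - \sum_(a < k) z a * \1_(`[t a, 1]) s =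
  \sum_(a < k) (t a <= s)%R%:R * (n%:R^-1 * (x (J a) - z a * n%:R - m)) + n%:R^-1 * rst.
  rewrite addrAC; congr (_ + _); rewrite mulr_sumr -sumrB; apply: eq_bigr => a _.
  rewrite indic_itv_le// Ji_; case: (t a <= s).
    by rewrite !mulr1 mul1r; field; rewrite gt_eqF.
  by rewrite !mulr0 mul0r subrr.
rewrite (le_trans (ler_normD _ _))// mulrDl mul1r; apply: lerD; last first.
  by rewrite normrM ger0_norm ?invr_ge0// mulrC ler_pdivrMr// rest.
rewrite (le_trans (ler_norm_sum _ _ _))//.
apply: (@le_trans _ _ (\sum_(a < k) (2 * eps))); last first.
  by rewrite sumr_const card_ord -(mulr_natr _ k); lra.
apply: ler_sum => a _; rewrite normrM -[leRHS]mul1r ler_pM//.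
  by case: (t a <= s); rewrite ?normr1 ?normr0.
rewrite normrM ger0_norm ?invr_ge0// mulrC ler_pdivrMr//.
rewrite (le_trans (ler_normB _ _))//.
by have := xJ a; have := mn; lra.
Qed.

End walks_near_step_paths.

(** * Measurability of the walks *)

Section walk_measurability.
Context (R : realType).

Lemma dJ1_walk_le (z z' : nat -> R) m n :
  dJ1 (walk z m n) (walk z' m n) <= \sum_(j < n) `|z j - z' j|.
Proof.
have S0 : 0 <= \sum_(j < n) `|z j - z' j| by rewrite sumr_ge0.
(* For [n = 0] the convention [0^-1 = 0] makes both walks vanish. For [n > 0] the factor [n^-1] is
   at most 1 and is discarded. *)
case: n S0 => [|n] S0.
  rewrite big_ord0; apply: dJ1_le_uniform => t t01.
  by rewrite /= /walk_fun t01 invr0 !mul0r subrr normr0.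
apply: walk_close => // k kn.
rewrite (eq_bigr (fun j => z j - z' j)); last by move=> j _; ring.
rewrite (le_trans (ler_norm_sum _ _ _))// (@le_trans _ _ (\sum_(j < n.+1) `|z j - z' j|))//.
  rewrite -[X in iota 0 X]subn0 -/(index_iota 0 k) big_mkord.
  rewrite (big_ord_widen _ (fun j => `|z j - z' j|) kn).
  by rewrite [leLHS]big_mkcond; apply: ler_sum => j _; case: ifP.
by rewrite ler_peMr// ler1n.
Qed.

Context (dT : measure_display) (T : measurableType dT).

(** The tuple of paths is a Lipschitz function [U] of [d * n] real summands. The preimage of an open
    set is then a countable union of events that place the summands in a ball with rational
    centre. *)
Lemma measurable_walks (d n : nat) (Z : 'I_d -> nat -> T -> R) (m : 'I_d -> R)
    (G : set (sum_prod (skorokhod R) d)) :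
    (forall i j, measurable_fun setT (Z i j)) -> open G ->
  measurable ((fun w => (fun i => walk (fun j => Z i j w) (m i) n)
    : sum_prod (skorokhod R) d) @^-1` G).
Proof.
move=> mZ oG.
pose dist (u v : 'I_d * 'I_n -> R) := \sum_(k : 'I_d * 'I_n) `|u k - v k|.
pose U (u : 'I_d * 'I_n -> R) : sum_prod (skorokhod R) d :=
  fun i => walk (fun j => if insub j is Some j' then u (i, j') else 0) (m i) n.
pose Zw w (k : 'I_d * 'I_n) := Z k.1 k.2 w.
have UE w : U (Zw w) = (fun i => walk (fun j => Z i j w) (m i) n).
  apply/funext => i; apply: mdist_positivity; apply/eqP; rewrite eq_le mdist_ge0 andbT.
  rewrite (le_trans (dJ1_walk_le _ _ _ _))// big1// => j _.
  by rewrite valK subrr normr0.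
have Udist u v : mdist (U u) (U v) <= dist u v.
  rewrite [leLHS](_ : _ = \sum_(i < d) dJ1 (U u i) (U v i))//.
  have -> : dist u v = \sum_(i < d) \sum_(j < n) `|u (i, j) - v (i, j)|.
    by rewrite pair_bigA; apply: eq_bigr => -[i j] _.
  apply: ler_sum => i _; rewrite (le_trans (dJ1_walk_le _ _ _ _))//.
  by apply: ler_sum => j _; rewrite valK.
pose q2u (q : {ffun 'I_d * 'I_n -> rat}) k : R := ratr (q k).
pose B (q : {ffun 'I_d * 'I_n -> rat}) (p : nat) := [set w | dist (Zw w) (q2u q) < p.+1%:R^-1].
pose good (q : {ffun 'I_d * 'I_n -> rat}) (p : nat) :=
  forall u, dist u (q2u q) < p.+1%:R^-1 -> G (U u).
have mB q p : measurable (B q p).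
  have mS : measurable_fun setT (fun w => dist (Zw w) (q2u q)).
    apply: measurable_sum => k; apply: measurableT_comp => //.
    by apply: measurable_funB => //; exact: mZ.
  rewrite (_ : B q p = (fun w => dist (Zw w) (q2u q)) @^-1` `]-oo, p.+1%:R^-1[%classic).
    by rewrite -[X in measurable X](setTI (_ @^-1` _)); exact: mS.
  by apply/seteqP; split => w /=; rewrite in_itv.
rewrite (_ : _ @^-1` G = \bigcup_k
    (if @unpickle ({ffun 'I_d * 'I_n -> rat} * nat)%type k is Some x then
     if `[< good x.1 x.2 >] then B x.1 x.2 else set0 else set0)).
  by apply: bigcupT_measurable => k; case: unpickle => // x; case: ifP.
apply/seteqP; split => w /=; last first.
  move=> [k _ /=]; case: unpickle => // -[q p] /=; case: ifPn => // /asboolP gqp Bw.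
  by rewrite -UE; exact: gqp.
rewrite -UE => GU.
have [e /= e0 He] : exists2 e, 0 < e & ball (U (Zw w)) e `<=` G.
  by have /nbhs_ballP[e /= e0 He] := open_nbhs_nbhs (conj oG GU); exists e.
(* If a centre is within [1 / p.+1] of the summands, its whole ball of that radius is within
   [2 / p.+1 <= e] of them, so [U] maps it into [G]. *)
pose p := Num.truncn (2 / e).
have pe : 2 / p.+1%:R <= e.
  by rewrite ler_pdivrMr// mulrC -ler_pdivrMr// ltW// truncnS_gt.
pose N := (#|{: 'I_d * 'I_n}|).+1.
have c0 : 0 < p.+1%:R^-1 / N%:R :> R by rewrite divr_gt0 ?invr_gt0.
have /choice[q Hq] : forall k, exists q : rat, `|Zw w k - ratr q| < p.+1%:R^-1 / N%:R.
  move=> k.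
  have [|q] := @rat_in_itvoo R (Zw w k - p.+1%:R^-1 / N%:R) (Zw w k + p.+1%:R^-1 / N%:R).
    by rewrite ltrD2l -subr_gt0 opprK addr_gt0.
  rewrite in_itv/= => /andP[q1 q2]; exists q; rewrite ltr_norml.
  move: q1 q2; move: (ratr q) => r; move: (_ / N%:R) => h q1 q2.
  apply/andP; split; lra.
have wq : dist (Zw w) (q2u (finfun q)) < p.+1%:R^-1.
  apply: (@le_lt_trans _ _ (\sum_(k : 'I_d * 'I_n) p.+1%:R^-1 / N%:R)).
    by apply: ler_sum => k _; rewrite /q2u ffunE ltW.
  rewrite sumr_const -[_ *+ #|_|]mulr_natr -mulrA gtr_pMr ?invr_gt0//.
  by rewrite mulrC ltr_pdivrMr// mul1r ltr_nat.
exists (pickle (finfun q, p)) => //=; rewrite pickleK /=; case: ifPn => [//|/asboolPn []].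
move=> u uq; apply: He; rewrite ballEmdist/= (le_lt_trans (Udist _ _))//.
apply: lt_le_trans pe.
rewrite (_ : 2 / _ = p.+1%:R^-1 + p.+1%:R^-1); last by field; rewrite gt_eqF.
apply: le_lt_trans (ltrD wq uq); rewrite -big_split/=; apply: ler_sum => k _.
rewrite [X in _ <= _ + X]distrC (le_trans _ (ler_normD _ _))//.
by rewrite addrA subrK.
Qed.

End walk_measurability.

(** * Large deviation bounds *)

Section logarithmic_limits.
Context (R : realType).
Implicit Types (p : nat -> \bar R) (a : nat -> R) (q : R).
Local Open Scope ereal_scope.

Lemma limn_esup_lne_le p a q : (forall n, 0 <= p n) ->
    (\forall n \near \oo, (0 < a n)%R) ->
    (\forall n \near \oo, p n <= (expR (- (q * a n)))%:E) ->
  limn_esup (fun n => lne (p n) / (a n)%:E) <= (- q)%:E.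
Proof.
move=> p0 a0 pq; rewrite /limn_esup limf_esupE.
apply: ge_ereal_inf; exists (ereal_sup [set lne (p n) / (a n)%:E |
    n in [set n | lne (p n) / (a n)%:E <= (- q)%:E]]); last first.
  by apply: ge_ereal_sup => _ [n ? <-].
exists [set n | lne (p n) / (a n)%:E <= (- q)%:E] => //.
near=> n; have an : (0 < a n)%R by near: n.
rewrite /= inver gt_eqF// lee_pdivrMr//.
rewrite -EFinM mulNr -[X in _ <= X%:E]expRK -lne_EFin ?expR_gt0//.
rewrite lee_lne; first by near: n.
- by rewrite in_itv/= p0 leey.
- by rewrite in_itv/= lee_fin expR_ge0 leey.
Unshelve. all: by end_near. Qed.

Lemma limn_einf_lne_ge p a q :
    (\forall n \near \oo, (0 < a n)%R) ->
    (\forall n \near \oo, (expR (- (q * a n)))%:E <= p n) ->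
  (- q)%:E <= limn_einf (fun n => lne (p n) / (a n)%:E).
Proof.
move=> a0 pq; rewrite /limn_einf EFinN leeN2 /limn_esup limf_esupE.
apply: ge_ereal_inf; exists (ereal_sup [set - (lne (p n) / (a n)%:E) |
    n in [set n | - (lne (p n) / (a n)%:E) <= q%:E]]); last first.
  by apply: ge_ereal_sup => _ [n ? <-].
exists [set n | - (lne (p n) / (a n)%:E) <= q%:E] => //.
near=> n; have an : (0 < a n)%R by near: n.
have pn : (expR (- (q * a n)))%:E <= p n by near: n.
rewrite /= leeNl -EFinN inver gt_eqF// lee_pdivlMr//.
rewrite -EFinM mulNr -[X in X%:E <= _]expRK -lne_EFin ?expR_gt0//.
rewrite lee_lne//.
- by rewrite in_itv/= lee_fin expR_ge0 leey.
- by rewrite in_itv/= leey andbT (le_trans _ pn)// lee_fin expR_ge0.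
Unshelve. all: by end_near. Qed.

(** The infimum over the fattening does not increase with [e], so its limit at [0+] is a supremum
    and each [e] can be treated separately. *)
Lemma LDP_upper_lim (S : metricType R) (I : S -> \bar R) (F : set S) (l : \bar R) :
    (forall e, (0 < e)%R -> ereal_inf [set I x | x in fattening F e] <= - l) ->
  l <= - lim (ereal_inf [set I x | x in fattening F e] @[e --> 0%R^'+]).
Proof.
move=> H; pose k e := ereal_inf [set I x | x in fattening F e].
have : k e @[e --> 0%R^'+] --> ereal_sup [set k x | x in [set` `]0%R, +oo[%R]].
  apply: nonincreasing_at_right_cvge => // x y _ _ xy.
  apply: le_ereal_inf => _ [s sx <-]; exists s => //.
  by rewrite /fattening/= (le_trans sx)// lee_fin.
move=> /cvg_lim => ->//; rewrite leeNr; apply: ge_ereal_sup => _ [e /= + <-].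
by rewrite in_itv/= andbT; exact: H.
Qed.

End logarithmic_limits.

(** * Upper and lower bounds for the walks *)

Section heavy_tailed_families.
Context (R : realType) (dT : measure_display) (T : measurableType dT).
Context (P : probability T R) (d : nat) (gamma c beta : R) (lambda : 'I_d -> R).
Context (Z : 'I_d -> nat -> {RV P >-> R}).
Hypothesis gamma_gt1 : 1 < gamma.
Hypothesis c_gt0 : 0 < c.
Hypothesis lambda_gt0 : forall i, 0 < lambda i.
Hypothesis Z_iid : forall i, iid (Z i).
Hypothesis Z_ge0 : forall i j, {ae P, forall w, 0 <= Z i j w}.
Hypothesis Z_tail : forall i, \forall x \near +oo,
  P [set w | x < Z i 0%N w] =
  (c * x `^ beta * expR (- (lambda i * (ln x) `^ gamma)))%:E.
Hypothesis Z_indep : mutually_independent P (fun i => sigma_RVs (Z i)).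

Let mu i := fine 'E_P[Z i 0%N].
Let X (k : 'I_d * nat) : {RV P >-> R} := Z k.1 k.2.

Let X_indep : mutually_independent P (fun k => sigma_RV (X k)).
Proof. exact: (walks_independent Z_iid Z_indep). Qed.

Local Notation a_ n := (ln n%:R `^ gamma).

Lemma Z_log_tail i : \forall v \near +oo, P [set w | expR v < Z i 0%N w] =
  (expR (log_tail (ln c) beta (lambda i) gamma v))%:E.
Proof.
have [M [_ HM]] := Z_tail i.
near=> v; rewrite HM/=; last first.
  rewrite (@lt_le_trans _ _ (1 + v)) ?expR_ge1Dx//.
  by rewrite -ltrBlDl; near: v; apply: nbhs_pinfty_gt; exact: num_real.
rewrite /log_tail !expRD lnK ?posrE// expRK; congr (_ * _ * _)%:E.
by rewrite mulrC expRM.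
Unshelve. all: by end_near. Qed.

Lemma Z_prob_eq i j (A : set R) : measurable A ->
  P (Z i j @^-1` A) = P (Z i 0%N @^-1` A).
Proof. exact: (Z_iid i).2. Qed.

Lemma Z_integral_eq i j (f : R -> R) : measurable_fun setT f ->
  (forall x, 0 <= f x) ->
  (\int[P]_w (f (Z i j w))%:E = \int[P]_w (f (Z i 0%N w))%:E)%E.
Proof.
move=> mf f0.
have mf' : measurable_fun setT (fun x => (f x)%:E) by exact/measurable_EFinP.
have f0' x : (0 <= (f x)%:E)%E by rewrite lee_fin.
have := ge0_integral_distribution (Z i j) mf' f0'.
have := ge0_integral_distribution (Z i 0%N) mf' f0'.
rewrite /comp => <- <-; apply: eq_measure_integral => A mA _.
exact: (Z_iid i).2.
Qed.

(** All partial sums are included because the walk must be close uniformly in time. [Q] leaves out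
    the indices whose summands are prescribed to be large. *)
Definition deviates i n (dl e : R) (Q : pred nat) : set T :=
  [set w | exists2 m, (m <= n)%N & e * n%:R <=
     `|\sum_(j <- iota 0 m | Q j) (cut (dl * n%:R) (Z i j w) - mu i)|].

Lemma measurable_deviates i n dl e Q : measurable (deviates i n dl e Q).
Proof.
pose S m w := `|\sum_(j <- iota 0 m | Q j) (cut (dl * n%:R) (Z i j w) - mu i)|.
have mS m : measurable_fun setT (S m).
  apply: measurableT_comp => //.
  rewrite [X in measurable_fun _ X](_ : _ = fun w =>
    \sum_(j <- [seq j <- iota 0 m | Q j]) (cut (dl * n%:R) (Z i j w) - mu i)).
    apply: measurable_sum => j; apply: measurable_funB => //.
    by apply: measurableT_comp => //; exact: measurable_cut.
  by apply/funext => w; rewrite big_filter.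
rewrite (_ : deviates _ _ _ _ _ =
    \bigcup_(m in `I_n.+1) (S m @^-1` `[e * n%:R, +oo[%classic)).
  apply: bigcup_measurable => m _.
  by rewrite -[X in measurable X](setTI (_ @^-1` _)); exact: mS.
apply/seteqP; split => [w [m mn H]|w [m /= mn H]]; exists m => //.
  by rewrite /= in_itv/= andbT.
by move: H; rewrite in_itv/= andbT.
Qed.

(** The threshold for [n] is uniform in the rectangle, as it must be because the prescribed indices
    depend on [n]. Indices in [Q] avoid those of the rectangle, so its probability factors out. *)
Lemma near_deviates_le i (e M : R) : 0 < e -> 0 <= M ->
  exists2 dl0, 0 < dl0 & forall dl, 0 < dl <= dl0 -> \forall n \near \oo,
    forall (s : seq ('I_d * nat)) (A : 'I_d * nat -> set R) (Q : pred nat),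
      uniq s -> (forall k, measurable (A k)) ->
      (forall j, Q j -> (i, j) \notin s) ->
    (P (rectangle X s A `&` deviates i n dl e Q) <=
     P (rectangle X s A) * (expR (- (M * ln n%:R `^ gamma)))%:E)%E.
Proof.
(* [s_ * e = M + 1]: the surplus [a] in the exponent [(M + 1) * a] pays for the [2 * (n + 1)] events
   of the union bound and for the factor [expR 1] of the moment generating functions. The choice of
   the bound on [dl] keeps [s_ * dl] at half the admissible threshold. *)
move=> e0 M0; pose s_ := (M + 1) / e.
have s0 : 0 < s_ by rewrite divr_gt0// ltr_wpDl.
have L0 : 0 < lambda i * 2^-1 `^ gamma by rewrite mulr_gt0// powR_gt0.
exists (lambda i * 2^-1 `^ gamma / (2 * s_)); first by rewrite divr_gt0// mulr_gt0.
move=> dl /andP[dl0]; rewrite ler_pdivlMr => [dlL|]; last exact: mulr_gt0.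
have sdl : s_ * dl < lambda i * 2^-1 `^ gamma.
  have : 0 < s_ * dl by rewrite mulr_gt0.
  lra.
have Hm := near_mgf_cut_le gamma_gt1 (lambda_gt0 i) (Z_log_tail i) (Z_ge0 i 0%N) s0 dl0 sdl.
have H4 : 0 < (4 * expR 1)^-1 :> R by rewrite invr_gt0 mulr_gt0 ?expR_gt0.
near=> n => s A Q us mA Qs.
have n0 : 0 < n%:R :> R by rewrite ltr0n; near: n; exists 1%N.
set a := ln n%:R `^ gamma.
have a1 : 1 <= a by rewrite /a; near: n; exact: near_speed_ge.
pose th := s_ * a / n%:R.
have th0 : 0 < th by apply: divr_gt0 => //; apply: mulr_gt0 => //; exact: lt_le_trans a1.
pose h (sg : bool) (k : 'I_d * nat) x := (-1) ^+ sg * th * (cut (dl * n%:R) x - mu i).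
pose u m := [seq (i, j) | j <- iota 0 m & Q j].
(* [r] encodes the number [r./2] of summands and the sign [odd r]. *)
pose B r := rectangle X s A `&`
  [set w | th * (e * n%:R) <= \sum_(k <- u r./2) h (odd r) k (X k w)].
have mh sg k : measurable_fun setT (h sg k).
  by apply: measurable_funM => //; apply: measurable_funB => //; exact: measurable_cut.
have mR : measurable (rectangle X s A) by exact: measurable_rectangle.
have mB r : measurable (B r).
  apply: measurableI => //.
  pose S w := \sum_(k <- u r./2) h (odd r) k (X k w).
  have mS : measurable_fun setT S.
    apply: measurable_sum => k.
    by apply: measurableT_comp => //; exact: measurable_funP.
  rewrite (_ : [set _ | _] = S @^-1` `[th * (e * n%:R), +oo[%classic).
    by rewrite -[X in measurable X](setTI (_ @^-1` _)); exact: mS.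
  by apply/seteqP; split => w /=; rewrite in_itv/= andbT.
apply: (@le_trans _ _ (P (\big[setU/set0]_(r < n.+1.*2) B r))).
  apply: le_measure; rewrite ?inE.
  - by apply: measurableI => //; exact: measurable_deviates.
  - exact: bigsetU_measurable.
  move=> w [Rw [m mn]]; set S := \sum_(j <- _ | _) _ => eS.
  rewrite -bigcup_mkord.
  have ES sg : \sum_(k <- u m) h sg k (X k w) = (-1) ^+ sg * th * S.
    by rewrite big_map big_filter /h mulr_sumr.
  pose sg := S < 0.
  exists (sg + m.*2)%N => /=.
    rewrite (@leq_ltn_trans (1 + m.*2))%N ?leq_add2r ?leq_b1//.
    by rewrite add1n doubleS !ltnS leq_double.
  rewrite /B; have -> : (sg + m.*2)./2 = m by rewrite half_bit_double.
  have -> : odd (sg + m.*2) = sg by rewrite oddD odd_double addbF; case: sg.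
  split=> //=; rewrite ES -mulrA [leRHS]mulrCA ler_wpM2l ?(ltW th0)//.
  rewrite (le_trans eS)// /sg; case: ltrP => [S0|S0].
    by rewrite expr1 mulN1r ltr0_norm.
  by rewrite expr0 mul1r ger0_norm.
apply: (le_trans (Boole_inequality _ _)) => //.
have BE r : (r < n.+1.*2)%N ->
    (P (B r) <= P (rectangle X s A) * (expR (1 - (M + 1) * a))%:E)%E.
  move=> rn.
  have usu : uniq (s ++ u r./2).
    rewrite cat_uniq us map_inj_uniq ?filter_uniq ?iota_uniq ?andbT//=; last by move=> x y [].
    by apply/hasPn => k /mapP[j]; rewrite mem_filter => /andP[Qj _] ->; exact: Qs.
  have hr k : k \in u r./2 ->
      (\int[P]_w (expR (h (odd r) k (X k w)))%:E <= (expR n%:R^-1)%:E)%E.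
    move=> /mapP[j _ ->]; rewrite /X/=.
    rewrite (@Z_integral_eq i j (fun x => expR (h (odd r) (i, j) x)))//.
      by have := near Hm n; apply.
    exact: measurableT_comp.
  have := @chernoff_indep _ _ _ P _ X s (u r./2) A (h (odd r)) (fun=> n%:R^-1)
    (th * (e * n%:R)) X_indep usu mA (mh _) hr.
  move=> /le_trans; apply.
  rewrite lee_wpmul2l// lee_fin ler_expR lerB//.
    rewrite big_const_seq count_predT iter_addr addr0 -(mulr_natl _ (size _)).
    rewrite ler_pdivrMr// mul1r ler_nat size_map size_filter.
    rewrite (leq_trans (count_size _ _))// size_iota -ltnS.
    by rewrite ltn_half_double.
  rewrite /th /s_ le_eqVlt; apply/orP; left; apply/eqP; field.
  by rewrite !gt_eqF.
apply: (@le_trans _ _ (\sum_(r < n.+1.*2)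
    (P (rectangle X s A) * (expR (1 - (M + 1) * a))%:E)))%E.
  by apply: lee_sum => r _; exact: BE.
have -> : P (rectangle X s A) = (fine (P (rectangle X s A)))%:E.
  by rewrite fineK// fin_num_measure.
rewrite -!EFinM sumEFin sumr_const card_ord -(mulr_natl _ n.+1.*2) lee_fin.
rewrite mulrCA ler_wpM2l ?fine_ge0//.
have : n%:R * expR (- (1 * a)) <= (4 * expR 1)^-1.
  by rewrite /a; near: n; exact: near_natr_expR_speed_le.
rewrite mul1r -[leRHS]div1r ler_pdivlMr ?mulr_gt0 ?expR_gt0// => H.
have -> : 1 - (M + 1) * a = - (M * a) + (1 - a) by ring.
rewrite expRD mulrCA -[leRHS]mulr1 ler_wpM2l ?expR_ge0//.
apply: le_trans H; rewrite expRD -muln2 natrM -natr1.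
have n1 : 1 <= n%:R :> R by rewrite ler1n -(ltr0n R).
rewrite mulrA [leRHS](_ : _ = 4 * n%:R * expR 1 * expR (- a)); last by ring.
rewrite ler_wpM2r ?expR_ge0// ler_wpM2r ?expR_ge0//; lra.
Unshelve. all: by end_near. Qed.

(** Each summand contributes at most [1 + expR (al i) * P (Z > dl * n)] to the exponential moment.
    Half of the margin [eta] covers the tail asymptotics, the other half brings the second term
    below [n^-1]. The [d * n] factors then give at most [expR d], absorbed by the speed. *)
Lemma near_big_jumps_le (dl q q' : R) : 0 < dl -> 0 <= q -> q < q' ->
  \forall n \near \oo,
    (P [set w | (q' <= \sum_(i < d) \sum_(j < n)
       lambda i * (dl * n%:R < Z i j w)%R%:R)%R] <= (expR (- (q * a_ n)))%:E)%E.
Proof.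
move=> dl0 q0 qq'; have q'0 : 0 < q' by exact: le_lt_trans qq'.
(* Chosen so that [(1 - eta) * q'] is the midpoint of [q] and [q']. *)
pose eta := (q' - q) / (2 * q').
have eta0 : 0 < eta by rewrite divr_gt0 ?subr_gt0 ?mulr_gt0.
have etaE : (1 - eta) * q' = (q + q') / 2.
  by rewrite /eta; field; rewrite gt_eqF.
have eta1 : 0 < 1 - eta by rewrite -(pmulr_lgt0 _ q'0) etaE; lra.
have Hp : \forall n \near \oo, forall i : 'I_d,
    (P [set w | (dl * n%:R < Z i 0%N w)%R] <=
      (expR (- (lambda i * (1 - eta / 2) * a_ n)))%:E)%E.
  apply: filter_forall => i; apply: (near_tail_scale_le gamma_gt1 (Z_log_tail i)) => //.
  by rewrite gtr_pMr// ltrBlDr ltrDl divr_gt0.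
have Hn : \forall n \near \oo, forall i : 'I_d,
    n%:R * expR (- (lambda i * (eta / 2) * a_ n)) <= 1.
  apply: filter_forall => i; apply: near_natr_expR_speed_le => //.
  by rewrite mulr_gt0// divr_gt0.
near=> n.
have n0 : 0 < n%:R :> R by rewrite ltr0n; near: n; exists 1%N.
set a := a_ n.
have a1 : 1 <= a by rewrite /a; near: n; exact: near_speed_ge.
pose al i := lambda i * (1 - eta) * a.
have al0 i : 0 <= al i by rewrite !mulr_ge0 ?(ltW (lambda_gt0 i)) ?(ltW eta1) ?(le_trans _ a1).
pose J : set R := `]dl * n%:R, +oo[%classic.
have mJ : measurable J by exact: measurable_itv.
pose h (k : 'I_d * nat) x : R := al k.1 * \1_J x.
have indJ x : \1_J x = (dl * n%:R < x)%R%:R :> R.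
  by rewrite indicE /J; congr (nat_of_bool _)%:R; apply/idP/idP; rewrite inE/= in_itv/= andbT.
have mh k : measurable_fun setT (h k).
  by apply: measurable_funM => //; exact: measurable_indic.
pose u := [seq (i, j) | i <- index_enum 'I_d, j <- iota 0 n].
have uu : uniq ([::] ++ u).
  by apply: allpairs_uniq; rewrite ?index_enum_uniq ?iota_uniq// => -[? ?] [? ?].
have hr k : k \in u -> (\int[P]_w (expR (h k (X k w)))%:E <= (expR n%:R^-1)%:E)%E.
  case: k => i j _; rewrite /X/=.
  rewrite (Z_integral_eq i j (f := fun x => expR (h (i, j) x)))//; last first.
    exact: measurableT_comp.
  have mS : measurable [set w | (dl * n%:R < Z i 0%N w)%R].
    rewrite (_ : [set _ | _] = Z i 0%N @^-1` J); first exact: measurable_RV_preimage.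
    by apply/seteqP; split => w /=; rewrite /J/= in_itv/= andbT.
  apply: (@le_trans _ _ (\int[P]_w
      (1 + expR (al i) * \1_[set w | (dl * n%:R < Z i 0%N w)%R] w)%:E)%E).
    apply: ge0_le_integral => //.
    - apply/measurable_EFinP; apply: measurableT_comp => //.
      by apply: measurableT_comp => //; exact: measurable_funP.
    - apply/measurable_EFinP; apply: measurable_funD => //.
      by apply: measurable_funM => //; exact: measurable_indic.
    - move=> w _; rewrite lee_fin /h indJ/= indicE (_ : (w \in _) = (dl * n%:R < Z i 0%N w)%R).
        by case: ltP => _; rewrite ?mulr1 ?mulr0 ?expR0 ?addr0// lerDr.
      by apply/idP/idP; rewrite inE.
  under eq_integral do rewrite EFinD EFinM.
  rewrite ge0_integralD//; last first.
    by apply: measurable_funeM; apply/measurable_EFinP; exact: measurable_indic.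
  rewrite integral_cst//= probability_setT mule1 ge0_integralZl ?lee_fin ?expR_ge0//; last first.
    by apply/measurable_EFinP; exact: measurable_indic.
  rewrite integral_indic// setIT.
  have : (P [set w | (dl * n%:R < Z i 0%N w)%R] <=
      (expR (- (lambda i * (1 - eta / 2) * a)))%:E)%E by exact: (near Hp n).
  move=> /(lee_wpmul2l (_ : 0 <= (expR (al i))%:E)%E) H.
  apply: (@le_trans _ _ (1 + (n%:R^-1)%:E)%E); last by rewrite lee_fin expR_ge1Dx.
  rewrite leeD2l// (le_trans (H _)) ?lee_fin ?expR_ge0//.
  rewrite -expRD -[leRHS]mul1r ler_pdivlMr// [_ * n%:R]mulrC.
  rewrite (_ : al i - _ = - (lambda i * (eta / 2) * a)); last by rewrite /al; field.
  exact: (near Hn n).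
have := @chernoff_indep _ _ _ P _ X [::] u (fun=> setT) h (fun=> n%:R^-1)
    ((1 - eta) * q' * a) X_indep uu (fun=> measurableT) mh hr.
have -> : rectangle X [::] (fun=> setT) = setT by apply/seteqP; split.
rewrite setTI probability_setT mul1e => H.
apply: (le_trans (y := P [set w | ((1 - eta) * q' * a <= \sum_(k <- u) h k (X k w))%R])).
  rewrite le_eqVlt; apply/orP; left; apply/eqP; congr (P _); apply/seteqP.
  have E w : \sum_(k <- u) h k (X k w) = (1 - eta) * a *
     \sum_(i < d) \sum_(j < n) lambda i * (dl * n%:R < Z i j w)%R%:R.
    rewrite big_allpairs mulr_sumr; apply: eq_bigr => i _.
    rewrite mulr_sumr -[in LHS](subn0 n) -/(index_iota 0 n) big_mkord.
    by apply: eq_bigr => j _; rewrite /h indJ /al/X/=; ring.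
  have a0 : 0 < (1 - eta) * a by rewrite mulr_gt0// (lt_le_trans ltr01).
  by split=> w /=; rewrite E mulrAC ler_pM2l.
apply: (le_trans H); rewrite lee_fin ler_expR.
rewrite (_ : \sum_(k <- u) _ = d%:R); last first.
  rewrite big_allpairs.
  under eq_bigr do rewrite big_const_seq count_predT iter_addr addr0 size_iota
    -(mulr_natl (n%:R^-1) n) divff ?gt_eqF//.
  by rewrite sumr_const card_ord.
rewrite etaE.
have : d%:R / ((q' - q) / 2) <= a by rewrite /a; near: n; exact: near_speed_ge.
rewrite ler_pdivrMr ?divr_gt0 ?subr_gt0//; lra.
Unshelve. all: by end_near. Qed.

Let Y n w : sum_prod (skorokhod R) d :=
  fun i => walk (fun j => Z i j w) (mu i) n.

Definition big_jumps n (dl q : R) : set T :=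
  [set w | q <= \sum_(i < d) \sum_(j < n)
     lambda i * (dl * n%:R < Z i j w)%R%:R].

Lemma measurable_big_jumps n dl q : measurable (big_jumps n dl q).
Proof.
pose S w : R := \sum_(i < d) \sum_(j < n) lambda i * (dl * n%:R < Z i j w)%R%:R.
have mS : measurable_fun setT S.
  apply: measurable_sum => i; apply: measurable_sum => j.
  apply: measurable_funM => //.
  rewrite [X in measurable_fun _ X](_ : _ = (\1_(`]dl * n%:R, +oo[%classic) : R -> R) \o Z i j).
    by apply: measurableT_comp => //; exact: measurable_indic.
  apply/funext => w /=; rewrite indicE; congr (nat_of_bool _)%:R.
  by apply/idP/idP; rewrite inE/= in_itv/= andbT.
rewrite (_ : big_jumps n dl q = S @^-1` `[q, +oo[%classic).
  by rewrite -[X in measurable X](setTI (_ @^-1` _)); exact: mS.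
by apply/seteqP; split => w /=; rewrite in_itv/= andbT.
Qed.

(* [x] is the step path made of the jumps of [Y n w] larger than [dl * n]. *)
Lemma big_jump_path n (dl e : R) w : (0 < n)%N -> 0 < dl -> 0 <= e ->
    (forall i, ~ deviates i n dl e xpredT w) ->
  exists2 x : sum_prod (skorokhod R) d, forall i, dJ1 (Y n w i) (x i) <= e &
    rate_fun lambda x = (\sum_(i < d) \sum_(j < n)
       lambda i * (dl * n%:R < Z i j w)%R%:R)%:E.
Proof.
move=> n0 dl0 e0 ndev; pose b := dl * n%:R.
have b0 : 0 < b by rewrite mulr_gt0// ltr0n.
pose z i j := Z i j w - cut b (Z i j w).
exists (fun i => walk (z i) 0 n).
  move=> i; apply: walk_close => // k kn.
  rewrite leNgt; apply/negP => H; apply: (ndev i); exists k => //.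
  rewrite (le_trans (ltW H))// le_eqVlt; apply/orP; left; apply/eqP.
  by congr (`|_|); apply: eq_bigr => j _; rewrite /z /b /mu; ring.
rewrite (rate_fun_finite lambda (k := fun i => #|[pred j : 'I_n | 0 < z i j]|)); last first.
  by move=> i; apply: walk_step_path => // j; exact: cut_remainder_ge0.
congr EFin; apply: eq_bigr => i _; rewrite -mulr_sumr; congr (_ * _).
rewrite -sum1_card natr_sum big_mkcond; apply: eq_bigr => j _ /=.
by rewrite /z inE/= cut_big_jump//; case: ifP.
Qed.

Lemma walks_upper_bound (F : set (sum_prod (skorokhod R) d)) :
    (forall n, measurable (Y n @^-1` F)) ->
  (limn_esup (fun n : nat => lne (P (Y n @^-1` F)) / (a_ n)%:E) <=
   - lim (ereal_inf [set rate_fun lambda x | x in fattening F e] @[e --> 0%R^'+]))%E.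
Proof.
move=> mYF; apply: LDP_upper_lim => e0 e00.
set k := ereal_inf _; set L := limn_esup _.
have a0 : \forall n \near \oo, 0 < a_ n.
  by have := near_speed_ge 1 gamma_gt1; apply: filterS => n; exact: lt_le_trans.
(* [k] and [L] may be infinite, so the inequality is tested on reals [q < q'] with [q'] below the
   infimum. *)
suff H q q' : 0 <= q -> q < q' -> (q'%:E <= k)%E -> (L <= (- q)%:E)%E.
  have L0 : (L <= 0)%E.
    rewrite -[leRHS]oppe0 -EFinN; apply: limn_esup_lne_le => //.
    by apply: nearW => n; rewrite mul0r oppr0 expR0; exact: probability_le1.
  rewrite leNgt; apply/negP => lk.
  have [r rE] : exists r, (- L = r%:E)%E.
    move: L0 lk; case: (L) => [r _ _|//|_ /=]; first by exists (- r).
    by rewrite ltNge leey.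
  have r0 : 0 <= r by rewrite -lee_fin -rE leeNr oppe0.
  have [q [q' [q0 rq qq' q'k]]] : exists q q', [/\ 0 <= q, r < q, q < q' & (q'%:E <= k)%E].
    move: lk; rewrite rE; case: (k) => [s|_|//].
      rewrite lte_fin => rs; exists (r + (s - r) / 3), s; rewrite lexx; split => //; lra.
    by exists (r + 1), (r + 2); rewrite leey; split => //; lra.
  have := H _ _ q0 qq' q'k; rewrite -leeN2 rE -EFinN opprK lee_fin.
  by rewrite leNgt rq.
move=> q0 qq' q'k; apply: limn_esup_lne_le => //.
(* The gap from [q] to [qm] absorbs the factor [d + 1] of the union bound; the gap from [qm] to [q']
   is the one required by [near_big_jumps_le]. *)
pose qm := (q + q') / 2.
have q_qm : q < qm by rewrite /qm; lra.
have qm_q' : qm < q' by rewrite /qm; lra.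
have qm0 : 0 <= qm by rewrite (le_trans q0)// ltW.
pose e := e0 / d.+1%:R.
have e_gt0 : 0 < e by rewrite divr_gt0.
have [dl dl0 Hdl] : exists2 dl : R, 0 < dl & forall i, \forall n \near \oo,
    (P (deviates i n dl e xpredT) <= (expR (- (qm * a_ n)))%:E)%E.
  have : \forall dl \near (0 : R)^'+, forall i, \forall n \near \oo,
      (P (deviates i n dl e xpredT) <= (expR (- (qm * a_ n)))%:E)%E.
    apply: filter_forall => i.
    have [dl0 dl00 Hdl] := near_deviates_le i e_gt0 qm0.
    near=> dl.
    have /Hdl : 0 < dl <= dl0.
      by apply/andP; split => //; near: dl; exact: nbhs_right_le.
    apply: filterS => n /(_ [::] (fun=> setT) xpredT).
    have -> : rectangle (fun k => X k) [::] (fun=> setT) = setT by apply/seteqP; split.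
    rewrite setTI probability_setT mul1e; apply => //.
  move=> H; near (0 : R)^'+ => dl; exists dl => //.
  by near: dl; exact: H.
have Hj := near_big_jumps_le dl0 qm0 qm_q'.
near=> n.
have n0 : (0 < n)%N by near: n; exists 1%N.
(* The [d + 1] exceptional events in one list: index [m < d] is a deviation in coordinate [m], index
   [d] is the event of costly big jumps. *)
pose A m := if insub m is Some i then deviates (i : 'I_d) n dl e xpredT
  else big_jumps n dl q'.
have mA m : measurable (A m).
  rewrite /A; case: insub => [i|]; first exact: measurable_deviates.
  exact: measurable_big_jumps.
have PA (m : nat) : (P (A m) <= (expR (- (qm * a_ n)))%:E)%E.
  rewrite /A; case: insub => [i|]; last by near: n.
  by move: i; near: n; exact: filter_forall.
apply: (@le_trans _ _ (P (\big[setU/set0]_(m < d.+1) A m))).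
  apply: le_measure; rewrite ?inE//; first exact: bigsetU_measurable.
  move=> w YF; rewrite -bigcup_mkord.
  have [[i dev]|ndev] := pselect (exists i, deviates i n dl e xpredT w).
    exists (i : nat); first by rewrite /= ltnS ltnW.
    by rewrite /A valK.
  exists d; rewrite /= ?ltnS// /A; case: insubP => [i|_]; first by rewrite ltnn.
  rewrite /big_jumps/=.
  (* Without deviations the big-jump path [x] is within [e0] of [Y n w], hence in the fattening of
     [F]; its rate, which is the weighted number of big jumps, is therefore at least [q']. *)
  have [x xY Ix] := big_jump_path n0 dl0 (ltW e_gt0) (fun i dev => ndev (ex_intro _ i dev)).
  rewrite -lee_fin -Ix (le_trans q'k)//; apply: ereal_inf_lbound; exists x => //.
  apply: ge_ereal_inf; exists (mdist x (Y n w))%:E; first by exists (Y n w).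
  rewrite lee_fin metric_sym.
  rewrite [leLHS](_ : _ = \sum_(i < d) dJ1 (Y n w i) (x i))//.
  apply: (@le_trans _ _ (\sum_(i < d) e)); first by apply: ler_sum => i _; exact: xY.
  rewrite sumr_const card_ord -(mulr_natr _ d) /e mulrAC ler_pdivrMr//.
  by rewrite ler_wpM2l ?(ltW e00)// ler_nat.
apply: (le_trans (Boole_inequality _ _)) => //.
apply: (@le_trans _ _ (\sum_(m < d.+1) (expR (- (qm * a_ n)))%:E)%E).
  by apply: lee_sum => m _; exact: PA.
rewrite sumEFin sumr_const card_ord lee_fin -(mulr_natl _ d.+1).
rewrite -[X in X * _]lnK ?posrE// -expRD ler_expR.
have : ln d.+1%:R / (qm - q) <= a_ n by near: n; exact: near_speed_ge.
by rewrite ler_pdivrMr ?subr_gt0//; lra.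
Unshelve. all: by end_near. Qed.

(** The event [rect] that prescribes the jumps already has the required probability. The bad events,
    intersected with [rect], have total probability at most [P rect / 2], so at least half of [rect]
    leads into [G]. *)
Lemma walks_lower_bound_step (G : set (sum_prod (skorokhod R) d)) x
    (k : 'I_d -> nat) (z t : forall i, 'I_(k i) -> R) (eta : R) :
    open G -> G x -> (forall i, step_path (z i) (t i) (x i)) -> 0 < eta ->
    (forall n, measurable (Y n @^-1` G)) ->
  \forall n \near \oo,
    ((expR (- ((\sum_(i < d) lambda i * (k i)%:R + eta) * a_ n)))%:E <=
      P (Y n @^-1` G))%E.
Proof.
move=> oG Gx xst eta0 mYG.
have [e0 /= e00 He0] : exists2 e, 0 < e & ball x e `<=` G.
  by have /nbhs_ballP[e /= e0 He] := open_nbhs_nbhs (conj oG Gx); exists e.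
pose K := (\sum_(i < d) k i)%N.
have kK i : (k i <= K)%N by rewrite /K (bigD1 i)//= leq_addr.
pose e1 := e0 / d.+1%:R; have e10 : 0 < e1 by rewrite divr_gt0.
(* Makes the error [(2 * k i + 1) * eps] of [walk_near_step_path] at most [e1] in every
   coordinate. *)
pose eps := e1 / (2 * K%:R + 1).
have K0 : 0 < 2 * K%:R + 1 :> R by rewrite ltr_wpDl// mulr_ge0.
have eps0 : 0 < eps by rewrite divr_gt0.
(* [eta = (K + 1) * eta1]: one share for each of the [K] windows and one for the factor [1 / 2]. *)
pose eta1 := eta / K.+1%:R; have eta10 : 0 < eta1 by rewrite divr_gt0.
have t01 i a : 0 < t i a <= 1 by have [_ _ + _] := xst i; apply.
have z0 i a : 0 < z i a by have [+ _ _ _] := xst i; apply.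
have tinj i : injective (t i) by have [] := xst i.
have /choice[r Hr] : forall i, exists r, [/\ 0 < r,
    forall a b, a != b -> r <= `|t i a - t i b| &
    forall t' : 'I_(k i) -> R,
      (forall a, `|t' a - t i a| <= r) -> (forall a, t i a = 1 -> t' a = 1) ->
    exists l, [/\ time_change l, forall s, `|l s - s| <= e1 &
      forall a s, (t' a <= l s) = (t i a <= s)]].
  move=> i; have [r r0 Hr] := time_change_moving (tinj i) (t01 i) e10.
  have [r' r'0 Hr'] : exists2 r, 0 < r &
      {in [seq `|t i p.1 - t i p.2| | p <- enum {: 'I_(k i) * 'I_(k i)} & p.1 != p.2],
        forall x, r <= x}.
    apply: seq_gt0_lbound => y /mapP[[a b]]; rewrite mem_filter/= => /andP[ab _] ->.
    by rewrite normr_gt0 subr_eq0; apply: contra ab => /eqP/tinj ->.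
  exists (Num.min r r'); split; first by rewrite lt_min r0.
    move=> a b ab; rewrite (@le_trans _ _ r') ?ge_min ?lexx ?orbT//; apply: Hr'.
    by apply/mapP; exists (a, b) => //; rewrite mem_filter/= ab mem_enum.
  move=> t' tt'; apply: Hr => a; rewrite (le_trans (tt' a))//.
  by rewrite ge_min lexx.
(* The [d] deviation events cost at most [M] each and the [d * n] extra-jump events at most [M / n]
   each, relative to [rect]: in total [2 * M * d <= 1 / 2]. *)
pose M := (4 * d.+1%:R)^-1 : R.
have M0 : 0 < M by rewrite invr_gt0 mulr_gt0.
pose dev_ok (dl : R) i n : Prop :=
    forall (s : seq ('I_d * nat)) (A : 'I_d * nat -> set R) (Q : pred nat),
      uniq s -> (forall k, measurable (A k)) ->
      (forall j, Q j -> (i, j) \notin s) ->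
    (P (rectangle (fun k => X k) s A `&` deviates i n dl eps Q) <=
     P (rectangle (fun k => X k) s A) * (expR (- (1 * ln n%:R `^ gamma)))%:E)%E.
have [dl dl0 HD] : exists2 dl : R, 0 < dl &
    \forall n \near \oo, forall i, dev_ok dl i n.
  have H : \forall dl \near (0 : R)^'+, forall i, \forall n \near \oo,
    dev_ok dl i n.
    apply: filter_forall => i.
    have [dl0 dl00 Hdl] := near_deviates_le i eps0 ler01.
    near=> dl; apply: Hdl; apply/andP; split => //.
    by near: dl; exact: nbhs_right_le.
  near (0 : R)^'+ => dl; exists dl => //; apply: filter_forall.
  by near: dl; exact: H.
have HT : \forall n \near \oo, forall i : 'I_d,
    (P [set w | (dl * n%:R < Z i 0%N w)%R] <=
      (expR (- (lambda i / 2 * a_ n)))%:E)%E.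
  apply: filter_forall => i.
  apply: (near_tail_scale_le gamma_gt1 (Z_log_tail i)) => //.
  by rewrite ltr_pdivrMr// mulr_natr mulr2n ltrDl.
have Hn : \forall n \near \oo, forall i : 'I_d,
    n%:R * expR (- (lambda i / 2 * a_ n)) <= M.
  apply: filter_forall => i; apply: near_natr_expR_speed_le => //.
  by rewrite divr_gt0.
have HW : \forall n \near \oo, forall i (a : 'I_(k i)),
    ((expR (- ((lambda i + eta1) * a_ n)))%:E <=
      P [set w | (z i a * n%:R < Z i 0%N w <= (z i a + eps) * n%:R)%R])%E.
  apply: filter_forall => i; apply: filter_forall => a.
  apply: (near_tail_window_ge gamma_gt1 (lambda_gt0 i) (Z_log_tail i)) => //.
  by rewrite ltrDl.
(* [n^-1 < r i] serves twice: rounding the jump times to the grid stays within the displacement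
   allowed by the time change, and jump times at least [r i] apart get distinct indices. The other
   bound makes the centring of the prescribed summands negligible. *)
have Hmu : \forall n \near \oo, forall i, `|mu i| <= eps * n%:R /\ (n%:R^-1 < r i).
  apply: filter_forall => i; have [ri0 _ _] := Hr i; near=> n; split.
    by rewrite mulrC -ler_pdivrMr//; near: n; exact: nbhs_infty_ger.
  have n0 : 0 < n%:R :> R by rewrite ltr0n; near: n; exists 1%N.
  by rewrite invf_plt ?posrE//; near: n; exact: nbhs_infty_gtr.
near=> n.
have n0 : (0 < n)%N by near: n; exists 1%N.
have n0' : 0 < n%:R :> R by rewrite ltr0n.
set an := a_ n.
pose J i (a : 'I_(k i)) : nat := projT1 (cid (jump_index n0 (t01 i a))).
have JP i (a : 'I_(k i)) : [/\ (J i a < n)%N, (J i a)%:R < n%:R * t i a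
    & n%:R * t i a <= (J i a).+1%:R] by rewrite /J; case: cid.
have muP i : `|mu i| <= eps * n%:R /\ (n%:R^-1 < r i) by move: i; near: n.
have Jinj i : injective (J i).
  move=> a b Jab; apply/eqP; apply: contrapT => /negP ab.
  have [_ Hab _] := Hr i; have := lt_le_trans (muP i).2 (Hab _ _ ab).
  have [_ a1 a2] := JP i a; have [_ b1 b2] := JP i b.
  rewrite Jab in a1 a2.
  have : `|n%:R * t i a - n%:R * t i b| < 1.
    rewrite ltr_norml; move: a1 a2 b1 b2; rewrite -!natr1.
    by move: (J i b)%:R => ?; move=> *; apply/andP; split; lra.
  rewrite -mulrBr normrM ger0_norm; last exact: ltW.
  rewrite mulrC -ltr_pdivlMr// div1r => /lt_trans h /h.
  by rewrite ltxx.
pose W : finType := {i : 'I_d & 'I_(k i)}.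
pose key (a : W) : 'I_d * nat := (tag a, J (tag a) (tagged a)).
have key_inj : injective key.
  move=> [i a] [i' a'] [/= ii']; move: a a'; rewrite -ii' => a a' /Jinj.
  by move=> ->.
pose s := [seq key a | a <- index_enum W].
have us : uniq s by rewrite map_inj_uniq// index_enum_uniq.
pose win (a : W) : set R :=
  `]z (tag a) (tagged a) * n%:R, (z (tag a) (tagged a) + eps) * n%:R]%classic.
pose A (kk : 'I_d * nat) : set R := if [pick a | key a == kk] is Some a then win a else setT.
have mA kk : measurable (A kk).
  by rewrite /A; case: pickP => // a _; exact: measurable_itv.
have AE a : A (key a) = win a.
  rewrite /A; case: pickP => [b /eqP/key_inj ->//|/(_ a)].
  by rewrite eqxx.
set rect := rectangle (fun k => X k) s A.
have mrect : measurable rect by exact: measurable_rectangle.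
have Prect : ((expR (- ((\sum_(i < d) (lambda i + eta1) * (k i)%:R) * an)))%:E <= P rect)%E.
  rewrite rectangle_prob// big_map.
  apply: (@le_trans _ _ (\prod_(a <- index_enum W)
      (expR (- ((lambda (tag a) + eta1) * an)))%:E)%E).
    rewrite prodEFin -expR_sum lee_fin ler_expR sumrN lerN2 -mulr_suml.
    rewrite -(sig_big_dep xpredT (fun=> xpredT) (fun i (a : 'I_(k i)) => lambda i + eta1))/=.
    rewrite le_eqVlt; apply/orP; left; apply/eqP; congr (_ * _).
    by apply: eq_bigr => i _; rewrite sumr_const card_ord mulr_natr.
  apply: lee_prod_ge0 => a _; split; first by rewrite lee_fin expR_ge0.
  rewrite AE /key/= Z_prob_eq//; last exact: measurable_itv.
  rewrite [leRHS](_ : _ = P [set w | (z (tag a) (tagged a) * n%:R < Z (tag a) 0%N w <=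
     (z (tag a) (tagged a) + eps) * n%:R)%R]).
    by have := near HW n; apply.
  by congr (P _); apply/seteqP; split => w /=; rewrite /win/= in_itv.
pose Q i (j : nat) := j \notin codom (J i).
have Qs i j : Q i j -> (i, j) \notin s.
  apply: contra => /mapP[[i' a] _ [/= ii' jE]].
  by rewrite jE; move: a {jE}; rewrite -ii' => a; exact: codom_f.
pose B1 i := rect `&` deviates i n dl eps (Q i).
(* Outside these events every summand that is not prescribed equals its cut value, so [deviates]
   controls the true remainder of the walk. *)
pose B2 i (j : 'I_n) := if Q i j then rect `&` [set w | dl * n%:R < Z i j w] else set0.
have mB1 i : measurable (B1 i).
  by apply: measurableI => //; exact: measurable_deviates.
have mB2 i j : measurable (B2 i j).
  by rewrite /B2; case: ifP => // _; apply: measurableI => //; exact: measurable_RV_gt.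
have PB1 i : (P (B1 i) <= P rect * M%:E)%E.
  apply: (@le_trans _ _ (P rect * (expR (- (1 * an)))%:E)%E).
    by have := near HD n; apply => //; exact: Qs.
  rewrite lee_wpmul2l// lee_fin mul1r.
  have : n%:R * expR (- (1 * an)) <= M.
    by rewrite /an; near: n; exact: near_natr_expR_speed_le.
  rewrite mul1r; apply: le_trans; rewrite ler_peMl ?expR_ge0//.
  by rewrite ler1n.
have PB2 i j : (P (B2 i j) <= P rect * (M / n%:R)%:E)%E.
  rewrite /B2; case: ifPn => [Qij|_]; last first.
    by rewrite measure0 mule_ge0// lee_fin divr_ge0// ltW.
  pose Jt : set R := `]dl * n%:R, +oo[%classic.
  have -> : [set w | dl * n%:R < Z i j w] = X (i, nat_of_ord j) @^-1` Jt.
    by apply/seteqP; split => w /=; rewrite /Jt/= in_itv/= andbT.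
  rewrite rectangle_setI//; [|exact: Qs|exact: measurable_itv].
  rewrite lee_wpmul2l// /X/= Z_prob_eq//; last exact: measurable_itv.
  apply: (@le_trans _ _ (expR (- (lambda i / 2 * an)))%:E).
    rewrite [leLHS](_ : _ = P [set w | (dl * n%:R < Z i 0%N w)%R]).
      by have := near HT n; apply.
    by congr (P _); apply/seteqP; split => w /=; rewrite /Jt/= in_itv/= andbT.
  rewrite lee_fin ler_pdivlMr// mulrC.
  by have := near Hn n; apply.
have incl : rect `<=` (Y n @^-1` G) `|` (\big[setU/set0]_(i : 'I_d) B1 i `|`
    \big[setU/set0]_(i : 'I_d) \big[setU/set0]_(j : 'I_n) B2 i j).
  move=> w Rw.
  have [[i B1i]|nB1] := pselect (exists i, B1 i w).
    right; left; rewrite -bigcup_seq; exists i => //=.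
    by rewrite mem_index_enum.
  have [[i [j B2ij]]|nB2] := pselect (exists i j, B2 i j w).
    right; right; rewrite -bigcup_seq; exists i => //=.
      by rewrite mem_index_enum.
    by rewrite -bigcup_seq; exists j => //=; rewrite mem_index_enum.
  left; apply: He0; rewrite ballEmdist/=.
  rewrite [ltLHS](_ : _ = \sum_(i < d) dJ1 (x i) (Y n w i))//.
  apply: (@le_lt_trans _ _ (\sum_(i < d) e1)); last first.
    rewrite sumr_const card_ord -(mulr_natr _ d) /e1 mulrAC ltr_pdivrMr//.
    by rewrite ltr_pM2l// ltr_nat.
  apply: ler_sum => i _; rewrite dJ1_sym.
  have [_ _ Hri] := Hr i.
  have [a||l [tl le Jl]] := Hri (fun a => (J i a).+1%:R / n%:R).
  - have [J1 J2 J3] := JP i a.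
    rewrite ger0_norm; last by rewrite subr_ge0 ler_pdivlMr// mulrC.
    rewrite (le_trans _ (ltW (muP i).2))// lerBlDr -(ler_pM2r n0') mulrDl.
    rewrite divfK ?gt_eqF// mulVf ?gt_eqF// -natr1 addrC lerD2l mulrC ltW//.
  - move=> a ta1; have [J1 J2 J3] := JP i a.
    have -> : (J i a).+1 = n; last by rewrite divff// gt_eqF.
    apply/eqP; rewrite eqn_leq J1 -(ler_nat R) (le_trans _ J3)//.
    by rewrite ta1 mulr1.
  have := @walk_near_step_path R (k i) (z i) (t i) (x i) n (fun j => Z i j w) (mu i)
    (J i) l e1 eps (xst i) n0 (Jinj i) tl le Jl _ (muP i).1 _.
  have -> : Num.max e1 ((2 * (k i)%:R + 1) * eps) = e1.
    apply: max_l; rewrite /eps mulrCA ger_pMr// ler_pdivrMr// mul1r lerD2r.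
    by rewrite ler_pM2l// ler_nat.
  apply.
    move=> a; have : A (key (Tagged _ a)) (X (key (Tagged _ a)) w).
      by apply: Rw; rewrite /= map_f// mem_index_enum.
    rewrite AE /win/= in_itv/= => /andP[w1 w2].
    rewrite ger0_norm; last by rewrite subr_ge0 ltW.
    by rewrite lerBlDl -mulrDl.
  move=> m mn; rewrite leNgt; apply/negP => H; apply: nB1; exists i; split => //.
  exists m => //; rewrite (le_trans (ltW H))// le_eqVlt; apply/orP; left; apply/eqP.
  congr (`|_|); rewrite big_seq_cond [RHS]big_seq_cond; apply: eq_bigr => j.
  rewrite mem_iota add0n => /andP[/andP[_ jm] Qj]; rewrite /cut; case: ifPn => //.
  rewrite -ltNge => Zj; case: nB2; exists i, (Ordinal (leq_trans jm mn)).
  by rewrite /B2/= /Q Qj.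
have PG : (P rect <= P (Y n @^-1` G) + P rect * (2^-1)%:E)%E.
  have mU1 : measurable (\big[setU/set0]_(i : 'I_d) B1 i) by exact: bigsetU_measurable.
  have mU2 i : measurable (\big[setU/set0]_(j : 'I_n) B2 i j) by exact: bigsetU_measurable.
  have mU3 : measurable (\big[setU/set0]_(i : 'I_d) \big[setU/set0]_(j : 'I_n) B2 i j).
    exact: bigsetU_measurable.
  apply: (@le_trans _ _ (P ((Y n @^-1` G) `|` (\big[setU/set0]_(i : 'I_d) B1 i `|`
    \big[setU/set0]_(i : 'I_d) \big[setU/set0]_(j : 'I_n) B2 i j)))).
    by apply: le_measure; rewrite ?inE//; apply: measurableU => //; exact: measurableU.
  rewrite (le_trans (measureU2 _ _ _))//; first exact: measurableU.
  rewrite leeD2l// (le_trans (measureU2 _ _ _))//.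
  apply: (@le_trans _ _ (\sum_(i < d) (P rect * M%:E) +
    \sum_(i < d) \sum_(j < n) (P rect * (M / n%:R)%:E))%E).
    apply: leeD.
      by rewrite (le_trans (prob_bigsetU_le _ _ _))//; apply: lee_sum => i _.
    rewrite (le_trans (prob_bigsetU_le _ _ _))//; apply: lee_sum => i _.
    by rewrite (le_trans (prob_bigsetU_le _ _ _))//; apply: lee_sum => j _.
  have -> : P rect = (fine (P rect))%:E by rewrite fineK// fin_num_measure.
  have p0 : 0 <= fine (P rect) by exact: fine_ge0.
  move: (fine _) p0 => p p0; rewrite -!EFinM !sumEFin.
  rewrite -EFinD lee_fin !sumr_const !card_ord.
  rewrite -(mulr_natr (p * M) d) -(mulr_natr (p * (M / n%:R) *+ n) d).
  rewrite -(mulr_natr (p * (M / n%:R)) n).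
  rewrite (_ : p * M * d%:R + _ = p * (2 * M * d%:R)); last by field; rewrite gt_eqF.
  rewrite ler_wpM2l// /M invfM mulrA mulrAC ler_pdivrMr//.
  rewrite (_ : 2 * 4^-1 = 2^-1 :> R); last by field.
  by rewrite ler_pM2l ?invr_gt0// ler_nat.
have : ln 2 / (eta / K.+1%:R) <= an by rewrite /an; near: n; exact: near_speed_ge.
rewrite ler_pdivrMr// => an2.
apply: (@le_trans _ _ (P rect * (2^-1)%:E)%E); last first.
  have -> : P rect = (fine (P rect))%:E by rewrite fineK// fin_num_measure.
  move: PG; have -> : P rect = (fine (P rect))%:E by rewrite fineK// fin_num_measure.
  have -> : P (Y n @^-1` G) = (fine (P (Y n @^-1` G)))%:E by rewrite fineK// fin_num_measure.
  by rewrite -EFinM -EFinD !lee_fin; lra.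
apply: le_trans (lee_wpmul2r _ Prect); last by rewrite lee_fin invr_ge0.
rewrite -EFinM lee_fin (_ : 2^-1 = expR (- ln 2)); last by rewrite expRN lnK ?posrE.
rewrite -expRD ler_expR (_ : \sum_(i < d) (lambda i + eta1) * (k i)%:R =
  \sum_(i < d) lambda i * (k i)%:R + eta1 * K%:R); last first.
  by rewrite natr_sum mulr_sumr -big_split/=; apply: eq_bigr => i _; ring.
have -> : eta = eta1 * K%:R + eta1.
  by rewrite /eta1 -natr1; field; rewrite natr1 gt_eqF.
by move: an2; rewrite -/eta1; lra.
Unshelve. all: by end_near. Qed.

Lemma walks_lower_bound (G : set (sum_prod (skorokhod R) d)) :
    open G -> (forall n, measurable (Y n @^-1` G)) ->
  (- ereal_inf [set rate_fun lambda x | x in G] <=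
    limn_einf (fun n : nat => lne (P (Y n @^-1` G)) / (a_ n)%:E))%E.
Proof.
move=> oG mYG; rewrite leeNl; apply: le_ereal_inf_tmp => _ [x Gx <-].
have [->|[k -> kP]] := rate_funP lambda x; first exact: leey.
apply/lee_addgt0Pr => eta eta0; rewrite leeNl -EFinD -EFinN.
apply: limn_einf_lne_ge.
  by have := near_speed_ge 1 gamma_gt1; apply: filterS => n; exact: lt_le_trans.
pose z i := projT1 (cid (kP i)); pose zP i := projT2 (cid (kP i)).
exact: (walks_lower_bound_step oG Gx (fun i => projT2 (cid (zP i)))).
Qed.

End heavy_tailed_families.

(* Z i j is the (j+1)-st term of the i-th sequence *)
Theorem theorem3p5 (R : realType) (dT : measure_display)
    (T : measurableType dT) (P : probability T R)
    (d : nat) (gamma c beta : R) (lambda : 'I_d -> R)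
    (Z : 'I_d -> nat -> {RV P >-> R})
    (d_ge1 : (1 <= d)%N) (gamma_gt1 : 1 < gamma) (c_gt0 : 0 < c)
    (lambda_gt0 : forall i, 0 < lambda i)
    (Z_iid : forall i, iid (Z i))
    (Z_ge0 : forall i j, {ae P, forall w, 0 <= Z i j w})
    (Z_tail : forall i, \forall x \near +oo,
      P [set w | x < Z i 0%N w] =
      (c * x `^ beta * expR (- (lambda i * (ln x) `^ gamma)))%:E)
    (Z_indep : mutually_independent P (fun i => sigma_RVs (Z i))) :
  extended_LDP P
    (fun (n : nat) (w : T) =>
      (fun i => walk (fun j => Z i j w) (fine 'E_P[Z i 0%N]%E) n)
        : sum_prod (skorokhod R) d)
    (rate_fun lambda)
    (fun n : nat => (ln n%:R) `^ gamma).
Proof.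
have mY n (G : set (sum_prod (skorokhod R) d)) : open G ->
    measurable ((fun w => (fun i => walk (fun j => Z i j w) (fine 'E_P[Z i 0%N]%E) n)
      : sum_prod (skorokhod R) d) @^-1` G).
  move=> oG.
  have mZ i j : measurable_fun setT (Z i j) by exact: measurable_funP.
  exact: (measurable_walks n (fun i => fine 'E_P[Z i 0%N]%E) mZ oG).
split.
- by move=> n G; exact: mY.
- by apply/cvgryPge => A; exact: near_speed_ge.
- by move=> x; exact: rate_fun_ge0.
- exact: rate_fun_lower_semicontinuous.
- move=> G oG.
  exact: (walks_lower_bound gamma_gt1 c_gt0 lambda_gt0 Z_iid Z_ge0 Z_tail Z_indep
    oG (fun n => mY n G oG)).
- move=> F cF.
  have mF n : measurable ((fun w => (fun i =>
      walk (fun j => Z i j w) (fine 'E_P[Z i 0%N]%E) n)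
      : sum_prod (skorokhod R) d) @^-1` F).
    rewrite -[F]setCK preimage_setC; apply: measurableC.
    exact: mY n _ (closed_openC cF).
  exact: (walks_upper_bound gamma_gt1 c_gt0 lambda_gt0 Z_iid Z_ge0 Z_tail Z_indep mF).
Qed.
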